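(* Let $X$ be an extremally disconnected realcompact space. Let $S\subseteq X$ be the union of the supports of all order continuous functionals on $\mathrm{C}(X)$. The following statements are equivalent. (i) There exists a vector lattice $\mathrm{E}$ such that $\mathrm{C}(X)$ is lattice isomorphic to the order dual $\mathrm{E}^\sim$. (ii) $\mathrm{C}(X)$ is perfect. (iii) $\upsilon S = X$. (iv) The map $P_{\mathrm{M}_{\mathrm n}}:\mathrm{C}(X)\to \varprojlim \mathcal{I}_{\mathrm{M}_{\mathrm n}}$ is a lattice isomorphism, where $\mathrm{M}_{\mathrm n}=\{\mathrm{C}_\varphi : 0\le\varphi\in \mathrm{C}(X)^\sim_{\mathrm n}\}$ is the collection of carriers of all positive order continuous functionals on $\mathrm{C}(X)$.
   Context: $\mathrm{C}(X)$ is the vector lattice of continuous real-valued functions on $X$. A realcompact space is a Tychonoff space homeomorphic to a closed subset of some product of copies of $\mathbb{R}$; for a Tychonoff space $Y$, $\upsilon Y$ denotes its (Hewitt) realcompactification, the unique realcompact space with $\mathrm{C}(Y)\cong \mathrm{C}(\upsilon Y)$ as vector lattices. The condition $\upsilon S=X$ means that the restriction map $\mathrm{C}(X)\ni u\mapsto u|_S\in \mathrm{C}(S)$ is a lattice isomorphism. $X$ is extremally disconnected if the closure of every open set is open. For a vector lattice $\mathrm{E}$, $\mathrm{E}^\sim$ is the vector lattice of order bounded linear functionals on $\mathrm{E}$, and $\mathrm{E}^\sim_{\mathrm n}$ is the sublattice of order continuous functionals ($\varphi$ is order continuous if $\inf|\varphi[A]|=0$ whenever $A\downarrow 0$, i.e.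 $A$ is downward directed with $\inf A=0$). $\mathrm{E}$ is perfect if the canonical map $\mathrm{E}\ni u\mapsto \Psi_u\in (\mathrm{E}^\sim_{\mathrm n})^\sim_{\mathrm n}$, $\Psi_u(\varphi)=\varphi(u)$, is a lattice isomorphism onto $(\mathrm{E}^\sim_{\mathrm n})^\sim_{\mathrm n}$. Support of a functional: for realcompact $X$, each order bounded functional $\varphi$ on $\mathrm{C}(X)$ is of the form $\varphi(u)=\int_X u\,d\mu_\varphi$ for a unique compactly supported signed Radon measure $\mu_\varphi$ on $X$; the support of $\varphi$ is the support of $\mu_\varphi$, i.e. the set of $x\in X$ with $|\mu_\varphi|(U)>0$ for all open $U\ni x$. For $\varphi\in \mathrm{E}^\sim$, its null ideal is $\mathrm{N}_\varphi=\{u\in\mathrm{E}: |\varphi|(|u|)=0\}$ and its carrier is $\mathrm{C}_\varphi=\mathrm{N}_\varphi^d=\{u: |u|\wedge|v|=0 \text{ for all } v\in \mathrm{N}_\varphi\}$. Since $X$ is extremally disconnected, $\mathrm{C}(X)$ is Dedekind complete, so every carrier is a projection band. Given a collection $\mathrm{M}$ of projection bands in a vector lattice $\mathrm{E}$ that is upward directed under inclusion, let $P_{\mathrm B}:\mathrm{E}\to \mathrm B$ be the band projection onto $\mathrm B\in \mathrm{M}$. The inverse system $\mathcal{I}_{\mathrm{M}}$ consists of the bands $\mathrm B\in \mathrm{M}$ (indexed by inclusion) and, for $\mathrm A\subseteq \mathrm B$ in $\mathrm M$, the band projection $P_{\mathrm B,\mathrm A}=P_{\mathrm A}|_{\mathrm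 B}:\mathrm B\to \mathrm A$. Its inverse limit is $\varprojlim\mathcal{I}_{\mathrm{M}}=\{(u_{\mathrm B})\in\prod_{\mathrm B\in\mathrm{M}}\mathrm B : P_{\mathrm B,\mathrm A}(u_{\mathrm B})=u_{\mathrm A} \text{ whenever } \mathrm A\subseteq \mathrm B\}$, a sublattice of the product with coordinatewise operations, and $P_{\mathrm{M}}(u)=(P_{\mathrm B}(u))_{\mathrm B\in\mathrm{M}}$. *)

(* Defs.v *)
From HB Require Import structures.
From mathcomp Require Import all_boot all_order all_algebra.
From mathcomp Require Import all_classical all_reals all_analysis.
From mathcomp Require Import lra.

Set Implicit Arguments.
Unset Strict Implicit.
Unset Printing Implicit Defensive.

Import Order.TTheory GRing.Theory Num.Theory.
Import numFieldNormedType.Exports.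

Local Open Scope classical_set_scope.
Local Open Scope ring_scope.

(* The lattice operations are part of this mixin rather than inherited from   *)
(* [Order.Lattice]: the join of [Order.Lattice ring_display] with the         *)
(* algebraic hierarchy lacks the intermediate structures HB asks for.         *)
HB.mixin Record isVectorLattice (R : realType) V
    of GRing.Lmodule R V & Order.POrder ring_display V := {
  vl_leD2r : forall z x y : V, x <= y -> x + z <= y + z;
  vl_scale_ge0 : forall (a : R) (x : V), 0 <= a -> 0 <= x -> 0 <= a *: x;
  vl_join : V -> V -> V;
  vl_meet : V -> V -> V;
  vl_joinP : forall x y z : V, (vl_join x y <= z) = (x <= z) && (y <= z);
  vl_meetP : forall x y z : V, (z <= vl_meet x y) = (z <= x) && (z <= y)
}.

#[short(type="vectorLatticeType")]
HB.structure Definition VectorLattice (R : realType) :=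
  {V of GRing.Lmodule R V & Order.POrder ring_display V
      & isVectorLattice R V}.

Section VectorLatticeTheory.
Context {R : realType} {V : vectorLatticeType R}.
Implicit Types x y z : V.

Definition vl_abs x : V := vl_join x (- x).

Definition downward_directed (A : set V) :=
  forall x y, A x -> A y -> exists z, [/\ A z, z <= x & z <= y].

Definition decreases_to0 (A : set V) :=
  [/\ A !=set0, downward_directed A & infimums A 0].

Lemma vl_joinl x y : x <= vl_join x y.
Proof. by have := vl_joinP x y (vl_join x y); rewrite lexx => /esym/andP[]. Qed.

Lemma vl_joinr x y : y <= vl_join x y.
Proof. by have := vl_joinP x y (vl_join x y); rewrite lexx => /esym/andP[]. Qed.

Lemma vl_meetl x y : vl_meet x y <= x.
Proof. by have := vl_meetP x y (vl_meet x y); rewrite lexx => /esym/andP[]. Qed.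

Lemma vl_meetr x y : vl_meet x y <= y.
Proof. by have := vl_meetP x y (vl_meet x y); rewrite lexx => /esym/andP[]. Qed.

Lemma vl_leD2rE z x y : (x + z <= y + z) = (x <= y).
Proof.
apply/idP/idP; last exact: vl_leD2r.
by move=> /(vl_leD2r (- z)); rewrite !addrK.
Qed.

Lemma vl_subr_ge0 x y : (0 <= y - x) = (x <= y).
Proof. by rewrite -(vl_leD2rE x 0) add0r subrK. Qed.

Lemma vl_leBl x y z : (x - z <= y) = (x <= y + z).
Proof. by rewrite -[LHS](vl_leD2rE z) subrK. Qed.

Lemma vl_leBlC x y z : (x - z <= y) = (x - y <= z).
Proof. by rewrite !vl_leBl addrC. Qed.

Lemma vl_addr_ge0 x y : 0 <= x -> 0 <= y -> 0 <= x + y.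
Proof.
move=> x0 y0; apply: (le_trans y0).
by rewrite -{1}[y]add0r vl_leD2rE.
Qed.

Lemma vl_leN2 x y : (- x <= - y) = (y <= x).
Proof. by rewrite -[LHS]vl_subr_ge0 opprK addrC vl_subr_ge0. Qed.

Definition vl_pos x : V := vl_join x 0.
Definition vl_neg x : V := vl_pos x - x.

Lemma vl_pos_ge0 x : 0 <= vl_pos x. Proof. exact: vl_joinr. Qed.
Lemma vl_neg_ge0 x : 0 <= vl_neg x.
Proof. by rewrite vl_subr_ge0 vl_joinl. Qed.
Lemma vl_posBneg x : vl_pos x - vl_neg x = x.
Proof. by rewrite opprB addrC subrK. Qed.

Lemma vl_decomp x : exists p q : V, [/\ 0 <= p, 0 <= q & x = p - q].
Proof.
exists (vl_pos x), (vl_neg x); rewrite vl_posBneg.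
by split; [exact: vl_pos_ge0|exact: vl_neg_ge0|].
Qed.

Lemma vl_scale_le (a : R) x y : 0 <= a -> x <= y -> a *: x <= a *: y.
Proof.
by move=> a0 xy; rewrite -[_ <= _]vl_subr_ge0 -scalerBr vl_scale_ge0// vl_subr_ge0.
Qed.

Lemma riesz_decomposition x y z : 0 <= x -> 0 <= y -> 0 <= z -> z <= x + y ->
  exists z1 z2, [/\ 0 <= z1, z1 <= x, 0 <= z2, z2 <= y & z = z1 + z2].
Proof.
move=> x0 y0 z0 zxy; exists (vl_meet z x), (z - vl_meet z x); split.
- by rewrite vl_meetP z0.
- exact: vl_meetr.
- by rewrite vl_subr_ge0 vl_meetl.
- rewrite vl_leBlC vl_meetP !vl_leBl zxy andbT.
  by rewrite -vl_subr_ge0 addrAC subrr add0r.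
- by rewrite addrC subrK.
Qed.

Section cone_extension.
Variable f : V -> R.
Hypothesis fD : forall x y, 0 <= x -> 0 <= y -> f (x + y) = f x + f y.
Hypothesis fZ : forall (a : R) x, 0 <= a -> 0 <= x -> f (a *: x) = a * f x.

Definition cone_ext x : R^o := f (vl_pos x) - f (vl_neg x).

Lemma cone_extB x y : 0 <= x -> 0 <= y -> cone_ext (x - y) = f x - f y.
Proof.
move=> x0 y0; rewrite /cone_ext; set z := x - y.
have : f (x + vl_neg z) = f (y + vl_pos z).
  have xz : x - z = y by rewrite /z opprB addrC subrK.
  by rewrite /vl_neg addrCA xz addrC.
rewrite (fD x0 (vl_neg_ge0 z)) (fD y0 (vl_pos_ge0 z)).
by move: (f x) (f y) (f (vl_pos z)) (f (vl_neg z)); clear -R => a b c d; lra.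
Qed.

Lemma cone_extE x : 0 <= x -> cone_ext x = f x.
Proof.
move=> x0; rewrite -[x in LHS]subr0 cone_extB//.
have /= := @fZ 0 0 (lexx _) (lexx _).
by rewrite scaler0 mul0r => ->; rewrite subr0.
Qed.

Lemma cone_ext_linear : linear cone_ext.
Proof.
have extZ a x : 0 <= a -> cone_ext (a *: x) = a * cone_ext x.
  move=> a0; rewrite -[x in LHS]vl_posBneg scalerBr.
  rewrite cone_extB ?vl_scale_ge0 ?vl_pos_ge0 ?vl_neg_ge0//.
  by rewrite !fZ ?vl_pos_ge0 ?vl_neg_ge0// -mulrBr.
have extN x : cone_ext (- x) = - cone_ext x.
  rewrite -[x in LHS]vl_posBneg opprB cone_extB ?vl_pos_ge0 ?vl_neg_ge0//.
  by rewrite /cone_ext opprB.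
have extD x y : cone_ext (x + y) = cone_ext x + cone_ext y.
  rewrite -[x in LHS]vl_posBneg -[y in LHS]vl_posBneg addrACA -opprD.
  rewrite (cone_extB (vl_addr_ge0 (vl_pos_ge0 x) (vl_pos_ge0 y))
    (vl_addr_ge0 (vl_neg_ge0 x) (vl_neg_ge0 y))).
  rewrite (fD (vl_pos_ge0 x) (vl_pos_ge0 y)) (fD (vl_neg_ge0 x) (vl_neg_ge0 y)).
  by rewrite /cone_ext opprD addrACA.
move=> a x y; rewrite extD; congr (_ + _).
have [a0|a0] := leP 0 a; first exact: extZ.
rewrite -{1}[a]opprK scaleNr extN extZ; last by rewrite oppr_ge0 ltW.
by rewrite mulNr opprK.
Qed.

End cone_extension.

End VectorLatticeTheory.

Section OrderDual.
Context {R : realType} (E : vectorLatticeType R).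
Implicit Types f g : E -> R^o.

Definition order_bounded f :=
  forall x y, exists M : R, forall z, x <= z -> z <= y -> `|f z| <= M.

Definition obl_functional : {pred E -> R^o} :=
  fun f => `[< linear f /\ order_bounded f >].

Lemma obl_functional_submod : submod_closed obl_functional.
Proof.
split.
  apply/asboolP; split; first by move=> a x y;
    rewrite [RHS](_ : _ = 0) // scaler0 addr0.
  by move=> x y; exists 0 => z _ _; rewrite normr0.
move=> a f g /asboolP[lf bf] /asboolP[lg bg]; apply/asboolP; split.
  move=> b x y; rewrite !fctE lf lg !scalerDr !scalerA [a * b]mulrC.
  by rewrite addrACA.
move=> x y; have [M fM] := bf x y; have [N gN] := bg x y.
exists (`|a| * M + N) => z xz zy; rewrite !fctE.
apply: (le_trans (ler_normD _ _)); apply: lerD; last exact: gN.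
by rewrite normrM; apply: ler_wpM2l => //; exact: fM.
Qed.

HB.instance Definition _ :=
  GRing.isSubmodClosed.Build R (E -> R^o) obl_functional obl_functional_submod.

Record order_dual := OrderDual {
  odual_fun :> E -> R^o;
  _ : obl_functional odual_fun }.

HB.instance Definition _ := [isSub for odual_fun].
HB.instance Definition _ := [Choice of order_dual by <:].
HB.instance Definition _ := [SubChoice_isSubLmodule of order_dual by <:].

Implicit Types phi psi : order_dual.

Lemma odual_linear phi : linear (odual_fun phi).
Proof. by case: phi => f /= /asboolP[]. Qed.

Lemma odual_bounded phi : order_bounded phi.
Proof. by case: phi => f /= /asboolP[]. Qed.

HB.instance Definition _ phi :=
  GRing.isLinear.Build R E R^o *:%R (odual_fun phi) (odual_linear phi).

Lemma odualB phi (x y : E) : phi (x - y) = phi x - phi y.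
Proof. exact: linearB. Qed.

Lemma odual_eqP phi psi : (forall x : E, 0 <= x -> phi x = psi x) -> phi = psi.
Proof.
move=> eq_pos; apply/val_inj/funext => x /=.
have [p [q [p0 q0 ->]]] := vl_decomp x.
by rewrite !linearB/= !eq_pos.
Qed.

Definition odual_le : rel order_dual :=
  fun phi psi => `[< forall x : E, 0 <= x -> phi x <= psi x >].

Lemma odual_le_refl : reflexive odual_le.
Proof. by move=> phi; apply/asboolP. Qed.

Lemma odual_le_anti : antisymmetric odual_le.
Proof.
move=> phi psi /andP[/asboolP le1 /asboolP le2]; apply: odual_eqP => x x0.
by apply/le_anti; rewrite le1// le2.
Qed.

Lemma odual_le_trans : transitive odual_le.
Proof.
move=> psi phi chi /asboolP le1 /asboolP le2; apply/asboolP => x x0.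
exact: le_trans (le1 _ x0) (le2 _ x0).
Qed.

HB.instance Definition _ := Order.Le_isPOrder.Build ring_display order_dual
  odual_le_refl odual_le_anti odual_le_trans.

Lemma odual_leP phi psi :
  reflect (forall x : E, 0 <= x -> phi x <= psi x) (phi <= psi).
Proof. exact: asboolP. Qed.

Lemma odual_mono phi x y : 0 <= phi -> x <= y -> phi x <= phi y.
Proof.
move=> /odual_leP phi0 xy; rewrite -subr_ge0 -linearB.
by apply: phi0; rewrite vl_subr_ge0.
Qed.

Lemma positive_obl f : linear f -> (forall x, 0 <= x -> 0 <= f x) ->
  obl_functional f.
Proof.
move=> lf f0; apply/asboolP; split=> // x y.
have fB u v : f (u - v) = f u - f v.
  by rewrite addrC -scaleN1r lf scaleN1r addrC.
have fm u v : u <= v -> f u <= f v.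
  by move=> uv; rewrite -subr_ge0 -fB f0// vl_subr_ge0.
exists (`|f x| + `|f y|) => z /fm xz /fm zy.
rewrite ler_norml; apply/andP; split.
  by rewrite (le_trans _ xz)// lerNl (le_trans (ler_norm _))// normrN lerDl.
by rewrite (le_trans zy)// (le_trans (ler_norm _))// lerDr.
Qed.

Section positive_part.
Variable phi : order_dual.

(* Riesz-Kantorovich: for [x >= 0], the positive part of [phi] takes the      *)
(* value [sup {phi y | 0 <= y <= x}] at [x].                                  *)
Definition odual_interval_image (x : E) : set R :=
  [set (phi y : R) | y in [set y | 0 <= y /\ y <= x]].

Definition odual_pos_cone (x : E) : R := sup (odual_interval_image x).

Let I := odual_interval_image.

Lemma odual_interval_image_has_sup x : 0 <= x -> has_sup (I x).
Proof.
move=> x0; split; first by exists (phi 0), 0.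
have [M PM] := odual_bounded phi 0 x; exists M => _ [y [y0 yx] <-].
by apply: (le_trans (ler_norm _)); exact: PM.
Qed.

Lemma odual_pos_cone_ub x y : 0 <= y -> y <= x -> phi y <= odual_pos_cone x.
Proof.
move=> y0 yx; apply: ub_le_sup; last by exists y.
by apply: (odual_interval_image_has_sup (le_trans y0 yx)).2.
Qed.

Lemma odual_pos_cone_le x (M : R) : 0 <= x ->
  (forall y, 0 <= y -> y <= x -> phi y <= M) -> odual_pos_cone x <= M.
Proof.
move=> x0 xM; apply: ge_sup; first exact: (odual_interval_image_has_sup x0).1.
by move=> _ [y [y0 yx] <-]; exact: xM.
Qed.

Lemma odual_pos_coneD x y : 0 <= x -> 0 <= y ->
  odual_pos_cone (x + y) = odual_pos_cone x + odual_pos_cone y.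
Proof.
move=> x0 y0; apply/le_anti/andP; split.
  apply: odual_pos_cone_le; first exact: vl_addr_ge0.
  move=> z z0 /(riesz_decomposition x0 y0 z0)[z1 [z2 [z10 z1x z20 z2y ->]]].
  by rewrite linearD lerD// odual_pos_cone_ub.
rewrite -lerBrDr; apply: odual_pos_cone_le => // u u0 ux.
rewrite lerBrDr addrC -lerBrDr; apply: odual_pos_cone_le => // v v0 vy.
rewrite lerBrDr addrC -linearD odual_pos_cone_ub//; first exact: vl_addr_ge0.
by apply: (@le_trans _ _ (x + v)); rewrite ?vl_leD2rE// ![x + _]addrC vl_leD2rE.
Qed.

Lemma odual_pos_coneZ (a : R) x : 0 <= a -> 0 <= x ->
  odual_pos_cone (a *: x) = a * odual_pos_cone x.
Proof.
have le_scale (b : R) y : 0 < b -> 0 <= y ->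
    odual_pos_cone (b *: y) <= b * odual_pos_cone y.
  move=> b0 y0; apply: odual_pos_cone_le; first exact: vl_scale_ge0 (ltW b0) y0.
  move=> z z0 zby; have b0' : 0 <= b^-1 by rewrite invr_ge0 ltW.
  have : phi (b^-1 *: z) <= odual_pos_cone y.
    apply: odual_pos_cone_ub; first exact: vl_scale_ge0.
    have := vl_scale_le b0' zby; rewrite scalerA mulVf ?gt_eqF//.
    by rewrite scale1r.
  by rewrite linearZ/= -(ler_pM2l b0) /GRing.scale/= mulrA divff ?gt_eqF// mul1r.
rewrite le_eqVlt => /predU1P[<- x0|a0 x0].
  rewrite scale0r mul0r; apply/le_anti/andP; split.
    apply: odual_pos_cone_le => // y y0 yx.
    have /le_anti <- : 0 <= y <= 0 by rewrite y0.
    by rewrite linear0.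
  rewrite -[leLHS](linear0 phi); exact: odual_pos_cone_ub.
apply/le_anti/andP; split; first exact: le_scale.
have a0' : 0 < a^-1 by rewrite invr_gt0.
have := le_scale a^-1 (a *: x) a0' (vl_scale_ge0 _ _ (ltW a0) x0).
rewrite scalerA mulVf ?gt_eqF// scale1r -(ler_pM2l a0) mulrA divff ?gt_eqF//.
by rewrite mul1r.
Qed.

Lemma odual_pos_cone_ge0 x : 0 <= x -> 0 <= odual_pos_cone x.
Proof. by move=> x0; rewrite -[leLHS](linear0 phi) odual_pos_cone_ub. Qed.

Lemma odual_pos_subproof : obl_functional (cone_ext odual_pos_cone).
Proof.
apply: positive_obl; first exact: cone_ext_linear odual_pos_coneD odual_pos_coneZ.
move=> x x0; rewrite (cone_extE odual_pos_coneD odual_pos_coneZ)//.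
exact: odual_pos_cone_ge0.
Qed.

Definition odual_pos : order_dual := OrderDual odual_pos_subproof.

Lemma odual_posE x : 0 <= x -> odual_pos x = odual_pos_cone x.
Proof. exact: cone_extE odual_pos_coneD odual_pos_coneZ x. Qed.

Lemma odual_pos_le psi : (odual_pos <= psi) = (phi <= psi) && (0 <= psi).
Proof.
apply/idP/andP => [/odual_leP le_psi|[/odual_leP phi_le /odual_leP psi0]].
  split; apply/odual_leP => x x0; apply: le_trans (le_psi _ x0);
    rewrite odual_posE//; [exact: odual_pos_cone_ub|exact: odual_pos_cone_ge0].
apply/odual_leP => x x0; rewrite odual_posE//.
apply: odual_pos_cone_le => // y y0 yx.
apply: (le_trans (phi_le _ y0)); apply: odual_mono => //.
by apply/odual_leP.
Qed.

End positive_part.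

Lemma odual_leD2r chi phi psi : phi <= psi -> phi + chi <= psi + chi.
Proof.
by move=> /odual_leP le1; apply/odual_leP => x x0; apply: lerD => //; exact: le1.
Qed.

Lemma odual_scale_ge0 (a : R) phi : 0 <= a -> 0 <= phi -> 0 <= a *: phi.
Proof.
move=> a0 /odual_leP phi0; apply/odual_leP => x x0.
by apply: mulr_ge0 => //; exact: phi0.
Qed.

Definition odual_join phi psi := odual_pos (phi - psi) + psi.
Definition odual_meet phi psi := - odual_join (- phi) (- psi).

Lemma odual_leBl phi psi chi : (phi - chi <= psi) = (phi <= psi + chi).
Proof.
apply/idP/idP => [/(odual_leD2r chi)|/(odual_leD2r (- chi))]; last by rewrite addrK.
by rewrite subrK.
Qed.

Lemma odual_leN2 phi psi : (- phi <= - psi) = (psi <= phi).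
Proof.
have imp (p q : order_dual) : p <= q -> - q <= - p.
  move=> /odual_leP le1; apply/odual_leP => x x0.
  by rewrite lerN2; exact: le1.
by apply/idP/idP => /imp; rewrite ?opprK.
Qed.

Lemma odual_joinP phi psi chi :
  (odual_join phi psi <= chi) = (phi <= chi) && (psi <= chi).
Proof.
have := odual_leBl (odual_pos (phi - psi)) chi (- psi).
rewrite opprK /odual_join => ->; rewrite odual_pos_le odual_leBl subrK.
by rewrite -[X in _ && X]odual_leBl opprK add0r.
Qed.

Lemma odual_meetP phi psi chi :
  (chi <= odual_meet phi psi) = (chi <= phi) && (chi <= psi).
Proof. by rewrite -[LHS]odual_leN2 opprK odual_joinP !odual_leN2. Qed.

HB.instance Definition _ := isVectorLattice.Build R order_dual
  odual_leD2r odual_scale_ge0 odual_joinP odual_meetP.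

End OrderDual.

Section OrderContinuousDual.
Context {R : realType} (E : vectorLatticeType R).
Implicit Types (A : set E) (phi psi : order_dual E).

Definition order_continuous (f : E -> R^o) :=
  forall A, decreases_to0 A -> inf [set (`|f a| : R) | a in A] = 0.

Lemma decreases_to0_ge0 A a : decreases_to0 A -> A a -> 0 <= a.
Proof. by case=> _ _ [+ _] Aa; apply. Qed.

Lemma inf_norm_eq0P (f : E -> R^o) A : A !=set0 ->
  (inf [set (`|f a| : R) | a in A] = 0 <->
   forall e : R, 0 < e -> exists2 a, A a & `|f a| < e).
Proof.
move=> A0; set B := [set _ | _ in _].
have B0 : B !=set0 by case: A0 => a Aa; exists `|f a|, a.
have lB : lbound B 0 by move=> _ [a _ <-].
have hB : has_inf B by split=> //; exists 0.
split=> [infB e e0|Pe].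
  have [_ [a Aa <-]] := @inf_adherent _ B e e0 hB.
  by rewrite infB add0r => ?; exists a.
apply/le_anti; rewrite lb_le_inf// andbT.
apply/ler_addgt0Pl => e e0; rewrite addr0.
have [a Aa /ltW] := Pe e e0; apply: le_trans.
by apply: ge_inf; [exists 0|exists a].
Qed.

Lemma positive_oc_small phi A (e : R) : 0 <= phi -> order_continuous phi ->
  decreases_to0 A -> 0 < e ->
  exists2 a, A a & forall b, A b -> b <= a -> `|phi b| < e.
Proof.
move=> phi0 phioc dA e0; have [A0 _ _] := dA.
have [a Aa ae] := (inf_norm_eq0P phi A0).1 (phioc _ dA) e e0.
exists a => // b Ab ba; apply: le_lt_trans ae.
have ge0 c : A c -> 0 <= phi c.
  by move=> Ac; apply: (odual_leP _ _ phi0); exact: decreases_to0_ge0 Ac.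
by rewrite !ger0_norm ?ge0//; exact: odual_mono.
Qed.

Lemma odual_pos_oc phi : order_continuous phi -> order_continuous (odual_pos phi).
Proof.
move=> phioc A dA; have [A0 dirA [lbA glbA]] := dA.
apply/inf_norm_eq0P => // e e0; have [b Ab] := A0.
have b0 : 0 <= b := lbA _ Ab.
have e20 : 0 < e / 2 by rewrite divr_gt0.
have [_ [y [y0 yb] <-]] :=
  sup_adherent e20 (odual_interval_image_has_sup phi b0).
rewrite -/(odual_pos_cone phi b) -(odual_posE phi b0) => yclose.
pose A' := [set vl_meet y a | a in [set a | A a /\ a <= b]].
have dA' : decreases_to0 A'.
  split.
  - by exists (vl_meet y b), b.
  - move=> _ _ [a1 [Aa1 a1b] <-] [a2 [Aa2 a2b] <-].
    have [a [Aa aa1 aa2]] := dirA _ _ Aa1 Aa2.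
    exists (vl_meet y a); split; first by exists a => //; split=> //; exact: le_trans a1b.
      by rewrite vl_meetP vl_meetl (le_trans (vl_meetr _ _)).
    by rewrite vl_meetP vl_meetl (le_trans (vl_meetr _ _)).
  - split; first by move=> _ [a [Aa _] <-]; rewrite vl_meetP y0 lbA.
    move=> z zA'; apply: glbA => a Aa.
    have [c [Ac ca cb]] := dirA _ _ Aa Ab.
    apply: (le_trans _ ca); apply: (le_trans _ (vl_meetr y c)).
    by apply: zA'; exists c.
have [_ [a [Aa ab] <-] small] :=
  (inf_norm_eq0P phi (let: And3 h _ _ := dA' in h)).1 (phioc _ dA') _ e20.
exists a => //; have a0 : 0 <= a := lbA _ Aa.
set m := vl_meet y a in small.
have m0 : 0 <= m by rewrite vl_meetP y0.
have le1 : phi (y - m) <= odual_pos phi (b - a).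
  rewrite odual_posE ?vl_subr_ge0//; apply: odual_pos_cone_ub.
    by rewrite vl_subr_ge0 vl_meetl.
  rewrite vl_leBlC vl_meetP; apply/andP; split.
    by rewrite vl_leBl -vl_subr_ge0 addrAC subrr add0r vl_subr_ge0.
  by rewrite opprB addrA vl_leBl [a + b]addrC vl_leD2rE.
rewrite (odualB phi y m) (odualB (odual_pos phi) b a) in le1.
have pa0 : 0 <= odual_pos phi a.
  by rewrite odual_posE//; exact: odual_pos_cone_ge0.
rewrite ger0_norm//.
have phim := le_lt_trans (ler_norm (phi m)) small.
have aux (p q u w : R) :
  w < e / 2 -> u - w <= p - q -> p - e / 2 < u -> q < e by clear; lra.
exact: aux phim le1 yclose.
Qed.

Lemma order_continuousP phi :
  order_continuous phi <->
  (forall A, decreases_to0 A -> forall e : R, 0 < e ->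
    exists2 a, A a & forall b, A b -> b <= a -> `|phi b| < e).
Proof.
split=> [phioc A dA e e0|small A dA]; last first.
  have [A0 _ _] := dA; apply/inf_norm_eq0P => // e e0.
  by have [a Aa /(_ _ Aa (lexx _))] := small A dA e e0; exists a.
have Nphioc : order_continuous (- phi).
  move=> B dB; rewrite -[RHS](phioc _ dB); congr inf.
  by apply/seteqP; split=> _ [b Bb <-]; exists b => //; rewrite normrN.
have e20 : 0 < e / 2 by rewrite divr_gt0.
have pos0 psi : 0 <= odual_pos psi.
  by have := odual_pos_le psi (odual_pos psi); rewrite lexx => /esym/andP[].
have [a1 Aa1 small1] := positive_oc_small (pos0 phi) (odual_pos_oc phioc) dA e20.
have [a2 Aa2 small2] :=
  positive_oc_small (pos0 (- phi)) (odual_pos_oc Nphioc) dA e20.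
have [_ dirA _] := dA; have [a [Aa aa1 aa2]] := dirA _ _ Aa1 Aa2.
exists a => // b Ab ba; have b0 := decreases_to0_ge0 dA Ab.
have le1 : phi b <= odual_pos phi b by rewrite odual_posE// odual_pos_cone_ub.
have le2 : - phi b <= odual_pos (- phi) b.
  by rewrite odual_posE//; exact: (odual_pos_cone_ub (- phi)).
have lt1 := le_lt_trans (ler_norm _) (small1 _ Ab (le_trans ba aa1)).
have lt2 := le_lt_trans (ler_norm _) (small2 _ Ab (le_trans ba aa2)).
have aux (p q u : R) : 0 < e ->
  u <= p -> - u <= q -> p < e / 2 -> q < e / 2 -> -e < u < e.
  by clear => *; apply/andP; split; lra.
by rewrite ltr_norml; exact: aux le1 le2 lt1 lt2.
Qed.

Lemma order_continuous_le phi psi :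
  0 <= phi -> phi <= psi -> order_continuous psi -> order_continuous phi.
Proof.
move=> phi0 phi_psi psioc; have psi0 := le_trans phi0 phi_psi.
apply/order_continuousP => A dA e e0.
have [a Aa small] := positive_oc_small psi0 psioc dA e0.
exists a => // b Ab ba; have b0 := decreases_to0_ge0 dA Ab.
rewrite ger0_norm; last exact: (odual_leP _ _ phi0).
apply: le_lt_trans (small _ Ab ba); apply: le_trans (ler_norm _).
exact: (odual_leP _ _ phi_psi).
Qed.

Definition oc_functional : {pred order_dual E} :=
  fun phi => `[< order_continuous phi >].

Lemma oc_functional_submod : submod_closed oc_functional.
Proof.
split.
  apply/asboolP/order_continuousP => A [[a Aa] _ _] e e0.
  by exists a => // b _ _; rewrite normr0.
move=> k phi psi /asboolP/order_continuousP phioc.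
move=> /asboolP/order_continuousP psioc.
apply/asboolP/order_continuousP => A dA e e0.
have k0 : 0 < `|k| + 1 by rewrite ltr_wpDl.
have e1 : 0 < e / 2 / (`|k| + 1) by rewrite !divr_gt0.
have e2 : 0 < e / 2 by rewrite divr_gt0.
have [a1 Aa1 small1] := phioc A dA _ e1.
have [a2 Aa2 small2] := psioc A dA _ e2.
have [_ dirA _] := dA; have [a [Aa aa1 aa2]] := dirA _ _ Aa1 Aa2.
exists a => // b Ab ba; rewrite [e]splitr.
apply: (le_lt_trans (ler_normD _ _)); apply: ltrD.
  rewrite normrM; have := small1 _ Ab (le_trans ba aa1).
  rewrite ltr_pdivlMr// => /(le_lt_trans _); apply.
  by rewrite mulrC ler_wpM2l// lerDl.
exact: small2 _ Ab (le_trans ba aa2).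
Qed.

HB.instance Definition _ := GRing.isSubmodClosed.Build R (order_dual E)
  oc_functional oc_functional_submod.

Record oc_dual := OcDual {
  oc_dual_val :> order_dual E;
  _ : oc_functional oc_dual_val }.

HB.instance Definition _ := [isSub for oc_dual_val].
HB.instance Definition _ := [Choice of oc_dual by <:].
HB.instance Definition _ := [SubChoice_isSubLmodule of oc_dual by <:].

Lemma oc_dualP (phi : oc_dual) : order_continuous phi.
Proof. by case: phi => phi /= /asboolP. Qed.

Definition oc_le : rel oc_dual :=
  fun phi psi : oc_dual => oc_dual_val phi <= oc_dual_val psi.

Lemma oc_le_refl : reflexive oc_le. Proof. by move=> phi; exact: lexx. Qed.

Lemma oc_le_anti : antisymmetric oc_le.
Proof. by move=> phi psi /le_anti /val_inj. Qed.

Lemma oc_le_trans : transitive oc_le.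
Proof. by move=> psi phi chi; exact: le_trans. Qed.

HB.instance Definition _ := Order.Le_isPOrder.Build ring_display oc_dual
  oc_le_refl oc_le_anti oc_le_trans.

Lemma oc_leD2r (chi phi psi : oc_dual) : phi <= psi -> phi + chi <= psi + chi.
Proof. exact: (@vl_leD2r R (order_dual E)). Qed.

Lemma oc_scale_ge0 (a : R) (phi : oc_dual) : 0 <= a -> 0 <= phi -> 0 <= a *: phi.
Proof. exact: (@vl_scale_ge0 R (order_dual E)). Qed.

Lemma oc_join_subproof (phi psi : oc_dual) :
  oc_functional (vl_join (oc_dual_val phi) (oc_dual_val psi)).
Proof.
have posP (chi : oc_dual) : odual_pos chi \in oc_functional.
  by apply/asboolP/odual_pos_oc/oc_dualP.
apply: (@rpredD _ oc_functional); last exact: valP psi.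
exact: (posP (phi - psi)).
Qed.

Definition oc_join (phi psi : oc_dual) := OcDual (oc_join_subproof phi psi).
Definition oc_meet (phi psi : oc_dual) := - oc_join (- phi) (- psi).

Lemma oc_joinP (phi psi chi : oc_dual) :
  (oc_join phi psi <= chi) = (phi <= chi) && (psi <= chi).
Proof. exact: (@vl_joinP R (order_dual E)). Qed.

Lemma oc_meetP (phi psi chi : oc_dual) :
  (chi <= oc_meet phi psi) = (chi <= phi) && (chi <= psi).
Proof. exact: (@vl_meetP R (order_dual E)). Qed.

HB.instance Definition _ := isVectorLattice.Build R oc_dual
  oc_leD2r oc_scale_ge0 oc_joinP oc_meetP.

End OrderContinuousDual.

Section CanonicalMap.
Context {R : realType} (E : vectorLatticeType R).

Definition evaluation (u : E) : oc_dual E -> R^o := fun phi => phi u.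

Lemma evaluation_obl u : obl_functional (evaluation u).
Proof.
apply/asboolP; split=> // phi psi; have [p [q [p0 q0 ->]]] := vl_decomp u.
exists (`|phi p| + `|psi p| + (`|phi q| + `|psi q|)) => chi.
move=> /odual_leP phi_chi /odual_leP chi_psi.
have bound x : 0 <= x -> `|chi x| <= `|phi x| + `|psi x|.
  move=> x0; rewrite ler_norml; apply/andP; split.
    apply: le_trans (phi_chi _ x0).
    by rewrite lerNl (le_trans (ler_norm _))// normrN lerDl.
  by rewrite (le_trans (chi_psi _ x0))// (le_trans (ler_norm _))// lerDr.
rewrite /evaluation odualB (le_trans (ler_normB _ _))//.
by apply: lerD; exact: bound.
Qed.

Lemma oc_dual_decreases_pointwise (A : set (oc_dual E)) (p : E) (e : R) :
  decreases_to0 A -> 0 <= p -> 0 < e -> exists2 phi, A phi & phi p < e.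
Proof.
move=> [[phi0 Aphi0] dirA [lbA glbA]] p0 e0.
pose I x := [set (phi x : R) | phi in A].
have I_lb x : 0 <= x -> lbound (I x) 0.
  by move=> x0 _ [phi Aphi <-]; exact: (odual_leP _ _ (lbA _ Aphi)).
have I_inf x : 0 <= x -> has_inf (I x).
  by move=> x0; split; [exists (phi0 x), phi0|exists 0; exact: I_lb].
pose f x := inf (I x).
have f_le phi x : A phi -> 0 <= x -> f x <= phi x.
  by move=> Aphi x0; apply: ge_inf; [exact: (I_inf _ x0).2|exists phi].
have le_f (M : R) x : (forall phi, A phi -> M <= phi x) -> M <= f x.
  move=> leM; apply: lb_le_inf; first by exists (phi0 x), phi0.
  by move=> _ [phi Aphi <-]; exact: leM.
have fD x y : 0 <= x -> 0 <= y -> f (x + y) = f x + f y.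
  move=> x0 y0; apply/le_anti/andP; split; last first.
    by apply: le_f => phi Aphi; rewrite linearD; apply: lerD; exact: f_le.
  rewrite -lerBlDr; apply: (le_f) => phi Aphi.
  rewrite lerBlDr [phi x + _]addrC -lerBlDr; apply: le_f => psi Apsi.
  rewrite lerBlDr; have [chi [Achi chiphi chipsi]] := dirA _ _ Aphi Apsi.
  apply: (le_trans (f_le _ _ Achi (vl_addr_ge0 x0 y0))).
  rewrite linearD addrC; apply: lerD.
    exact: (odual_leP _ _ chipsi).
  exact: (odual_leP _ _ chiphi).
have fZ (a : R) x : 0 <= a -> 0 <= x -> f (a *: x) = a * f x.
  move=> a0 x0; have [->|aN0] := eqVneq a 0.
    rewrite scale0r mul0r; apply/le_anti/andP; split.
      by apply: (le_trans (f_le _ _ Aphi0 (lexx _))); rewrite linear0.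
    by apply: le_f => phi _; rewrite linear0.
  have a_gt0 : 0 < a by rewrite lt_neqAle eq_sym aN0.
  apply/le_anti/andP; split; last first.
    apply: le_f => phi Aphi; rewrite linearZ/=.
    by apply: ler_wpM2l => //; exact: f_le.
  rewrite -ler_pdivrMl//; apply: le_f => phi Aphi.
  rewrite ler_pdivrMl//.
  apply: (le_trans (f_le _ _ Aphi (vl_scale_ge0 _ _ a0 x0))).
  by rewrite linearZ.
have obl_f : obl_functional (cone_ext f).
  apply: positive_obl; first exact: cone_ext_linear.
  move=> x x0; rewrite cone_extE//; apply: le_f => phi Aphi.
  exact: (odual_leP _ _ (lbA _ Aphi)).
pose psi := OrderDual obl_f.
have psiE x : 0 <= x -> psi x = f x by move=> x0; exact: cone_extE.
have psi_le phi : A phi -> psi <= oc_dual_val phi.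
  by move=> Aphi; apply/odual_leP => x x0; rewrite psiE//; exact: f_le.
have psi0 : 0 <= psi.
  apply/odual_leP => x x0; rewrite psiE//; apply: le_f => phi Aphi.
  exact: (odual_leP _ _ (lbA _ Aphi)).
have psioc : oc_functional psi.
  apply/asboolP; apply: (order_continuous_le psi0 (psi_le _ Aphi0)).
  exact: oc_dualP.
have : (OcDual psioc : oc_dual E) <= 0.
  by apply: glbA => phi Aphi; exact: psi_le.
move=> /odual_leP/(_ _ p0); rewrite /= [X in X <= _ -> _](psiE _ p0) => fp0.
have [_ [phi Aphi <-] small] := inf_adherent e0 (I_inf _ p0).
exists phi => //; apply: (lt_le_trans small).
by rewrite -[leRHS]add0r lerD2r.
Qed.

Lemma evaluation_oc u : oc_functional (OrderDual (evaluation_obl u)).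
Proof.
apply/asboolP => A dA; have [A0 dirA [lbA _]] := dA.
apply/inf_norm_eq0P => // e e0.
have [p [q [p0 q0 ->]]] := vl_decomp u.
have [phi Aphi small] := oc_dual_decreases_pointwise dA (vl_addr_ge0 p0 q0) e0.
exists phi => //; have phi0 : 0 <= oc_dual_val phi := lbA _ Aphi.
have phip := odual_leP _ _ phi0 _ p0; have phiq := odual_leP _ _ phi0 _ q0.
rewrite linearD in small.
rewrite /= /evaluation odualB (le_lt_trans (ler_normB _ _))//.
by rewrite !ger0_norm.
Qed.

Definition canonical_map (u : E) : oc_dual (oc_dual E) :=
  OcDual (evaluation_oc u).

End CanonicalMap.

Section LatticeHomomorphisms.
Context {R : realType}.
Implicit Types V W : vectorLatticeType R.

Definition lattice_hom V W (f : V -> W) :=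
  [/\ linear f, {morph f : x y / vl_join x y} & {morph f : x y / vl_meet x y}].

Definition lattice_isomorphism V W (f : V -> W) := lattice_hom f /\ bijective f.

Definition lattice_isomorphic V W :=
  exists f : V -> W, lattice_isomorphism f.

Definition lattice_isomorphism_onto V W (f : V -> W) (D : set W) :=
  [/\ lattice_hom f, injective f & range f = D].

Definition perfect V := lattice_isomorphism (@canonical_map R V).

End LatticeHomomorphisms.

Section ContinuousFunctions.
Context (R : realType) (X : topologicalType).

Definition Cfun : Type := continuousType X R.

HB.instance Definition _ := Choice.on Cfun.

Implicit Types u v : Cfun.

Lemma cfun_continuous u : continuous (u : X -> R^o).
Proof. exact: (@cts_fun _ _ u). Qed.

Lemma cfunD_cts u v : continuous (fun x => u x + v x : R).
Proof. by move=> x; apply: (@cvgD R R^o); exact: cfun_continuous. Qed.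

Lemma cfunN_cts u : continuous (fun x => - u x : R).
Proof. by move=> x; apply: (@cvgN R R^o); exact: cfun_continuous. Qed.

Lemma cfunZ_cts (a : R) u : continuous (fun x => a * u x : R).
Proof. by move=> x; apply: (@cvgMl_tmp R); exact: cfun_continuous. Qed.

Lemma cfun_max_cts u v : continuous (fun x => Num.max (u x) (v x) : R).
Proof.
have -> : (fun x => Num.max (u x) (v x)) =
    (fun x => 2^-1 * (u x + v x + `|u x - v x|) : R).
  by apply/funext => x; rewrite maxr_absE mulrC.
move=> x; apply: (@cvgMl_tmp R); apply: (@cvgD R R^o); first exact: cfunD_cts.
apply: (@cvg_norm R R^o); apply: (@cvgB R R^o); exact: cfun_continuous.
Qed.

Lemma cfun_min_cts u v : continuous (fun x => Num.min (u x) (v x) : R).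
Proof.
have -> : (fun x => Num.min (u x) (v x)) =
    (fun x => 2^-1 * (u x + v x - `|u x - v x|) : R).
  by apply/funext => x; rewrite minr_absE mulrC.
move=> x; apply: (@cvgMl_tmp R); apply: (@cvgB R R^o); first exact: cfunD_cts.
apply: (@cvg_norm R R^o); apply: (@cvgB R R^o); exact: cfun_continuous.
Qed.

Definition cfun0 : Cfun := mkcts (@cst_continuous X R 0).
Definition cfunD u v : Cfun := mkcts (@cfunD_cts u v).
Definition cfunN u : Cfun := mkcts (@cfunN_cts u).
Definition cfunZ a u : Cfun := mkcts (@cfunZ_cts a u).
Definition cfun_max u v : Cfun := mkcts (@cfun_max_cts u v).
Definition cfun_min u v : Cfun := mkcts (@cfun_min_cts u v).

Lemma cfunP u v : (forall x, u x = v x) -> u = v.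
Proof. by move=> uv; apply/continuousEP. Qed.

Lemma cfunDA : associative cfunD.
Proof. by move=> u v w; apply: cfunP => x /=; exact: addrA. Qed.
Lemma cfunDC : commutative cfunD.
Proof. by move=> u v; apply: cfunP => x /=; exact: addrC. Qed.
Lemma cfunD0 : left_id cfun0 cfunD.
Proof. by move=> u; apply: cfunP => x /=; exact: add0r. Qed.
Lemma cfunDN : left_inverse cfun0 cfunN cfunD.
Proof. by move=> u; apply: cfunP => x /=; exact: addNr. Qed.

HB.instance Definition _ :=
  GRing.isZmodule.Build Cfun cfunDA cfunDC cfunD0 cfunDN.

Lemma cfunZA (a b : R) u : cfunZ a (cfunZ b u) = cfunZ (a * b) u.
Proof. by apply: cfunP => x /=; exact: mulrA. Qed.
Lemma cfunZ1 : left_id 1 cfunZ.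
Proof. by move=> u; apply: cfunP => x /=; exact: mul1r. Qed.
Lemma cfunZDr : right_distributive cfunZ +%R.
Proof. by move=> a u v; apply: cfunP => x /=; exact: mulrDr. Qed.
Lemma cfunZDl u : {morph cfunZ^~ u : a b / a + b}.
Proof. by move=> a b; apply: cfunP => x /=; exact: mulrDl. Qed.

HB.instance Definition _ :=
  GRing.Zmodule_isLmodule.Build R Cfun cfunZA cfunZ1 cfunZDr cfunZDl.

Definition cfun_le : rel Cfun := fun u v => `[< forall x, u x <= v x >].

Lemma cfun_le_refl : reflexive cfun_le. Proof. by move=> u; apply/asboolP. Qed.

Lemma cfun_le_anti : antisymmetric cfun_le.
Proof.
move=> u v /andP[/asboolP uv /asboolP vu]; apply: cfunP => x.
by apply/le_anti; rewrite uv vu.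
Qed.

Lemma cfun_le_trans : transitive cfun_le.
Proof.
move=> v u w /asboolP uv /asboolP vw; apply/asboolP => x.
exact: le_trans (uv x) (vw x).
Qed.

HB.instance Definition _ := Order.Le_isPOrder.Build ring_display Cfun
  cfun_le_refl cfun_le_anti cfun_le_trans.

Lemma cfun_leP u v : reflect (forall x, u x <= v x) (u <= v).
Proof. exact: asboolP. Qed.

Lemma cfun_leD2r w u v : u <= v -> u + w <= v + w.
Proof. by move=> /cfun_leP uv; apply/cfun_leP => x; apply: lerD. Qed.

Lemma cfun_scale_ge0 (a : R) u : 0 <= a -> 0 <= u -> 0 <= a *: u.
Proof.
by move=> a0 /cfun_leP u0; apply/cfun_leP => x; apply: mulr_ge0 => //; exact: u0.
Qed.

Lemma cfun_joinP u v w : (cfun_max u v <= w) = (u <= w) && (v <= w).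
Proof.
apply/cfun_leP/andP => [uvw|[/cfun_leP uw /cfun_leP vw] x].
  by split; apply/cfun_leP => x; apply: le_trans (uvw x); rewrite /= le_max lexx ?orbT.
by rewrite /= ge_max uw vw.
Qed.

Lemma cfun_meetP u v w : (w <= cfun_min u v) = (w <= u) && (w <= v).
Proof.
apply/cfun_leP/andP => [uvw|[/cfun_leP uw /cfun_leP vw] x].
  by split; apply/cfun_leP => x; apply: le_trans (uvw x) _; rewrite /= ge_min lexx ?orbT.
by rewrite /= le_min uw vw.
Qed.

HB.instance Definition _ := isVectorLattice.Build R Cfun
  cfun_leD2r cfun_scale_ge0 cfun_joinP cfun_meetP.

End ContinuousFunctions.

Section Restriction.
Context (R : realType) (X : topologicalType) (S : set X).

Lemma cfun_restr_cts (u : Cfun R X) :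
  continuous ((u : X -> R) \o (set_val : S -> X)).
Proof.
move=> x; apply: continuous_comp; last exact: (@cts_fun _ _ u).
exact: initial_continuous.
Qed.

Definition cfun_restr (u : Cfun R X) : Cfun R S := mkcts (@cfun_restr_cts u).

End Restriction.

Section Bands.
Context {R : realType} {E : vectorLatticeType R}.
Implicit Types (A B : set E) (u v : E).

Definition disjoint_complement A : set E :=
  [set u | forall v, A v -> vl_meet (vl_abs u) (vl_abs v) = 0].

Definition null_ideal (phi : order_dual E) : set E :=
  [set u | vl_abs phi (vl_abs u) = 0].

Definition carrier (phi : order_dual E) : set E :=
  disjoint_complement (null_ideal phi).

(* For a projection band [B], [u] has exactly one decomposition [b + (u - b)] *)
(* with [b] in [B] and [u - b] in the disjoint complement of [B].             *)
Definition band_projection B u : E :=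
  xget 0 [set b | B b /\ disjoint_complement B (u - b)].

Definition oc_carriers : set (set E) :=
  [set carrier phi | phi in [set phi : oc_dual E | 0 <= phi]].

End Bands.

Arguments oc_carriers {R} E.

Section ProductLattice.
Context {R : realType} (I : Type) (E : vectorLatticeType R).

Definition vl_prod : Type := I -> E.

HB.instance Definition _ := GRing.Lmodule.copy vl_prod (I -> E).

Implicit Types u v w : vl_prod.

Definition prod_le : rel vl_prod := fun u v => `[< forall i, u i <= v i >].

Lemma prod_le_refl : reflexive prod_le. Proof. by move=> u; apply/asboolP. Qed.

Lemma prod_le_anti : antisymmetric prod_le.
Proof.
move=> u v /andP[/asboolP uv /asboolP vu]; apply/funext => i.
by apply/le_anti; rewrite uv vu.
Qed.

Lemma prod_le_trans : transitive prod_le.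
Proof.
move=> v u w /asboolP uv /asboolP vw; apply/asboolP => i.
exact: le_trans (uv i) (vw i).
Qed.

HB.instance Definition _ := Order.Le_isPOrder.Build ring_display vl_prod
  prod_le_refl prod_le_anti prod_le_trans.

Lemma prod_leP u v : reflect (forall i, u i <= v i) (u <= v).
Proof. exact: asboolP. Qed.

Definition prod_join u v : vl_prod := fun i => vl_join (u i) (v i).
Definition prod_meet u v : vl_prod := fun i => vl_meet (u i) (v i).

Lemma prod_leD2r w u v : u <= v -> u + w <= v + w.
Proof. by move=> /prod_leP uv; apply/prod_leP => i; apply: vl_leD2r. Qed.

Lemma prod_scale_ge0 (a : R) u : 0 <= a -> 0 <= u -> 0 <= a *: u.
Proof.
by move=> a0 /prod_leP u0; apply/prod_leP => i; apply: vl_scale_ge0 (u0 i).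
Qed.

Lemma prod_joinP u v w : (prod_join u v <= w) = (u <= w) && (v <= w).
Proof.
apply/prod_leP/andP => [uvw|[/prod_leP uw /prod_leP vw] i].
  by split; apply/prod_leP => i; move: (uvw i); rewrite vl_joinP => /andP[].
by rewrite vl_joinP uw vw.
Qed.

Lemma prod_meetP u v w : (w <= prod_meet u v) = (w <= u) && (w <= v).
Proof.
apply/prod_leP/andP => [uvw|[/prod_leP uw /prod_leP vw] i].
  by split; apply/prod_leP => i; move: (uvw i); rewrite vl_meetP => /andP[].
by rewrite vl_meetP uw vw.
Qed.

HB.instance Definition _ := isVectorLattice.Build R vl_prod
  prod_leD2r prod_scale_ge0 prod_joinP prod_meetP.

End ProductLattice.

Section InverseLimit.
Context {R : realType} {E : vectorLatticeType R} (M : set (set E)).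

(* The product of the bands in [M], and hence the inverse limit, is presented *)
(* as a set of families in the power [M -> E].                                *)
Definition inverse_limit : set (vl_prod M E) :=
  [set u | (forall B : M, set_val B (u B)) /\
    forall A B : M, set_val A `<=` set_val B ->
      band_projection (set_val A) (u B) = u A].

Definition limit_projection (u : E) : vl_prod M E :=
  fun B => band_projection (set_val B) u.

End InverseLimit.

Arguments inverse_limit {R E} M.
Arguments limit_projection {R E} M.

Definition homeomorphic (X Y : topologicalType) :=
  exists (f : X -> Y) (g : Y -> X),
    [/\ continuous f, continuous g, cancel f g & cancel g f].

Definition realcompact (R : realType) (X : topologicalType) :=
  [/\ hausdorff_space X, completely_regular_space X &
    exists (I : Type) (D : set (prod_topology (fun _ : I => R))),
      closed D /\ homeomorphic X D].

Definition extremally_disconnected (X : topologicalType) :=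
  forall U : set X, open U -> open (closure U).

(* Measurable types are required to be pointed; pointing [X] at a given [x]   *)
(* leaves the Borel sets unchanged and avoids excluding the empty space.      *)
Definition pointed_at (X : topologicalType) (x : X) : Type := X.

HB.instance Definition _ (X : topologicalType) (x : X) :=
  Choice.copy (pointed_at x) X.
HB.instance Definition _ (X : topologicalType) (x : X) :=
  isPointed.Build (pointed_at x) x.

Definition borel_space (X : topologicalType) (x : X) :=
  g_sigma_algebraType (@open X : set (set (pointed_at x))).

Section TotalVariation.
Context d (T : measurableType d) (R : realType) (nu : {charge set T -> \bar R}).

Let hahn_pos : set T := sval (cid (Hahn_decomposition nu)).
Let hahn_neg : set T := sval (cid (svalP (cid (Hahn_decomposition nu)))).
Let hahnP : hahn_decomposition nu hahn_pos hahn_neg :=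
  svalP (cid (svalP (cid (Hahn_decomposition nu)))).

(* By uniqueness of the Jordan decomposition, neither definition depends on   *)
(* the chosen Hahn decomposition.                                             *)
Definition total_variation : set T -> \bar R := charge_variation hahnP.

Definition charge_integral (f : T -> \bar R) : \bar R :=
  (\int[jordan_pos hahnP]_x f x - \int[jordan_neg hahnP]_x f x)%E.

End TotalVariation.

Section RadonSupport.
Context {R : realType} {X : topologicalType}.

Section radon_charges.
Context (x0 : X) (nu : {charge set (borel_space x0) -> \bar R}).

Definition radon_charge :=
  forall A : set (borel_space x0), measurable A ->
    total_variation nu A =
    ereal_sup [set total_variation nu K |
               K in [set K | compact (K : set X) /\ K `<=` A]].

Definition charge_support : set X :=
  [set x | forall U : set X, open U -> U x -> (0 < total_variation nu U)%E].

Definition represents (phi : order_dual (Cfun R X)) :=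
  [/\ radon_charge, compact charge_support &
    forall u : Cfun R X, (phi u : R)%:E = charge_integral nu (fun x => (u x)%:E)].

End radon_charges.

(* The representing charge is unique, so the existential picks out its        *)
(* support; membership of [x] provides the point needed to make [X] a         *)
(* measurable type.                                                           *)
Definition functional_support (phi : order_dual (Cfun R X)) : set X :=
  [set x | exists2 nu : {charge set (borel_space x) -> \bar R},
    represents nu phi & charge_support nu x].

End RadonSupport.

Definition oc_support_union (R : realType) (X : topologicalType) : set X :=
  \bigcup_(phi : oc_dual (Cfun R X)) functional_support phi.

Arguments oc_support_union R X : clear implicits.

(* Main.v *)
(* For a positive order continuous phi, the indicators of the clopen sets     *)
(* annihilated by phi have a supremum, again the indicator of a clopen null   *)
(* set; its complement K is the support of phi, compact because X is          *)
(* realcompact. So S is the union of an upward directed family of clopen sets *)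
(* K, and the carrier of phi is the band of functions vanishing off K: a      *)
(* point of the inverse limit is the same thing as a continuous function on   *)
(* S, whence (iii) <-> (iv).                                                  *)
(*                                                                            *)
(* If C(X) is an order dual E~, each e >= 0 in E is an order continuous       *)
(* functional on C(X), these functionals separate points, and pointwise       *)
(* bounded directed families in E~ have suprema; applied to the truncations   *)
(* of a function on S, this yields its extension to X. The same argument      *)
(* applies to perfect spaces. Conversely, let L >= 0 be order bounded on      *)
(* G = C(X)_n~. For phi >= 0 in G the functional w |-> L(phi w) is dominated  *)
(* by a multiple of phi, so it has a continuous density u_phi. The densities  *)
(* agree on common supports and glue to a function on S; its extension u to X *)
(* satisfies L(phi) = phi(u). Thus C(X) = G~, and C(X) is perfect.            *)
(*                                                                            *)
(* To compare S with the supports of Radon measures, phi is represented by    *)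
(* the outer measure A |-> inf {phi(1_cl G) | G open, A <= G}: by order       *)
(* continuity it vanishes on the boundaries of open sets, so open sets are    *)
(* Caratheodory measurable.                                                   *)

Require Import Defs.
From HB Require Import structures.
From mathcomp Require Import all_boot all_order all_algebra.
From mathcomp Require Import all_classical all_reals all_analysis.
From mathcomp Require Import measurable_realfun lra.

Set Implicit Arguments.
Unset Strict Implicit.
Unset Printing Implicit Defensive.

Import Order.TTheory GRing.Theory Num.Theory.
Import numFieldNormedType.Exports.

Local Open Scope classical_set_scope.
Local Open Scope ring_scope.

(** * Vector lattices and their order duals *)

(** All four statements are compared with [extension_property]: every continuous function on S, the
    union of the supports, extends uniquely to X. Extremal disconnectedness makes the set of points
    not seen by a positive order continuous functional clopen ([csuppC]). So S is covered by clopen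
    pieces, on which both continuity and carriers can be read off; this gives [restriction_ext] and
    [limit_projection_ext].

    An order dual contains the pointwise suprema of its bounded directed families, and these build
    the extensions ([extension_property_of_dual]), because the positive elements of the predual
    become order continuous functionals ([dual_eval_oc_pos]). For the converse, a Hahn decomposition
    into clopen sets and a Radon-Nikodym theorem with continuous densities ([oc_hahn],
    [oc_radon_nikodym]) turn a positive functional on the order continuous dual into a compatible
    family of densities, which the extension property glues ([eval_map_surj]). The resulting
    isomorphism is onto the whole order dual of C(X)_n~, and therefore yields both (i) and (ii).

    Supports are handled without measures, through [csupp]. Radon charges are met only for
    [oc_support_unionE], which combines one explicit representing measure ([oc_represents]) with a
    separation argument for arbitrary representing charges ([functional_support_subset]). *)

Section OrderEmbedding.
Context {R : realType}.
Implicit Types V W : vectorLatticeType R.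

Definition order_embedding V W (f : V -> W) :=
  forall x y : V, (f x <= f y) = (x <= y).

Lemma order_embedding_inj V W (f : V -> W) : order_embedding f -> injective f.
Proof. by move=> fle x y fxy; apply/le_anti; rewrite -!fle fxy lexx. Qed.

(** Joins and meets are determined by the order, so a surjection that preserves and reflects the
    order respects them automatically. *)
Lemma order_isomorphism V W (f : V -> W) :
  linear f -> order_embedding f -> (forall y, exists x, f x = y) ->
  lattice_isomorphism f.
Proof.
move=> lf fle fsurj; have [g fg] := choice fsurj; split; last first.
  exists g => // x; apply: (order_embedding_inj fle); exact: fg.
split=> // x y; apply/le_anti/andP; split.
- rewrite -[leRHS]fg fle vl_joinP -!fle fg.
  by rewrite vl_joinl vl_joinr.
- by rewrite vl_joinP !fle vl_joinl vl_joinr.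
- by rewrite vl_meetP !fle vl_meetl vl_meetr.
- rewrite -[leLHS]fg fle vl_meetP -!fle fg.
  by rewrite vl_meetl vl_meetr.
Qed.

Lemma lattice_hom_embedding V W (f : V -> W) :
  lattice_hom f -> injective f -> order_embedding f.
Proof.
move=> [_ fj _] finj x y; apply/idP/idP => [fxy|xy].
  have <- : vl_join x y = y.
    apply: finj; rewrite fj; apply/le_anti.
    by rewrite vl_joinP fxy lexx vl_joinr.
  exact: vl_joinl.
have <- : vl_join x y = y by apply/le_anti; rewrite vl_joinP xy lexx vl_joinr.
by rewrite fj vl_joinl.
Qed.

End OrderEmbedding.

Section OrderDualLinear.
Context {R : realType} {E : vectorLatticeType R}.
Implicit Types (phi psi : order_dual E) (x y : E) (a : R).

Lemma odualD phi x y : phi (x + y) = phi x + phi y :> R.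
Proof. exact: linearD. Qed.

Lemma odualZ phi a x : phi (a *: x) = a * phi x :> R.
Proof. exact: linearZ. Qed.

Lemma odual0 phi : phi 0 = 0 :> R.
Proof. exact: linear0. Qed.

Lemma odual_ge0 phi x : 0 <= phi -> 0 <= x -> 0 <= phi x.
Proof. by move=> /odual_leP; exact. Qed.

Lemma odual_posBneg phi : phi = odual_pos phi - (odual_pos phi - phi).
Proof. by rewrite opprB addrC subrK. Qed.

Lemma odual_pos_ge0 phi : 0 <= odual_pos phi.
Proof. by have := odual_pos_le phi (odual_pos phi); rewrite lexx => /esym/andP[]. Qed.

Lemma odual_pos_ge phi : phi <= odual_pos phi.
Proof. by have := odual_pos_le phi (odual_pos phi); rewrite lexx => /esym/andP[]. Qed.

Lemma odual_neg_ge0 phi : 0 <= odual_pos phi - phi.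
Proof. by rewrite vl_subr_ge0 odual_pos_ge. Qed.

Lemma order_continuousB phi psi : order_continuous phi -> order_continuous psi ->
  order_continuous (phi - psi : order_dual E).
Proof.
move=> /asboolP cphi /asboolP cpsi; apply/asboolP.
exact: (@rpredB _ (@oc_functional R E)).
Qed.

Lemma order_continuousZ a phi : order_continuous phi -> 
  order_continuous (a *: phi : order_dual E).
Proof.
by move=> /asboolP cphi; apply/asboolP; exact: (@rpredZ _ _ (@oc_functional R E)).
Qed.

Lemma order_continuousD phi psi : order_continuous phi -> order_continuous psi ->
  order_continuous (phi + psi : order_dual E).
Proof.
move=> /asboolP cphi /asboolP cpsi; apply/asboolP.
exact: (@rpredD _ (@oc_functional R E)).
Qed.

End OrderDualLinear.

Section DirectedSup.
Context {R : realType} {E : vectorLatticeType R}.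
Implicit Types (phi psi : order_dual E) (D : set (order_dual E)).

Definition upward_directed {d} {T : porderType d} (A : set T) :=
  forall x y, A x -> A y -> exists z, [/\ A z, (x <= z)%O & (y <= z)%O].

(** Stronger than a least upper bound in the order dual: the values converge on the positive cone,
    so some member of [D] is close to [l] at any given point. *)
Definition pointwise_sup D (l : order_dual E) :=
  forall x, 0 <= x -> has_sup [set (phi x : R) | phi in D] /\
    (l x : R) = sup [set (phi x : R) | phi in D].

Lemma pointwise_sup_ub D l phi : pointwise_sup D l -> D phi -> phi <= l.
Proof.
move=> sl Dphi; apply/odual_leP => x x0; have [[_ ubx] ->] := sl x x0.
by apply: ub_le_sup => //; exists phi.
Qed.

Lemma pointwise_sup_lub D l psi : pointwise_sup D l ->
  (forall phi, D phi -> phi <= psi) -> l <= psi.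
Proof.
move=> sl Dpsi; apply/odual_leP => x x0; have [[Dx ubx] ->] := sl x x0.
by apply: ge_sup => // _ [phi Dphi <-]; exact: (odual_leP _ _ (Dpsi _ Dphi)).
Qed.

Lemma pointwise_sup_adherent D l x (e : R) : pointwise_sup D l -> 0 <= x ->
  0 < e -> exists2 phi, D phi & l x - e < phi x.
Proof.
move=> sl x0 e0; have [hs ->] := sl x x0.
by have [_ [phi Dphi <-] ?] := sup_adherent e0 hs; exists phi.
Qed.

(** The supremum of the values is additive on the positive cone because [D] is directed: one member
    above two given ones serves both summands. [cone_ext] then extends it linearly. *)
Lemma order_dual_directed_sup D : D !=set0 -> upward_directed D ->
  (forall phi, D phi -> 0 <= phi) ->
  (forall x, 0 <= x -> has_ubound [set (phi x : R) | phi in D]) ->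
  exists l, pointwise_sup D l.
Proof.
move=> [phi0 Dphi0] dirD posD ubD.
have hs x : 0 <= x -> has_sup [set (phi x : R) | phi in D].
  by move=> x0; split; [exists (phi0 x), phi0|exact: ubD].
pose f x : R := sup [set (phi x : R) | phi in D].
have le_f phi x : D phi -> 0 <= x -> phi x <= f x.
  by move=> Dphi x0; apply: ub_le_sup; [exact: ubD|exists phi].
have f_le (M : R) x : (forall phi, D phi -> phi x <= M) -> f x <= M.
  move=> leM; apply: ge_sup; first by exists (phi0 x), phi0.
  by move=> _ [phi Dphi <-]; exact: leM.
have fD x y : 0 <= x -> 0 <= y -> f (x + y) = f x + f y.
  move=> x0 y0; apply/le_anti/andP; split.
    by apply: (f_le) => phi Dphi; rewrite linearD; apply: lerD; exact: le_f.
  rewrite -lerBrDr; apply: (f_le) => phi Dphi.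
  rewrite lerBrDr addrC -lerBrDr; apply: (f_le) => psi Dpsi.
  rewrite lerBrDr; have [chi [Dchi chiphi chipsi]] := dirD _ _ Dphi Dpsi.
  apply: le_trans (le_f _ _ Dchi (vl_addr_ge0 x0 y0)).
  rewrite linearD addrC; apply: lerD.
    exact: (odual_leP _ _ chiphi).
  exact: (odual_leP _ _ chipsi).
have fZ (a : R) x : 0 <= a -> 0 <= x -> f (a *: x) = a * f x.
  move=> a0 x0; have [->|aN0] := eqVneq a 0.
    rewrite scale0r mul0r; apply/le_anti/andP; split.
      by apply: (f_le) => phi _; rewrite linear0.
    by apply: le_trans (le_f _ _ Dphi0 (lexx _)); rewrite linear0.
  have a_gt0 : 0 < a by rewrite lt_neqAle eq_sym aN0.
  apply/le_anti/andP; split.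
    apply: (f_le) => phi Dphi; rewrite linearZ/=.
    by apply: ler_wpM2l => //; exact: le_f.
  rewrite -ler_pdivlMl//; apply: (f_le) => phi Dphi; rewrite ler_pdivlMl//.
  apply: le_trans (le_f _ _ Dphi (vl_scale_ge0 _ _ a0 x0)).
  by rewrite linearZ.
have obl_f : obl_functional (cone_ext f).
  apply: positive_obl; first exact: cone_ext_linear.
  move=> x x0; rewrite cone_extE//; apply: le_trans (le_f _ _ Dphi0 x0).
  exact: (odual_leP _ _ (posD _ Dphi0)).
by exists (OrderDual obl_f) => x x0; split; [exact: hs|exact: cone_extE].
Qed.

(** If [phi] in [D] is within e/2 of [l] at [b], then positivity of [l - phi] keeps it within e/2 at
    every positive element below [b]; smallness of [phi] thus passes to [l]. *)
Lemma pointwise_sup_oc D l : pointwise_sup D l -> 0 <= l ->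
  (forall phi, D phi -> order_continuous phi) ->
  order_continuous l.
Proof.
move=> sl l0 ocD; apply/order_continuousP => A dA e e0.
have [[b Ab] dirA [lbA _]] := dA; have b0 := lbA _ Ab.
have e2 : 0 < e / 2 by rewrite divr_gt0.
have [phi Dphi lphi] := pointwise_sup_adherent sl b0 e2.
have [a Aa small] := (order_continuousP phi).1 (ocD _ Dphi) A dA _ e2.
have [c [Ac ca cb]] := dirA _ _ Aa Ab.
exists c => // d Ad dc; have d0 := lbA _ Ad.
rewrite ger0_norm; last exact: (odual_leP _ _ l0).
have := le_lt_trans (ler_norm _) (small _ Ad (le_trans dc ca)).
have : phi (b - d) <= l (b - d).
  apply: (odual_leP _ _ (pointwise_sup_ub sl Dphi)).
  by rewrite vl_subr_ge0 (le_trans dc).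
rewrite !odualB; move: (phi b) (phi d) (l b) (l d) lphi => p q r s.
by rewrite /GRing.scale/=; clear; lra.
Qed.

End DirectedSup.

(** * Continuous functions on extremally disconnected spaces *)

Lemma clopen_setC {X : topologicalType} (U : set X) : clopen U -> clopen (~` U).
Proof.
by case=> oU cU; split; [exact: closed_openC|exact: open_closedC].
Qed.

Lemma clopenD {X : topologicalType} (U V : set X) :
  clopen U -> clopen V -> clopen (U `\` V).
Proof.
by move=> cU cV; rewrite setDE; apply: clopenI => //; exact: clopen_setC.
Qed.

Section ContinuousFunctionAlgebra.
Context {R : realType} {X : topologicalType}.
Implicit Types (u v w : Cfun R X) (U V W : set X).

Lemma cfunM_cts u v : continuous (fun x => u x * v x : R).
Proof.
by move=> x; apply: (@continuousM R X u v); exact: cfun_continuous.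
Qed.

Definition cfunM u v : Cfun R X := mkcts (@cfunM_cts u v).

Definition cfun_cst (a : R) : Cfun R X := mkcts (@cst_continuous X R a).

Lemma clopen_indic_cts U : clopen U -> continuous (\1_U : X -> R).
Proof.
move=> [oU cU] x; have [Ux|NUx] := pselect (U x).
  apply: (@near_cst_continuous X R 1); near=> y.
  by rewrite indicE mem_set//; near: y; exact: open_nbhs_nbhs.
apply: (@near_cst_continuous X R 0); near=> y.
rewrite indicE memNset//; near: y; apply: open_nbhs_nbhs; split=> //.
exact: closed_openC.
Unshelve. all: by end_near. Qed.

Lemma cind_exists U : exists u, (clopen U -> forall x, u x = (x \in U)%:R) /\
  (~ clopen U -> u = 0).
Proof.
have [cU|NU] := pselect (clopen U); last by exists 0.
exists (mkcts (@clopen_indic_cts U cU)); split=> // _ x.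
Qed.

(* The indicator of [U], or the zero function if [U] is not clopen. *)
Definition cind U : Cfun R X := sval (cid (cind_exists U)).

Lemma cindE U x : clopen U -> cind U x = (x \in U)%:R.
Proof. by move=> cU; rewrite (svalP (cid (cind_exists U))).1. Qed.

Lemma cindN U : ~ clopen U -> cind U = 0.
Proof. by move=> cU; rewrite [LHS](svalP (cid (cind_exists U))).2. Qed.

Lemma cind_in U x : clopen U -> U x -> cind U x = 1.
Proof. by move=> cU Ux; rewrite cindE// mem_set. Qed.

Lemma cind_out U x : clopen U -> ~ U x -> cind U x = 0.
Proof. by move=> cU Ux; rewrite cindE// memNset. Qed.

Lemma cind_ge0x U x : 0 <= cind U x.
Proof. by have [cU|/cindN ->//] := pselect (clopen U); rewrite cindE. Qed.

Lemma cind_le1x U x : cind U x <= 1.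
Proof.
have [cU|/cindN ->] := pselect (clopen U); last exact: ler01.
by rewrite cindE// lern1 leq_b1.
Qed.

Lemma cind_ge0 U : 0 <= cind U.
Proof. by apply/cfun_leP => x; exact: cind_ge0x. Qed.

Lemma cind_le U V : clopen U -> clopen V -> U `<=` V -> cind U <= cind V.
Proof.
move=> cU cV UV; apply/cfun_leP => x; rewrite !cindE//.
case: (boolP (x \in U)) => [xU|_]; last by rewrite ler0n.
by rewrite (mem_set (UV _ (set_mem xU))) lexx.
Qed.

Lemma cind0 : cind set0 = 0.
Proof. by apply: cfunP => x; rewrite cind_out//; exact: clopen0. Qed.

Lemma cind_setU U V : clopen U -> clopen V ->
  cind (U `|` V) <= cind U + cind V.
Proof.
move=> cU cV; apply/cfun_leP => x.
rewrite [leRHS](_ : _ = cind U x + cind V x)//.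
have [[Ux|Vx]|NUV] := pselect ((U `|` V) x).
- by rewrite (le_trans (cind_le1x _ _))// (cind_in cU Ux) lerDl cind_ge0x.
- by rewrite (le_trans (cind_le1x _ _))// (cind_in cV Vx) lerDr cind_ge0x.
- by rewrite cind_out ?addr_ge0 ?cind_ge0x//; exact: clopenU.
Qed.

Lemma open_cfun_gt u (a : R) : open [set x | a < u x].
Proof.
rewrite (_ : [set _ | _] = u @^-1` [set y : R | a < y])//.
apply: open_comp; last exact: open_gt.
by move=> x _; exact: cfun_continuous.
Qed.

Lemma open_cfun_lt u (a : R) : open [set x | u x < a].
Proof.
rewrite (_ : [set _ | _] = u @^-1` [set y : R | y < a])//.
apply: open_comp; last exact: open_lt.
by move=> x _; exact: cfun_continuous.
Qed.

Lemma closure_cfun_ge u (a : R) x : closure [set x | a < u x] x -> a <= u x.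
Proof.
move=> clx; rewrite leNgt; apply/negP => ua.
have [y [/= ay ya]] := clx _ (open_nbhs_nbhs (conj (open_cfun_lt u a) ua)).
by have := lt_trans ay ya; rewrite ltxx.
Qed.

Lemma closure_cfun_le u (a : R) (A : set X) x : (forall y, A y -> u y <= a) ->
  closure A x -> u x <= a.
Proof.
move=> Au clx; rewrite leNgt; apply/negP => ua.
have [y [/Au]] := clx _ (open_nbhs_nbhs (conj (open_cfun_gt u a) ua)).
by rewrite leNgt => /negP.
Qed.

Lemma vl_absE u x : vl_abs u x = `|u x|.
Proof.
rewrite /vl_abs [LHS](_ : _ = Num.max (u x) (- u x))//.
have [u0|u0] := lerP 0 (u x).
  by rewrite max_l ?ger0_norm// (le_trans _ u0)// oppr_le0.
by rewrite max_r ?ltr0_norm// (le_trans (ltW u0))// oppr_ge0 ltW.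
Qed.

End ContinuousFunctionAlgebra.

Section ExtremallyDisconnected.
Context {X : topologicalType}.
Hypothesis X_ed : extremally_disconnected X.
Hypothesis X_reg : regular_space X.

Lemma ed_closure_clopen (U : set X) : open U -> clopen (closure U).
Proof. by move=> oU; split; [exact: X_ed|exact: closed_closure]. Qed.

Lemma clopen_nbhs (x : X) (U : set X) : nbhs x U ->
  exists W, [/\ clopen W, W x & W `<=` U].
Proof.
move=> /X_reg[V /nbhs_interior xV VU]; exists (closure V°); split.
- by apply: ed_closure_clopen; exact: open_interior.
- by apply: subset_closure; exact: nbhs_singleton.
- by apply: subset_trans VU; apply: closure_subset; exact: interior_subset.
Qed.

End ExtremallyDisconnected.

(** * Order bounded functionals on C(X): truncation and clopen sets *)

Section BoundedOnFunctionals.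
Context {R : realType} {X : topologicalType}.
Implicit Types (u v w : Cfun R X) (U V W : set X) (sigma tau phi : order_dual (Cfun R X)).

Definition cfun_excess u (a : R) : Cfun R X := vl_pos (u - cfun_cst a).

Lemma cfun_excessE u a x : cfun_excess u a x = Num.max (u x - a) 0.
Proof. by []. Qed.

(** The dominating function is the sum of all the terms. Where [u < N] the terms of index at least
    [N] vanish, so the sum is locally finite and hence continuous. *)
Lemma cfun_dominating u (a : nat -> R) : (forall n, 0 <= a n) ->
  exists w, forall n, a n *: cfun_excess u n%:R <= w.
Proof.
move=> a0.
pose S N y : R := \sum_(n < N) a n * Num.max (u y - n%:R) 0.
pose f y : R := S (Num.truncn (u y)).+1 y.
have fS N y : u y < N%:R -> (0 < N)%N -> f y = S N y.
  move=> uN N0; have trN : (Num.truncn (u y) < N)%N.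
    by rewrite -(prednK N0) ltnS truncn_le_nat prednK.
  rewrite /f /S [RHS](bigID (fun n : 'I_N => (n < (Num.truncn (u y)).+1)%N))/=.
  rewrite [X in _ = _ + X]big1 ?addr0.
    by rewrite (big_ord_widen _ (fun n => a n * Num.max (u y - n%:R) 0) trN).
  move=> n; rewrite -leqNgt => hn; rewrite max_r ?mulr0// subr_le0.
  apply: ltW; apply: lt_le_trans (truncnS_gt _) _.
  by rewrite ler_nat.
have Scts N : continuous (S N).
  elim: N => [|N IH] y.
    rewrite [S 0%N](_ : _ = fun=> 0); first exact: cst_continuous.
    by apply/funext => z; rewrite /S big_ord0.
  rewrite [S N.+1](_ : _ = fun z => S N z + (a N *: cfun_excess u N%:R) z).
    by apply: (@cvgD R R^o); [exact: IH|exact: cfun_continuous].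
  by apply/funext => z; rewrite /S big_ord_recr.
have fcts : continuous f.
  move=> y; have [N uN] : exists N, u y < N.+1%:R.
    by exists (Num.truncn (u y)); exact: truncnS_gt.
  rewrite /continuous_at (fS N.+1)//.
  apply: cvg_trans (Scts N.+1 y); apply: near_eq_cvg; near=> z.
  rewrite (fS N.+1)//; near: z; apply: (@open_nbhs_nbhs _ y).
  by split=> //; exact: open_cfun_lt.
exists (mkcts fcts) => n; apply/cfun_leP => y /=.
have [N [uN nN]] : exists N, u y < N%:R /\ (n < N)%N.
  exists (maxn n (Num.truncn (u y))).+1; split; last by rewrite ltnS leq_maxl.
  by rewrite (lt_le_trans (truncnS_gt _))// ler_nat ltnS leq_maxr.
rewrite [leRHS](fS N)//; last by rewrite (leq_ltn_trans _ nN).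
rewrite /S (bigD1 (Ordinal nN))//= lerDl sumr_ge0// => i _.
by rewrite mulr_ge0// le_max lexx orbT.
Unshelve. all: by end_near. Qed.

Lemma cfun_excess_ge0 u a : 0 <= cfun_excess u a.
Proof. exact: vl_pos_ge0. Qed.

(* Otherwise |sigma| is unbounded on [0, w], where w dominates the multiples  *)
(* n |sigma ((u - n)^+)|^-1 (u - n)^+ for all n.                              *)
Lemma obl_excess_eq0 sigma u : exists n : nat, sigma (cfun_excess u n%:R) = 0.
Proof.
apply: contrapT => /forallNP sN.
pose e n := cfun_excess u n%:R; pose a n : R := n%:R / `|sigma (e n)|.
have a0 n : 0 <= a n by rewrite divr_ge0.
have [w wa] := cfun_dominating u a0.
have [M sM] := odual_bounded sigma 0 w.
pose n := (Num.truncn M).+1.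
have := sM (a n *: e n) (vl_scale_ge0 _ _ (a0 n) (cfun_excess_ge0 _ _)) (wa n).
rewrite odualZ normrM ger0_norm// /a mulfVK ?normr_eq0; last exact/eqP/sN.
by rewrite leNgt truncnS_gt.
Qed.

(** A positive functional does not see [u] above a certain level; this does the work of boundedness
    on a compact support. *)
Lemma pos_excess_eq0 phi u : 0 <= phi ->
  exists2 n : nat, (0 < n)%N & forall w, 0 <= w -> w <= cfun_excess u n%:R ->
    phi w = 0.
Proof.
move=> phi0; have [n pn] := obl_excess_eq0 phi u.
exists n.+1 => // w w0 wn; apply/le_anti; rewrite (odual_leP _ _ phi0)// andbT.
rewrite -[leRHS]pn; apply: odual_mono => //; apply: (le_trans wn).
apply/cfun_leP => x; rewrite !cfun_excessE.
rewrite ge_max !le_max lexx orbT andbT; apply/orP; left.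
by rewrite lerD2l lerN2 ler_nat.
Qed.

Section positivity.
Hypothesis X_ed : extremally_disconnected X.

(** Binary expansion: with [U] the closure of [{v > 1/2}], [v] is half of [cind U] plus half of a
    function [v'] again between 0 and 1. A lower bound -M on the unit interval therefore improves to
    -M/2^n for every n. *)
Lemma obl_ge0_unit sigma : (forall U, clopen U -> 0 <= sigma (cind U)) ->
  forall u, 0 <= u -> u <= cfun_cst 1 -> 0 <= sigma u.
Proof.
move=> s0 u u0 u1.
have [M sM] := odual_bounded sigma 0 (cfun_cst 1).
suff H n v : 0 <= v -> v <= cfun_cst 1 -> - (M / 2 ^+ n) <= sigma v.
  rewrite leNgt; apply/negP => su0.
  have : (M + 1) / 2 ^+ (Num.truncn ((M + 1) / - sigma u)).+1 < - sigma u.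
    rewrite ltr_pdivrMr ?exprn_gt0//.
    rewrite mulrC -ltr_pdivrMr ?oppr_gt0//.
    apply: (lt_le_trans (truncnS_gt _)).
    by rewrite -natrX ler_nat ltnW// ltn_expl.
  set n := (Num.truncn _).+1 => sn.
  have := H n u u0 u1; rewrite lerNl => su.
  have := lt_le_trans sn su.
  by rewrite ltr_pM2r ?invr_gt0 ?exprn_gt0// gtrDl ltNge ler01.
elim: n v => [|n IH] v v0 v1.
  rewrite expr0 divr1 lerNl (le_trans (ler_norm _))// normrN; exact: sM.
pose U := closure [set x | 2^-1 < v x].
have cU : clopen U by apply: ed_closure_clopen => //; exact: open_cfun_gt.
pose v' : Cfun R X := 2 *: (v - 2^-1 *: cind U).
have -> : v = 2^-1 *: cind U + 2^-1 *: v'.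
  by rewrite scalerA mulVf// scale1r addrC subrK.
have v'x x : v' x = 2 * (v x - 2^-1 * cind U x) by [].
have v0x x : 0 <= v x by move/cfun_leP: v0; exact.
have v1x x : v x <= 1 by move/cfun_leP: v1; exact.
have v'0 : 0 <= v'.
  apply/cfun_leP => x; rewrite v'x [leLHS](_ : _ = 0)// mulr_ge0//.
  have [Ux|NUx] := pselect (U x).
    by rewrite cind_in// mulr1 subr_ge0; exact: closure_cfun_ge Ux.
  by rewrite cind_out// mulr0 subr0.
have v'1 : v' <= cfun_cst 1.
  apply/cfun_leP => x; rewrite v'x [leRHS](_ : _ = 1)//.
  have [Ux|NUx] := pselect (U x).
    by rewrite cind_in//; move: (v1x x); lra.
  rewrite cind_out//; have : v x <= 2^-1.
    by rewrite leNgt; apply/negP => vx; apply: NUx; exact: subset_closure.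
  by lra.
have := IH v' v'0 v'1; rewrite odualD !odualZ.
have -> : M / 2 ^+ n.+1 = 2^-1 * (M / 2 ^+ n) by rewrite exprS invfM mulrCA.
have := s0 U cU.
move: (sigma (cind U)) (sigma v') (M / 2 ^+ n) => p q r; lra.
Qed.

Lemma obl_ge0 sigma : (forall U, clopen U -> 0 <= sigma (cind U)) -> 0 <= sigma.
Proof.
move=> s0; apply/odual_leP => u u0; rewrite [leLHS](_ : _ = 0)//.
have [n sn] := obl_excess_eq0 sigma u.
rewrite -[X in sigma X](subrK (cfun_excess u n%:R)) odualD sn addr0.
(* Scaling by [n.+1] instead of [n] keeps the factor invertible when [n] is 0. *)
pose v : Cfun R X := n.+1%:R^-1 *: (u - cfun_excess u n%:R).
have -> : u - cfun_excess u n%:R = n.+1%:R *: v.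
  by rewrite scalerA divff ?pnatr_eq0// scale1r.
have bnd x : 0 <= u x - cfun_excess u n%:R x <= n.+1%:R.
  have ux : 0 <= u x by move/cfun_leP: u0; exact.
  rewrite cfun_excessE maxEle; case: ifPn => [h|/negbTE h].
    by rewrite subr0 ux/= -natr1; move: h; lra.
  have n0 : 0 <= n%:R :> R by rewrite ler0n.
  by rewrite opprB addrC subrK n0/= ler_nat.
rewrite odualZ; apply: mulr_ge0 => //; apply: obl_ge0_unit => //.
  apply/cfun_leP => x; rewrite [leRHS](_ : _ = n.+1%:R^-1 *
     (u x - cfun_excess u n%:R x))// [leLHS](_ : _ = 0)//.
  by have /andP[h _] := bnd x; rewrite mulr_ge0.
apply/cfun_leP => x; rewrite [leLHS](_ : _ = n.+1%:R^-1 *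
     (u x - cfun_excess u n%:R x))// [leRHS](_ : _ = 1)//.
by have /andP[_ h] := bnd x; rewrite mulrC ler_pdivrMr ?mul1r.
Qed.

Lemma obl_eq sigma tau : (forall U, clopen U -> sigma (cind U) = tau (cind U)) ->
  sigma = tau.
Proof.
move=> st; apply/le_anti; rewrite -[_ <= tau]vl_subr_ge0 -[tau <= _]vl_subr_ge0.
apply/andP; split; apply: obl_ge0 => U cU.
  by rewrite [leRHS](_ : _ = tau (cind U) - sigma (cind U))// st// subrr.
by rewrite [leRHS](_ : _ = sigma (cind U) - tau (cind U))// st// subrr.
Qed.

End positivity.

End BoundedOnFunctionals.

Section Multiplication.
Context {R : realType} {X : topologicalType}.
Implicit Types (u v w : Cfun R X) (U V W : set X).
Implicit Types (sigma tau phi psi : order_dual (Cfun R X)).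

Lemma cfun_ge0x u x : 0 <= u -> 0 <= u x.
Proof. by move=> /cfun_leP; exact. Qed.

Lemma cfunM_ge0 u v : 0 <= u -> 0 <= v -> 0 <= cfunM u v.
Proof.
by move=> u0 v0; apply/cfun_leP => x; apply: mulr_ge0; exact: cfun_ge0x.
Qed.

Lemma odual_mul_obl phi w :
  obl_functional (fun v : Cfun R X => phi (cfunM w v) : R^o).
Proof.
apply/asboolP; split=> [a x y|x y].
  rewrite -linearP; congr (odual_fun phi _); apply: cfunP => z /=.
  rewrite [RHS](_ : _ = a * (w z * x z) + w z * y z)// -mulrCA -mulrDr.
by [].
pose b := cfunM (vl_abs w) (vl_abs x + vl_abs y).
have [M pM] := odual_bounded phi (- b) b; exists M => z xz zy.
have bz t : `|cfunM w z t| <= b t.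
  rewrite [b t](_ : _ = vl_abs w t * (vl_abs x t + vl_abs y t))// !vl_absE.
  rewrite normrM ler_wpM2l//.
  have := cfun_leP _ _ xz t; have := cfun_leP _ _ zy t.
  move=> zy' xz'; rewrite ler_norml; apply/andP; split.
    have h : - z t <= `|x t|.
      by rewrite lerNl (le_trans _ xz')// lerNl -normrN ler_norm.
    by rewrite lerNl (le_trans h)// lerDl.
  by rewrite (le_trans zy')// (le_trans (ler_norm _))// lerDr.
apply: pM; apply/cfun_leP => t; have := bz t; rewrite ler_norml => /andP[] //.
Qed.

(** In terms of measures, the measure of [phi] multiplied by the density [w]. *)
Definition odual_mul phi w : order_dual (Cfun R X) :=
  OrderDual (odual_mul_obl phi w).

Lemma odual_mulE phi w v : odual_mul phi w v = phi (cfunM w v).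
Proof. by []. Qed.

Lemma odual_mul_ge0 phi w : 0 <= phi -> 0 <= w -> 0 <= odual_mul phi w.
Proof.
move=> p0 w0; apply/odual_leP => v v0; rewrite odual_mulE.
exact: odual_ge0 (cfunM_ge0 _ _).
Qed.

Lemma odual_mulDr phi w1 w2 :
  odual_mul phi (w1 + w2) = odual_mul phi w1 + odual_mul phi w2.
Proof.
apply/val_inj/funext => v /=; rewrite -[RHS]odualD; congr (odual_fun phi _).
by apply: cfunP => t; exact: mulrDl.
Qed.

Lemma odual_mulZr phi a w : odual_mul phi (a *: w) = a *: odual_mul phi w.
Proof.
apply/val_inj/funext => v /=; rewrite -[RHS]odualZ; congr (odual_fun phi _).
by apply: cfunP => t; apply/esym; exact: mulrA.
Qed.

Lemma odual_mulBr phi w1 w2 :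
  odual_mul phi (w1 - w2) = odual_mul phi w1 - odual_mul phi w2.
Proof. by rewrite odual_mulDr -scaleN1r odual_mulZr scaleN1r. Qed.

Lemma odual_mulBl phi psi w :
  odual_mul (phi - psi) w = odual_mul phi w - odual_mul psi w.
Proof. by apply/val_inj/funext. Qed.

(** For every n, |z| is at most n e + (|z| - n)^+; [phi] kills the first term by assumption and the
    second for a suitable n. *)
Lemma pos_null phi e (z : Cfun R X) : 0 <= phi -> phi e = 0 -> 0 <= e ->
  (forall x, z x != 0 -> 1 <= e x) -> phi z = 0.
Proof.
move=> p0 pe0 e0 ze.
have [n n0 pn] := pos_excess_eq0 (vl_abs z) p0.
have aux v : 0 <= v -> v <= vl_abs z -> phi v = 0.
  move=> v0 vz; apply/le_anti/andP; split; last exact: odual_ge0.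
  have -> : 0 = phi (n%:R *: e + cfun_excess (vl_abs z) n%:R).
    by rewrite odualD odualZ pe0 mulr0 add0r pn// cfun_excess_ge0.
  apply: odual_mono => //; apply/cfun_leP => x.
  rewrite [leRHS](_ : _ = n%:R * e x + Num.max (vl_abs z x - n%:R) 0)//.
  have := cfun_leP _ _ vz x; rewrite vl_absE => vzx.
  have [zx|/ze ex] := eqVneq (z x) 0.
    rewrite (le_trans vzx)// zx normr0 addr_ge0 ?mulr_ge0 ?le_max ?lexx ?orbT//.
    exact: cfun_ge0x.
  rewrite (le_trans vzx)// -lerBlDl le_max; apply/orP; left.
  by rewrite lerD2l lerN2 ler_peMr.
have -> : z = vl_pos z - vl_neg z by rewrite vl_posBneg.
have pos_le (r : R) : Num.max r 0 - r <= `|r| /\ Num.max r 0 <= `|r|.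
  by case: (leP r 0) => h; [rewrite ler0_norm//|rewrite gtr0_norm//]; lra.
rewrite odualB !aux ?subr0 ?vl_pos_ge0 ?vl_neg_ge0//.
  by apply/cfun_leP => x; rewrite vl_absE; exact: (pos_le (z x)).1.
by apply/cfun_leP => x; rewrite vl_absE; exact: (pos_le (z x)).2.
Qed.

(** For v >= 0, the product w v is at most (n+1) v + (w - (n+1))^+ v. Where the last term is
    nonzero, (w - n)^+ is at least 1, so [pos_null] removes it once [phi] kills (w - n)^+; hence the
    shift from n to n+1. *)
Lemma odual_mul_le phi w : 0 <= phi ->
  exists n : nat, odual_mul phi w <= n%:R *: phi.
Proof.
move=> p0.
have [n n0 pn] := pos_excess_eq0 w p0; exists n.+1.
have pnv v : 0 <= v -> phi (cfunM (cfun_excess w n.+1%:R) v) = 0.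
  move=> v0; apply: (@pos_null _ (cfun_excess w n%:R)) => //.
  - by apply: pn => //; exact: cfun_excess_ge0.
  - exact: cfun_excess_ge0.
  move=> x; rewrite [X in X != 0](_ : _ = Num.max (w x - n.+1%:R) 0 * v x)//.
  rewrite mulf_eq0 negb_or => /andP[+ _]; rewrite cfun_excessE maxEle.
  case: ifPn => [h|]; first by rewrite eqxx.
  by rewrite -ltNge le_max => h _; apply/orP; left; move: h; rewrite -natr1; lra.
apply/odual_leP => v v0.
rewrite [leRHS](_ : _ = n.+1%:R * phi v)// odual_mulE -odualZ.
rewrite -[leRHS]addr0 -(pnv _ v0) -odualD; apply: odual_mono => //.
apply/cfun_leP => x; rewrite [leLHS](_ : _ = w x * v x)//.
rewrite [leRHS](_ : _ = n.+1%:R * v x + Num.max (w x - n.+1%:R) 0 * v x)//.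
rewrite -mulrDl ler_wpM2r//; first exact: cfun_ge0x.
by rewrite -lerBlDl le_max lexx.
Qed.

Lemma odual_mul_oc phi w : order_continuous phi -> order_continuous (odual_mul phi w).
Proof.
have pos psi v : 0 <= psi -> order_continuous psi -> 0 <= v ->
    order_continuous (odual_mul psi v).
  move=> p0 pc v0; have [n le_n] := odual_mul_le v p0.
  apply: (order_continuous_le _ le_n); first exact: odual_mul_ge0.
  exact: order_continuousZ.
move=> pc; rewrite (odual_posBneg phi) -(vl_posBneg w) odual_mulBl.
rewrite !(odual_mulBr _ (vl_pos w) (vl_neg w)).
have pc1 := odual_pos_oc pc.
have pc2 := order_continuousB pc1 pc.
by apply: order_continuousB; apply: order_continuousB; apply: pos => //;
  rewrite ?odual_pos_ge0 ?odual_neg_ge0 ?vl_pos_ge0 ?vl_neg_ge0.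
Qed.

End Multiplication.

Section OrderContinuity.
Context {R : realType} {X : topologicalType}.
Implicit Types (U V W : set X) (sigma phi : order_dual (Cfun R X)).
Implicit Types (D : set (set X)).

Definition clopen_directed D :=
  [/\ D !=set0, (forall U, D U -> clopen U) &
    forall U V, D U -> D V -> exists W, [/\ D W, U `<=` W & V `<=` W]].

(** The functions 1_U - 1_V, for V in [D], decrease to 0 in C(X): a lower bound is at most 0 on the
    union of [D], hence by continuity on its closure, which contains [U]. *)
Lemma oc_clopen_lim sigma D U (e : R) : order_continuous sigma ->
  clopen_directed D -> clopen U -> (forall V, D V -> V `<=` U) ->
  U `<=` closure (\bigcup_(V in D) V) -> 0 < e ->
  exists2 V, D V & forall W, D W -> V `<=` W ->
    `|sigma (cind U) - sigma (cind W)| < e.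
Proof.
move=> sc [[V0 DV0] cD dirD] cU DU UD e0.
pose A := [set (cind U - cind V : Cfun R X) | V in D].
have dA : decreases_to0 A.
  split; first by exists (cind U - cind V0), V0.
    move=> _ _ [V DV <-] [W DW <-]; have [Z [DZ VZ WZ]] := dirD _ _ DV DW.
    exists (cind U - cind Z); split; first by exists Z.
      by rewrite ![cind U - _]addrC vl_leD2rE vl_leN2 cind_le//; exact: cD.
    by rewrite ![cind U - _]addrC vl_leD2rE vl_leN2 cind_le//; exact: cD.
  split; first by move=> _ [V DV <-]; rewrite vl_subr_ge0 cind_le//;
    [exact: cD|exact: DU].
  move=> z zA; apply/cfun_leP => x; rewrite [leRHS](_ : _ = 0)//.
  have zV V : D V -> z x <= cind U x - cind V x.
    move=> DV; have := zA _ (ex_intro2 _ _ V DV erefl).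
    by move=> /cfun_leP/(_ x).
  have [Ux|Ux] := pselect (U x); last first.
    apply: (le_trans (zV _ DV0)); rewrite cind_out//.
    by rewrite sub0r oppr_le0 cind_ge0x.
  apply: (closure_cfun_le _ (UD _ Ux)) => y [V DV Vy].
  have := zA _ (ex_intro2 _ _ V DV erefl) => /cfun_leP/(_ y) /le_trans; apply.
  rewrite [leLHS](_ : _ = cind U y - cind V y)// [cind V y]cind_in//; last exact: cD.
  by rewrite subr_le0 cind_le1x.
have [_ [V DV <-] small] := (order_continuousP sigma).1 sc A dA e e0.
exists V => // W DW VW; rewrite -odualB; apply: small; first by exists W.
by rewrite ![cind U - _]addrC vl_leD2rE vl_leN2 cind_le//; exact: cD.
Qed.

End OrderContinuity.

(** * Supports and densities of order continuous functionals *)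

Section Support.
Context {R : realType} {X : topologicalType}.
Hypothesis X_ed : extremally_disconnected X.
Hypothesis X_reg : regular_space X.
Implicit Types (u v w : Cfun R X) (U V W : set X).
Implicit Types (phi psi : order_dual (Cfun R X)).

(** A measure-free support, tested on clopen sets so that only values of [phi] enter;
    [oc_charge_support] identifies it with the support of the representing measure. *)
Definition csupp phi : set X :=
  [set x | forall U, clopen U -> U x -> 0 < phi (cind U)].

Lemma pos_cind_eq0 phi U : 0 <= phi -> ~ 0 < phi (cind U) -> phi (cind U) = 0.
Proof.
move=> p0 /negP; rewrite -leNgt => h; apply/le_anti.
by rewrite h odual_ge0// cind_ge0.
Qed.

(** Null clopen sets are closed under finite unions, so by order continuity the closure of their
    union is again null. It is the largest null clopen set, that is, the complement of the
    support. *)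
Lemma csuppC phi : 0 <= phi -> order_continuous phi ->
  clopen (~` csupp phi) /\ phi (cind (~` csupp phi)) = 0.
Proof.
move=> p0 pc; pose D : set (set X) := [set U | clopen U /\ phi (cind U) = 0].
have dD : clopen_directed D.
  split; first by exists set0; split; [exact: clopen0|rewrite cind0 odual0].
    by move=> U [].
  move=> U V [cU pU] [cV pV]; have cUV := clopenU cU cV.
  exists (U `|` V); split; [split=> //|exact: subsetUl|exact: subsetUr].
  apply/le_anti; rewrite odual_ge0// ?cind_ge0// andbT.
  have -> : 0 = phi (cind U + cind V) by rewrite odualD pU pV addr0.
  by apply: odual_mono => //; exact: cind_setU.
pose U := closure (\bigcup_(V in D) V).
have cU : clopen U.
  by apply: ed_closure_clopen => //; apply: bigcup_open => V [[]].
have UV V : D V -> V `<=` U by move=> DV x Vx; apply: subset_closure; exists V.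
have pU : phi (cind U) = 0.
  apply/eqP; rewrite -normr_le0 leNgt; apply/negP => pU.
  have [V DV /(_ V DV (@subset_refl _ V))] :=
    oc_clopen_lim pc dD cU UV (@subset_refl _ U) pU.
  by rewrite DV.2 subr0 ltxx.
have -> : ~` csupp phi = U.
  apply/seteqP; split=> x; last first.
    by move=> Ux /(_ U cU Ux); rewrite pU ltxx.
  move=> /existsNP[V /not_implyP[cV /not_implyP[Vx /(pos_cind_eq0 p0) pV]]].
  by apply: (UV V) => //; split.
by [].
Qed.

Lemma clopen_csupp phi : 0 <= phi -> order_continuous phi -> clopen (csupp phi).
Proof.
by move=> p0 pc; rewrite -[csupp phi]setCK; exact: (clopen_setC (csuppC p0 pc).1).
Qed.

Lemma eq_on_csupp phi u v : 0 <= phi -> order_continuous phi ->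
  (forall x, csupp phi x -> u x = v x) -> phi u = phi v.
Proof.
move=> p0 pc uv; apply/eqP; rewrite -subr_eq0 -odualB; apply/eqP.
have [cN pN] := csuppC p0 pc; apply: (pos_null p0 pN (cind_ge0 _)) => x.
have [Kx|NKx _] := pselect (csupp phi x).
  by rewrite [X in X != 0](_ : _ = u x - v x)// uv// subrr eqxx.
by rewrite (cind_in cN NKx).
Qed.

(** If u(x) > 0, then u exceeds u(x)/2 on a clopen neighbourhood of x, which has positive mass when
    x lies in the support. *)
Lemma pos_eq0_csupp phi u x : 0 <= phi -> 0 <= u -> phi u = 0 ->
  csupp phi x -> u x = 0.
Proof.
move=> p0 u0 pu Kx; apply/le_anti; rewrite (cfun_ge0x _ u0) andbT leNgt.
apply/negP => ux; have ux2 : 0 < u x / 2 by rewrite divr_gt0.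
have [|W [cW Wx Wu]] := clopen_nbhs X_ed X_reg (x := x) (U := [set y | u x / 2 < u y]).
  apply: open_nbhs_nbhs; split; first exact: open_cfun_gt.
  by rewrite /=; lra.
have := Kx W cW Wx; apply/negP; rewrite -leNgt -(ler_pM2l ux2) mulr0 -pu -odualZ.
apply: odual_mono => //; apply/cfun_leP => y.
rewrite [leLHS](_ : _ = u x / 2 * cind W y)//.
have [Wy|NWy] := pselect (W y); first by rewrite cind_in// mulr1 ltW//; exact: Wu.
by rewrite cind_out// mulr0 cfun_ge0x.
Qed.

Lemma le_csupp phi psi : phi <= psi -> csupp phi `<=` csupp psi.
Proof.
move=> /odual_leP pp x Kx U cU Ux; apply: lt_le_trans (Kx U cU Ux) _.
exact/pp/cind_ge0.
Qed.

Lemma csupp_bounded phi u : 0 <= phi -> exists n : nat, forall x, csupp phi x ->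
  `|u x| <= n%:R.
Proof.
move=> p0; have [n n0 pn] := pos_excess_eq0 (vl_abs u) p0; exists n => x Kx.
have := pos_eq0_csupp p0 (cfun_excess_ge0 _ _) (pn _ (cfun_excess_ge0 _ _) (lexx _)) Kx.
rewrite cfun_excessE vl_absE => h; rewrite leNgt; apply/negP => nu.
have : Num.max (`|u x| - n%:R) 0 <= 0 by rewrite h.
by rewrite ge_max lexx andbT subr_le0 leNgt nu.
Qed.

End Support.

Section SupportCompact.
Context {R : realType} {X : topologicalType}.
Hypothesis X_ed : extremally_disconnected X.
Hypothesis X_rc : realcompact R X.

Lemma realcompact_regular : regular_space X.
Proof. by have [_ crs _] := X_rc; exact: completely_regular_regular crs. Qed.

(** Inside a product of lines every coordinate is bounded on the support ([csupp_bounded]), so the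
    support lands in a closed subset of a Tychonoff box; a cluster point found there is carried back
    to X. *)
Lemma compact_csupp (phi : order_dual (Cfun R X)) : 0 <= phi ->
  order_continuous phi -> compact (csupp phi).
Proof.
move=> p0 pc; have [_ _ [I [D [cD [f [g [cf cg fK gK]]]]]]] := X_rc.
pose h (x : X) : prod_topology (fun _ : {classic I} => R) := set_val (f x).
have ccoord i : continuous (fun x => h x i : R).
  move=> x; apply: (@continuous_comp _ _ _ h (proj i)).
    by apply: continuous_comp; [exact: cf|exact: initial_continuous].
  exact: proj_continuous.
have /choice[n nP] i := csupp_bounded X_ed realcompact_regular (mkcts (ccoord i)) p0.
pose P : set (prod_topology (fun _ : {classic I} => R)) :=
  [set p | forall i, [set` `[- (n i)%:R, (n i)%:R]] (p i)].
have cP : compact P.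
  apply: (@tychonoff _ (fun=> R) (fun i => [set` `[- (n i)%:R, (n i)%:R]])) => i.
  exact: segment_compact.
move=> F FF FK.
have hK x : csupp phi x -> (D `&` P) (h x).
  move=> Kx; split; first exact: (set_valP (f x)).
  by move=> i /=; rewrite in_itv/= -ler_norml; exact: (nP i x Kx).
have cDP : compact (D `&` P) by rewrite setIC; exact: (compact_closedI cP cD).
have [p [[Dp Pp] clp]] : (D `&` P) `&` cluster (h @ F) !=set0.
  have hF : F (h @^-1` (D `&` P)) by apply: filterS FK; exact: hK.
  exact: cDP hF.
pose d : D := SigSub (mem_set Dp).
have clF : cluster F (g d).
  move=> A B FA nB; have := cg d _ nB; rewrite nbhsE => -[V [oO Od] OB].
  case: oO => Q oQ QO.
  have hA : F (h @^-1` (h @` A)) by apply: filterS FA => a Aa; exists a.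
  have [//||_ [[a Aa <-] Qa]] := clp (h @` A) Q.
  - by apply: open_nbhs_nbhs; split=> //; move: Od; rewrite -QO.
  by exists a; split=> //; rewrite -(fK a); apply: OB; rewrite -QO.
exists (g d); split=> //.
have [_ clK] := clopen_csupp X_ed p0 pc.
rewrite closure_id in clK; rewrite clK => B nB.
by apply: clF.
Qed.

End SupportCompact.

(** * Clopen Hahn decompositions and continuous densities *)

Section HahnDecomposition.
Context {R : realType} {X : topologicalType}.
Hypothesis X_ed : extremally_disconnected X.
Implicit Types (u v w : Cfun R X) (U V W Q N : set X).
Implicit Types (sigma phi tau : order_dual (Cfun R X)).

Lemma cind_setD U V : clopen U -> clopen V -> V `<=` U ->
  cind (U `\` V) = cind U - cind V :> Cfun R X.
Proof.
move=> cU cV VU; have cD := clopenD cU cV.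
apply: cfunP => x; rewrite [RHS](_ : _ = cind U x - cind V x)//.
have [Vx|NVx] := pselect (V x).
  by rewrite (cind_in cV)// (cind_in cU)//; [rewrite cind_out ?subrr// => -[]|exact: VU].
rewrite (cind_out cV)// subr0.
have [Ux|NUx] := pselect (U x); first by rewrite !cind_in.
by rewrite !cind_out// => -[].
Qed.

(* Zorn: a clopen W inside V that is minimal subject to                       *)
(* sigma (cind W) <= sigma (cind V) has the required property; chains have    *)
(* lower bounds by order continuity.                                          *)
Lemma oc_strictly_negative sigma V : order_continuous sigma -> clopen V ->
  sigma (cind V) < 0 ->
  exists W, [/\ clopen W, W `<=` V, W !=set0 &
    forall Q, clopen Q -> Q `<=` W -> Q !=set0 -> sigma (cind Q) < 0].
Proof.
move=> sc cV sV.
pose T := {U : set X | [/\ clopen U, U `<=` V & sigma (cind U) <= sigma (cind V)]}.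
have T0P : [/\ clopen V, V `<=` V & sigma (cind V) <= sigma (cind V)] by split.
pose t0 : T := exist _ V T0P.
pose r : rel T := fun s t =>
  `[< sval t `<=` sval s /\ sigma (cind (sval t)) <= sigma (cind (sval s)) >].
have [[W [cW WV sW]] maxW] : exists t : T, premaximal r t.
  apply: (ZL_preorder t0).
  - by move=> t; apply/asboolP; split.
  - move=> a b c /asboolP[ba sba] /asboolP[cb scb]; apply/asboolP; split.
      exact: subset_trans ba.
    exact: le_trans sba.
  - move=> A totA.
    have [A0|/set0P[a0 Aa0]] := eqVneq A set0; first by exists t0; rewrite A0.
    pose D : set (set X) := [set V `\` sval t | t in A].
    have cT (t : T) : clopen (sval t) by case: t => U [].
    have TV (t : T) : sval t `<=` V by case: t => U [].
    have dD : clopen_directed D.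
      split; first by exists (V `\` sval a0), a0.
        by move=> _ [t At <-]; exact: clopenD.
      move=> _ _ [s As <-] [t At <-].
      have [/asboolP[st _]|/asboolP[st _]] := totA _ _ As At.
        by exists (V `\` sval t); split; [exists t| |] => //; exact: setDS.
      by exists (V `\` sval s); split; [exists s| |] => //; exact: setDS.
    pose N := closure (\bigcup_(U in D) U).
    have cN : clopen N.
      apply: ed_closure_clopen => //; apply: bigcup_open => _ [t At <-].
      by have [] := clopenD cV (cT t).
    have DN U : D U -> U `<=` N by move=> DU x Ux; apply: subset_closure; exists U.
    have NV : N `<=` V.
      have [_ clV] := cV; rewrite closure_id in clV; rewrite clV.
      by apply: closure_subset => x [_ [t At <-] []].
    have sD (t : T) :
        sigma (cind (V `\` sval t)) = sigma (cind V) - sigma (cind (sval t)).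
      by rewrite cind_setD ?odualB.
    have sN : sigma (cind (V `\` N)) = sigma (cind V) - sigma (cind N).
      by rewrite cind_setD ?odualB.
    have lim (t : T) : A t -> sigma (cind (V `\` N)) <= sigma (cind (sval t)).
      move=> At; apply/ler_addgt0Pr => e e0.
      have [_ [s As <-] small] := oc_clopen_lim sc dD cN DN (@subset_refl _ N) e0.
      (* A member of the chain below both [s] and [t]: being below [s] makes its value nearly the
         limit value, and being below [t] bounds that value by the one at [t]. *)
      have [s' [As' s's ts']] : exists s', [/\ A s', r s s' & r t s'].
        have rr a : r a a by apply/asboolP; split.
        by have [st|st] := totA _ _ As At; [exists t|exists s].
      have /asboolP[s'ss _] := s's; have /asboolP[_ ss't] := ts'.
      have := small (V `\` sval s') (ex_intro2 _ _ s' As' erefl) (setDS s'ss).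
      rewrite sN sD distrC => /(le_lt_trans (ler_norm _)); move: ss't.
      move: (sigma (cind N)) (sigma (cind V)) (sigma (cind (sval s')))
        (sigma (cind (sval t))) => a b c d; lra.
    have tP : [/\ clopen (V `\` N), V `\` N `<=` V &
        sigma (cind (V `\` N)) <= sigma (cind V)].
      split; [exact: clopenD|by move=> x []|].
      by apply: le_trans (lim _ Aa0) _; case: (a0) => U [].
    exists (exist _ (V `\` N) tP) => s As; apply/asboolP; split; last exact: lim.
    move=> x /= [Vx NNx]; apply: contrapT => sx; apply: NNx.
    by apply: (DN (V `\` sval s)) => //; exists s.
have W0 : W !=set0.
  apply/set0P/eqP => We; have := sW; rewrite We.
  by rewrite cind0 odual0 leNgt sV.
exists W; split=> // Q cQ QW [x Qx]; rewrite ltNge; apply/negP => sQ.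
(* Removing a [Q] of nonnegative value gives a strictly smaller admissible set, against
   minimality. *)
have le_s : sigma (cind (W `\` Q)) <= sigma (cind W).
  by rewrite cind_setD// odualB gerBl.
have P' : [/\ clopen (W `\` Q), W `\` Q `<=` V &
    sigma (cind (W `\` Q)) <= sigma (cind V)].
  split; [exact: clopenD|by move=> y [/WV]|exact: (le_trans le_s sW)].
have /= := maxW (exist _ (W `\` Q) P').
case/(_ _)/asboolP => [|/(_ x (QW _ Qx))[]//].
by apply/asboolP; split=> //= y [].
Qed.

Definition nonpos_on sigma W :=
  forall Q, clopen Q -> Q `<=` W -> sigma (cind Q) <= 0.

(** [N] is the closure of the union of all clopen sets on which [sigma] is nonpositive. A positive
    [Q] inside it would be approximated by sets [Q] cut with such a set; a negative [Q] outside it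
    would contain, by [oc_strictly_negative], a nonempty set already included in [N]. *)
Lemma oc_hahn sigma : order_continuous sigma ->
  exists N, [/\ clopen N, nonpos_on sigma N,
    forall W, clopen W -> nonpos_on sigma W -> W `<=` N &
    forall Q, clopen Q -> Q `<=` ~` N -> 0 <= sigma (cind Q)].
Proof.
move=> sc; pose D : set (set X) := [set W | clopen W /\ nonpos_on sigma W].
have D0 : D set0.
  split; first exact: clopen0.
  by move=> Q cQ; rewrite subset0 => ->; rewrite cind0 odual0.
have DU U V : D U -> D V -> D (U `|` V).
  move=> [cU nU] [cV nV]; split; first exact: clopenU.
  move=> Q cQ QUV; have cQU := clopenI cQ cU.
  have -> : cind Q = cind (Q `&` U) + cind (Q `\` (Q `&` U)) :> Cfun R X.
    by have -> := cind_setD cQ cQU (@subIsetl _ _ _); rewrite addrC subrK.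
  rewrite odualD -[leRHS]addr0 lerD//; first by apply: nU => // x [].
  apply: nV; first exact: clopenD.
  by move=> x [Qx nQU]; have [Ux|] := QUV _ Qx; [case: nQU|].
pose N := closure (\bigcup_(W in D) W).
have cN : clopen N.
  by apply: ed_closure_clopen => //; apply: bigcup_open => W [[]].
have DN W : D W -> W `<=` N by move=> DW x Wx; apply: subset_closure; exists W.
have nN : nonpos_on sigma N.
  move=> Q cQ QN; rewrite leNgt; apply/negP => sQ.
  pose DQ : set (set X) := [set Q `&` W | W in D].
  have dDQ : clopen_directed DQ.
    split; first by exists (Q `&` set0), set0.
      by move=> _ [W [cW _] <-]; exact: clopenI.
    move=> _ _ [U DU' <-] [V DV <-]; exists (Q `&` (U `|` V)); split.
    - by exists (U `|` V) => //; exact: DU.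
    - by apply: setIS; exact: subsetUl.
    - by apply: setIS; exact: subsetUr.
  have DQQ W : DQ W -> W `<=` Q by move=> [V _ <-] x [].
  have Qcl : Q `<=` closure (\bigcup_(W in DQ) W).
    move=> x Qx B nB; have nQB : nbhs x (Q `&` B).
      by apply: filterI => //; apply: open_nbhs_nbhs; split=> //; exact: cQ.1.
    have [y [[W DW Wy] [Qy By]]] := QN _ Qx _ nQB.
    by exists y; split=> //; exists (Q `&` W) => //; exists W.
  have [_ [W [cW nW] <-]] := oc_clopen_lim sc dDQ cQ DQQ Qcl sQ.
  move=> /(_ (Q `&` W) (ex_intro2 _ _ W (conj cW nW) erefl) (@subset_refl _ _)).
  have := nW (Q `&` W) (clopenI cQ cW) (@subIsetr _ _ _) => h.
  by rewrite ltNge (le_trans _ (ler_norm _))// lerBrDr gerDl.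
exists N; split=> //; first by move=> W cW nW; exact: DN.
move=> Q cQ QN; rewrite leNgt; apply/negP => sQ.
have [W [cW WQ [x Wx] nW]] := oc_strictly_negative sc cQ sQ.
apply: (QN x (WQ _ Wx)); apply: (DN W) => //; split=> // Q' cQ' Q'W.
have [->|/set0P Q'0] := eqVneq Q' set0; first by rewrite cind0 odual0.
by apply: ltW; exact: nW.
Qed.

End HahnDecomposition.

Section RadonNikodym.
Context {R : realType} {X : topologicalType}.
Hypothesis X_ed : extremally_disconnected X.
Hypothesis X_reg : regular_space X.
Implicit Types (u v w : Cfun R X) (U V W Q N : set X).
Implicit Types (phi tau : order_dual (Cfun R X)).

Lemma clopen_nbhs_near u x (e : R) W : 0 < e -> clopen W -> W x ->
  exists Q, [/\ clopen Q, Q `<=` W, Q x &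
    forall y, Q y -> u x - e < u y /\ u y < u x + e].
Proof.
move=> e0 cW Wx.
have [|Q [cQ Qx QW]] := clopen_nbhs X_ed X_reg (x := x)
    (U := W `&` ([set y | u x - e < u y] `&` [set y | u y < u x + e])).
  apply: open_nbhs_nbhs; split; last by split=> //; split => /=; lra.
  apply: openI; first exact: cW.1.
  by apply: openI; [exact: open_cfun_gt|exact: open_cfun_lt].
by exists Q; split=> // [y /QW[]|y /QW[_ []]].
Qed.

Lemma odual_mul_cind_le phi u Q (a : R) : 0 <= phi -> clopen Q ->
  (forall y, Q y -> u y <= a) -> odual_mul phi u (cind Q) <= a * phi (cind Q).
Proof.
move=> p0 cQ ua; rewrite odual_mulE -odualZ; apply: odual_mono => //.
apply/cfun_leP => y; rewrite [leLHS](_ : _ = u y * cind Q y)//.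
rewrite [leRHS](_ : _ = a * cind Q y)//.
have [Qy|NQy] := pselect (Q y); last by rewrite cind_out// !mulr0.
by rewrite cind_in// !mulr1 ua.
Qed.

Lemma odual_mul_cind_ge phi u Q (a : R) : 0 <= phi -> clopen Q ->
  (forall y, Q y -> a <= u y) -> a * phi (cind Q) <= odual_mul phi u (cind Q).
Proof.
move=> p0 cQ ua; rewrite odual_mulE -odualZ; apply: odual_mono => //.
apply/cfun_leP => y; rewrite [leRHS](_ : _ = u y * cind Q y)//.
rewrite [leLHS](_ : _ = a * cind Q y)//.
have [Qy|NQy] := pselect (Q y); last by rewrite cind_out// !mulr0.
by rewrite cind_in// !mulr1 ua.
Qed.

(* The density is u(x) = inf {r >= 0 | x \in N r}, where N r is the largest   *)
(* clopen set on which tau <= r phi.                                          *)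
Lemma oc_radon_nikodym phi tau (c : R) : 0 <= phi -> order_continuous phi ->
  0 <= tau -> tau <= c *: phi -> 0 <= c ->
  exists2 u, 0 <= u & tau = odual_mul phi u.
Proof.
move=> p0 pc t0 tc c0.
have tauc : order_continuous tau.
  by apply: order_continuous_le t0 tc _; exact: order_continuousZ.
have /choice[N NP] (r : R) :=
  oc_hahn X_ed (order_continuousB tauc (order_continuousZ r pc)).
have sE (r : R) Q : (tau - r *: phi) (cind Q) = tau (cind Q) - r * phi (cind Q) by [].
have pQ0 Q : 0 <= phi (cind Q) by rewrite odual_ge0// cind_ge0.
have tQ0 Q : 0 <= tau (cind Q) by rewrite odual_ge0// cind_ge0.
have N_le r Q : clopen Q -> Q `<=` N r -> tau (cind Q) <= r * phi (cind Q).
  by move=> cQ QN; have [_ /(_ Q cQ QN) + _ _] := NP r; rewrite sE subr_le0.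
have N_ge r Q : clopen Q -> Q `<=` ~` N r -> r * phi (cind Q) <= tau (cind Q).
  by move=> cQ QN; have [_ _ _ /(_ Q cQ QN)] := NP r; rewrite sE subr_ge0.
have cN r : clopen (N r) by have [] := NP r.
have N_mono r s : r <= s -> N r `<=` N s.
  move=> rs; have [_ _ /(_ (N r) (cN r)) + _] := NP s; apply.
  move=> Q cQ QN; rewrite sE subr_le0 (le_trans (N_le _ _ cQ QN))//.
  by rewrite ler_wpM2r.
(* The bound [tau <= c *: phi] makes [N c] the whole space, so the infimum defining the density is
   over a nonempty set. *)
have Nc x : N c x.
  have [_ _ /(_ setT clopenT) + _] := NP c; apply=> // Q cQ _.
  by rewrite sE subr_le0; exact: (odual_leP _ _ tc _ (cind_ge0 Q)).
pose S x : set R := [set r | 0 <= r /\ N r x].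
have S_inf x : has_inf (S x).
  by split; [exists c|exists 0 => r []].
pose f x : R := inf (S x).
have f_le (r : R) x : 0 <= r -> N r x -> f x <= r.
  by move=> r0 Nrx; apply: ge_inf; [exact: (S_inf x).2|].
have f_ge0 x : 0 <= f x by apply: lb_le_inf; [exact: (S_inf x).1|move=> r []].
have f_lt x (b : R) : f x < b -> exists r : R, [/\ 0 <= r, r < b & N r x].
  move=> fb; have e0 : 0 < b - f x by rewrite subr_gt0.
  have [r [r0 Nrx]] := inf_adherent e0 (S_inf x).
  by rewrite addrC subrK; exists r.
have f_ge (r : R) x : ~ N r x -> r <= f x.
  move=> Nrx; apply: lb_le_inf; first exact: (S_inf x).1.
  move=> s [s0 Nsx]; rewrite leNgt; apply/negP => sr.
  by apply: Nrx; exact: N_mono (ltW sr) _ Nsx.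
(* Near x, staying in the open set [N r] bounds f above by r, and staying off the closed set
   [N (f x - e)] bounds it below; if [f x - e] is negative, the lower bound is free. *)
have fcts : continuous f.
  move=> x; apply/(@cvgrPdist_le R R^o) => e e0.
  have [r [r0 rfe Nrx]] : exists r, [/\ 0 <= r, r < f x + e & N r x].
    by apply: f_lt; rewrite ltrDl.
  have near1 : \forall y \near x, N r y.
    by apply: open_nbhs_nbhs; split=> //; exact: (cN r).1.
  have near2 : \forall y \near x, f x - e <= f y.
    have [fe0|fe0] := ltP (f x - e) 0.
      by apply: nearW => y; exact: le_trans (ltW fe0) (f_ge0 y).
    have Nfx : ~ N (f x - e) x.
      by move=> /(f_le _ _ fe0); rewrite leNgt gtrDl oppr_lt0 e0.
    have : nbhs x (~` N (f x - e)).
      by apply: open_nbhs_nbhs; split=> //; exact: (clopen_setC (cN _)).1.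
    by apply: filterS => y; exact: f_ge.
  near=> y; have h1 : f y <= r by apply: f_le => //; near: y.
  have h2 : f x - e <= f y by near: y.
  by rewrite ler_norml; apply/andP; split; move: h1 h2 rfe; lra.
pose u : Cfun R X := mkcts fcts.
have uE x : u x = f x by [].
(* By [oc_strictly_negative], nonnegativity need only be found on some nonempty clopen part of each
   nonempty clopen set. This allows shrinking to a [Q] on which [u] varies by less than e/2. *)
have strict (sigma : order_dual (Cfun R X)) :
    (forall W, clopen W -> W !=set0 -> exists Q, [/\ clopen Q,
      Q `<=` W, Q !=set0 & 0 <= sigma (cind Q)]) ->
    order_continuous sigma -> 0 <= sigma.
  move=> sW sc; apply: obl_ge0 => // V cV; rewrite leNgt; apply/negP => sV.
  have [W [cW _ W0 WQ]] := oc_strictly_negative X_ed sc cV sV.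
  have [Q [cQ QW Q0]] := sW W cW W0.
  by rewrite leNgt WQ.
have muc := odual_mul_oc u pc.
(* The two estimates on [Q] hold up to e times [phi], e/2 from the variation of [u] and e/2 from the
   choice of level; letting e tend to 0 absorbs this. *)
have e_trick (s1 s2 : order_dual (Cfun R X)) : (forall e : R, 0 < e ->
    0 <= s1 + e *: phi - s2) -> s2 <= s1.
  move=> h; apply/odual_leP => v v0; apply/ler_addgt0Pr => e e0.
  have e1 : 0 < e / (phi v + 1) by rewrite divr_gt0// ltr_wpDl// odual_ge0.
  have := odual_leP _ _ (h _ e1) v v0.
  rewrite [leRHS](_ : _ = s1 v + e / (phi v + 1) * phi v - s2 v)//.
  rewrite [leLHS](_ : _ = 0)// subr_ge0 => /le_trans; apply; rewrite lerD2l.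
  rewrite mulrAC ler_pdivrMr ?ltr_wpDl ?odual_ge0//.
  by rewrite mulrDr mulr1 lerDl ltW.
exists u; first by apply/cfun_leP => x; exact: f_ge0.
apply/le_anti/andP; split; apply: e_trick => e e0.
  apply: strict; last first.
    apply: order_continuousB => //; apply: order_continuousD => //.
    exact: order_continuousZ.
  move=> W cW [x Wx]; have e2 : 0 < e / 2 by rewrite divr_gt0.
  have [r [r0 rfe Nrx]] : exists r, [/\ 0 <= r, r < f x + e / 2 & N r x].
    by apply: f_lt; rewrite ltrDl.
  have [Q [cQ QWN Qx Qu]] := clopen_nbhs_near u e2 (clopenI cW (cN r)) (conj Wx Nrx).
  exists Q; split=> //; [by move=> y /QWN[]|by exists x|].
  rewrite [leRHS](_ : _ = odual_mul phi u (cind Q) + e * phi (cind Q) - tau (cind Q))//.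
  have h1 := N_le r Q cQ (fun y Qy => (QWN y Qy).2).
  have h2 : (f x - e / 2) * phi (cind Q) <= odual_mul phi u (cind Q).
    by apply: odual_mul_cind_ge => // y /Qu[/ltW].
  have h3 : r * phi (cind Q) <= (f x + e / 2) * phi (cind Q).
    by rewrite ler_wpM2r// ltW.
  by move: h1 h2 h3; move: (odual_mul _ _ _) => a; lra.
apply: strict; last first.
  apply: order_continuousB => //; apply: order_continuousD => //.
  exact: order_continuousZ.
move=> W cW [x Wx]; have e2 : 0 < e / 2 by rewrite divr_gt0.
have tE Q : (tau + e *: phi - odual_mul phi u) (cind Q) =
  tau (cind Q) + e * phi (cind Q) - odual_mul phi u (cind Q) by [].
have [fe0|fe0] := ltP (f x - e / 2) 0.
  have [Q [cQ QW Qx Qu]] := clopen_nbhs_near u e2 cW Wx.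
  exists Q; split=> //; [by exists x|].
  have h2 : odual_mul phi u (cind Q) <= e * phi (cind Q).
    by apply: odual_mul_cind_le => // y /Qu[_]; rewrite !uE; move: fe0; lra.
  by rewrite tE; move: h2 (tQ0 Q); move: (odual_mul _ _ _) => a; lra.
have Nfx : ~ N (f x - e / 2) x.
  by move=> /(f_le _ _ fe0); rewrite leNgt gtrDl oppr_lt0 e2.
have [Q [cQ QWN Qx Qu]] := clopen_nbhs_near u e2
  (clopenI cW (clopen_setC (cN _))) (conj Wx Nfx).
exists Q; split=> //; [by move=> y /QWN[]|by exists x|].
have h1 := N_ge _ Q cQ (fun y Qy => (QWN y Qy).2).
have h2 : odual_mul phi u (cind Q) <= (f x + e / 2) * phi (cind Q).
  by apply: odual_mul_cind_le => // y /Qu[_ /ltW].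
by rewrite tE; move: h1 h2; move: (odual_mul _ _ _) => a; lra.
Unshelve. all: by end_near. Qed.

End RadonNikodym.

(** * Order duals and the extension property *)

Section Extension.
Context {R : realType} {X : topologicalType}.
Implicit Types (u v w : Cfun R X) (U V W Q N : set X).
Implicit Types (phi psi : order_dual (Cfun R X)).

Definition oc_pos : set (order_dual (Cfun R X)) :=
  [set phi : order_dual (Cfun R X) | 0 <= phi /\ order_continuous phi].

Lemma oc_posD phi psi : oc_pos phi -> oc_pos psi -> oc_pos (phi + psi).
Proof.
by move=> [p0 pc] [q0 qc]; split; [exact: vl_addr_ge0|exact: order_continuousD].
Qed.

Lemma oc_pos0 : oc_pos 0.
Proof.
split=> //; have /asboolP := @rpred0 _ (@oc_functional R (Cfun R X)).
by [].
Qed.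

Definition oc_csupp : set X := \bigcup_(phi in oc_pos) csupp phi.

Definition glueable (h : X -> R) := forall phi, oc_pos phi ->
  exists v, forall x, csupp phi x -> h x = v x.

(* The condition upsilon S = X: the sets csupp phi are open in X and cover S, *)
(* so the continuous functions on S are exactly the glueable ones.            *)
Definition extension_property :=
  (forall u, (forall x, oc_csupp x -> u x = 0) -> u = 0) /\
  (forall h, glueable h -> exists g : Cfun R X, forall x, oc_csupp x -> g x = h x).

End Extension.

Section ExtensionFromDual.
Context {R : realType} {X : topologicalType}.
Hypothesis X_ed : extremally_disconnected X.
Context {E : vectorLatticeType R} (f : Cfun R X -> order_dual E).
Hypothesis f_linear : linear f.
Hypothesis f_le : order_embedding f.
(** Common to both uses: an isomorphism onto an order dual has every [l] in its range, and the
    evaluation map of a perfect space has the order continuous ones, which include such suprema. *)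
Hypothesis f_sup : forall (D : set (Cfun R X)) l, D !=set0 ->
  (forall u, D u -> 0 <= u) -> pointwise_sup [set f u | u in D] l ->
  exists g, f g = l.
Implicit Types (u v w : Cfun R X).

Let fD u v : f (u + v) = f u + f v.
Proof. by have := f_linear 1 u v; rewrite !scale1r. Qed.

Let f0 : f 0 = 0.
Proof. by apply: (addIr (f 0)); rewrite -fD !add0r. Qed.

Let fZ a u : f (a *: u) = a *: f u.
Proof. by have := f_linear a u 0; rewrite f0 !addr0. Qed.

Let fB u v : f (u - v) = f u - f v.
Proof. by rewrite fD -scaleN1r fZ scaleN1r. Qed.

Let f_ge0 u : 0 <= u -> 0 <= f u.
Proof. by move=> u0; rewrite -f0 f_le. Qed.

Lemma dual_directed_sup (D : set (Cfun R X)) : D !=set0 -> upward_directed D ->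
  (forall u, D u -> 0 <= u) ->
  (forall e, 0 <= e -> exists M : R, forall u, D u -> f u e <= M) ->
  exists g, pointwise_sup [set f u | u in D] (f g).
Proof.
move=> D0 dD Dpos Dbnd.
have [||||l lP] := @order_dual_directed_sup R E [set f u | u in D].
- by have [u Du] := D0; exists (f u), u.
- move=> _ _ [u Du <-] [v Dv <-]; have [w [Dw uw vw]] := dD _ _ Du Dv.
  by exists (f w); split; [exists w|rewrite f_le|rewrite f_le].
- by move=> _ [u Du <-]; apply: f_ge0; exact: Dpos.
- move=> e e0; have [M DM] := Dbnd e e0.
  by exists M => _ [_ [u Du <-] <-]; exact: DM.
by have [g fg] := f_sup D0 Dpos lP; exists g; rewrite fg.
Qed.

Lemma dual_eval_obl (e : E) : 0 <= e ->
  obl_functional (fun u : Cfun R X => f u e : R^o).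
Proof.
move=> e0; apply: positive_obl; first by move=> a u v; rewrite f_linear.
by move=> u u0; apply: odual_ge0 => //; exact: f_ge0.
Qed.

(** If A decreases to 0, the functions a0 - a increase to a0 in C(X). Their pointwise supremum in
    the dual comes from some g, and g >= a0 because a0 - g is a lower bound of A; hence the values
    f(a)(e) decrease to 0. *)
Lemma dual_eval_oc_pos (e : E) (e0 : 0 <= e) :
  oc_pos (OrderDual (dual_eval_obl e0)).
Proof.
split; first by apply/odual_leP => u u0; exact: (odual_ge0 (f_ge0 u0) e0).
move=> A dA; have [[a0 Aa0] dirA [lbA glbA]] := dA.
apply/inf_norm_eq0P; first by exists a0.
move=> eps eps0.
(* Restricting to members below [a0] makes the differences nonnegative. *)
pose D : set (Cfun R X) := [set u : Cfun R X | exists a, [/\ A a, a <= a0 & u = a0 - a]].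
have D_le u : D u -> u <= a0.
  by move=> [a [Aa _ ->]]; rewrite vl_leBl -[leLHS]addr0 [a0 + a]addrC
    [a0 + 0]addrC vl_leD2rE lbA.
have [||||g gP] := @dual_directed_sup D.
- by exists (a0 - a0), a0.
- move=> _ _ [a [Aa aa0 ->]] [b [Ab ba0 ->]].
  have [c [Ac ca cb]] := dirA _ _ Aa Ab; exists (a0 - c).
  split; first by exists c; split=> //; exact: le_trans ca aa0.
    by rewrite ![a0 - _]addrC vl_leD2rE vl_leN2.
  by rewrite ![a0 - _]addrC vl_leD2rE vl_leN2.
- by move=> _ [a [Aa aa0 ->]]; rewrite vl_subr_ge0.
- move=> e' e'0; exists (f a0 e') => u Du.
  by have : f u <= f a0; [rewrite f_le D_le|move=> /odual_leP; exact].
have a0g : a0 <= g.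
  rewrite -vl_subr_ge0 -vl_leN2 oppr0 opprB; apply: glbA => a Aa.
  have [b [Ab ba ba0]] := dirA _ _ Aa Aa0.
  apply: le_trans ba; rewrite vl_leBlC -f_le.
  by apply: (pointwise_sup_ub gP); exists (a0 - b) => //; exists b.
have [_ [_ [a [Aa aa0 ->]] <-]] := pointwise_sup_adherent gP e0 eps0.
have : f a0 <= f g by rewrite f_le.
move=> /odual_leP/(_ e e0) fa0 fg; exists a => //=.
rewrite ger0_norm; last by apply: odual_ge0 => //; apply: f_ge0; exact: lbA.
move: fg; rewrite fB [X in _ < X](_ : _ = f a0 e - f a e)//.
by move: fa0; move: (f a0 e) (f g e) (f a e) => p q r; lra.
Qed.

Lemma pos_le_on_csupp (phi : order_dual (Cfun R X)) u v : oc_pos phi ->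
  (forall x, csupp phi x -> u x <= v x) -> phi u <= phi v.
Proof.
move=> [p0 pc] uv; rewrite (_ : phi u = phi (vl_meet u v)).
  by apply: odual_mono => //; exact: vl_meetr.
by apply: eq_on_csupp => // x Kx; apply/esym/min_l; exact: uv.
Qed.

(* For h >= 0 glueable, the truncations of h to the supports are directed and *)
(* bounded at each functional f(.)(e), since the truncation to the support of *)
(* that functional already bounds it; their supremum extends h.               *)
Lemma extension_property_of_dual : extension_property (R := R) (X := X).
Proof.
have oc_posE (e : E) (e0 : 0 <= e) u : f u e = OrderDual (dual_eval_obl e0) u by [].
split=> [u u0|].
  apply: (order_embedding_inj f_le); rewrite f0; apply: odual_eqP => e e0.
  have [p0 pc] := dual_eval_oc_pos e0.
  rewrite (oc_posE e e0) (eq_on_csupp X_ed (v := 0) p0 pc) ?odual0//.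
  by move=> x Kx; rewrite u0//; exists (OrderDual (dual_eval_obl e0)).
suff ext_pos h : (forall x, 0 <= h x) -> glueable h ->
    exists g : Cfun R X, forall x, oc_csupp (R := R) x -> g x = h x.
  move=> h gh.
  have [||g1 g1h] := ext_pos (fun x => Num.max (h x) 0).
  - by move=> x; rewrite le_max lexx orbT.
  - move=> phi /gh[v hv]; exists (vl_pos v) => x /hv ->.
    by [].
  have [||g2 g2h] := ext_pos (fun x => Num.max (h x) 0 - h x).
  - by move=> x; rewrite subr_ge0 le_max lexx.
  - move=> phi /gh[v hv]; exists (vl_neg v) => x /hv ->.
    by [].
  exists (g1 - g2) => x Sx.
  by rewrite [LHS](_ : _ = g1 x - g2 x)// g1h// g2h// opprB addrC subrK.
move=> h0 gh.
pose D : set (Cfun R X) := [set w : Cfun R X |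
  exists phi : order_dual (Cfun R X), [/\ oc_pos phi,
  (forall x, csupp phi x -> w x = h x) & (forall x, ~ csupp phi x -> w x = 0)]].
have D_ex (phi : order_dual (Cfun R X)) : oc_pos phi -> exists w, [/\ D w,
  (forall x, csupp phi x -> w x = h x) & (forall x, ~ csupp phi x -> w x = 0)].
  move=> op; have [v hv] := gh phi op; have [p0 pc] := op.
  have cK := clopen_csupp X_ed p0 pc.
  have H1 x : csupp phi x -> cfunM (cind (csupp phi)) v x = h x.
    move=> Kx; rewrite [LHS](_ : _ = cind (csupp phi) x * v x)// cind_in//.
    by rewrite mul1r hv.
  have H2 x : ~ csupp phi x -> cfunM (cind (csupp phi)) v x = 0.
    move=> Kx; rewrite [LHS](_ : _ = cind (csupp phi) x * v x)// cind_out//.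
    by rewrite mul0r.
  by exists (cfunM (cind (csupp phi)) v); split=> //; exists phi.
have D_le w x : D w -> w x <= h x.
  move=> [phi [_ w1 w2]]; have [Kx|NKx] := pselect (csupp phi x).
    by rewrite w1.
  by rewrite w2.
have D_ge0 w : D w -> 0 <= w.
  move=> [phi [_ w1 w2]]; apply/cfun_leP => x.
  have [Kx|NKx] := pselect (csupp phi x); first by rewrite w1//; exact: h0.
  by rewrite w2.
have [||||g gP] := @dual_directed_sup D.
- by have [w [Dw _ _]] := D_ex 0 oc_pos0; exists w.
- move=> w1 w2 Dw1 Dw2; have [phi1 [op1 w11 w12]] := Dw1.
  have [phi2 [op2 w21 w22]] := Dw2.
  have [w [Dw w1' w2']] := D_ex _ (oc_posD op1 op2); exists w.
  have le1 : phi1 <= phi1 + phi2.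
    by rewrite -[leLHS]addr0 ![phi1 + _]addrC vl_leD2rE; case: op2.
  have le2 : phi2 <= phi1 + phi2 by rewrite -[leLHS]add0r vl_leD2rE; case: op1.
  split=> //; apply/cfun_leP => x.
    have [Kx|NKx] := pselect (csupp phi1 x); last by rewrite w12// cfun_ge0x// D_ge0.
    by rewrite w11// w1'//; exact: (le_csupp le1).
  have [Kx|NKx] := pselect (csupp phi2 x); last by rewrite w22// cfun_ge0x// D_ge0.
  by rewrite w21// w1'//; exact: (le_csupp le2).
- exact: D_ge0.
- move=> e e0; have ope := dual_eval_oc_pos e0.
  have [w [Dw w1 _]] := D_ex _ ope; exists (f w e) => u Du.
  rewrite !(oc_posE e e0); apply: pos_le_on_csupp => // x Kx.
  by rewrite w1//; exact: D_le.
exists g => x [psi opsi Kx].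
have [w [Dw w1 w2]] := D_ex _ opsi.
have gw v : D v -> v <= g.
  by move=> Dv; rewrite -f_le; apply: (pointwise_sup_ub gP); exists v.
(* [g'] is [g] with its values on the support of [psi] replaced by those of [h]. It still dominates
   [D], so leastness of [g] gives [g <= h] there. *)
pose g' := g - cfunM (cind (csupp psi)) (g - w).
have cK := clopen_csupp X_ed opsi.1 opsi.2.
have g'E y : g' y = g y - cind (csupp psi) y * (g y - w y) by [].
have gg' : g <= g'.
  rewrite -f_le; apply: (pointwise_sup_lub gP) => _ [v Dv <-]; rewrite f_le.
  apply/cfun_leP => y; rewrite g'E; have [Ky|NKy] := pselect (csupp psi y).
    by rewrite cind_in// mul1r opprB addrC subrK w1// D_le.
  by rewrite cind_out// mul0r subr0; have /cfun_leP := gw v Dv; exact.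
apply/le_anti; have /cfun_leP/(_ x) := gw w Dw; rewrite w1// => ->.
have /cfun_leP/(_ x) := gg'; rewrite g'E cind_in// mul1r opprB addrC subrK w1//.
by move=> ->.
Qed.

End ExtensionFromDual.

(** * The dual of the order continuous dual *)

Section EvaluationMap.
Context {R : realType} {X : topologicalType}.
Hypothesis X_ed : extremally_disconnected X.
Hypothesis X_reg : regular_space X.
Local Notation G := (oc_dual (Cfun R X)).
Implicit Types (u v w : Cfun R X) (phi psi chi : G) (L : order_dual G).

(** Unlike [canonical_map], the target is the whole order dual; surjectivity onto it gives
    perfectness and also exhibits C(X) as an order dual. *)
Definition eval_map u : order_dual G := OrderDual (evaluation_obl u).

Lemma eval_mapE u phi : eval_map u phi = phi u.
Proof. by []. Qed.

Lemma eval_map_linear : linear eval_map.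
Proof.
move=> a u v; apply/val_inj/funext => phi.
by rewrite /= /evaluation odualD odualZ.
Qed.

Lemma oc_pos_oc_dual phi : 0 <= phi -> oc_pos (oc_dual_val phi).
Proof. by move=> p0; split=> //; exact: oc_dualP. Qed.

Definition oc_mul phi w : G :=
  OcDual (asboolT (odual_mul_oc w (oc_dualP phi))).

Lemma oc_mulE phi w : oc_dual_val (oc_mul phi w) = odual_mul phi w.
Proof. by []. Qed.

Lemma oc_mul_ge0 phi w : 0 <= phi -> 0 <= w -> 0 <= oc_mul phi w.
Proof. exact: odual_mul_ge0. Qed.

Lemma oc_mul_linear phi : linear (oc_mul phi).
Proof.
by move=> a u v; apply/val_inj; rewrite /= odual_mulDr odual_mulZr.
Qed.

Lemma oc_mul_le phi v w : 0 <= phi -> v <= w -> oc_mul phi v <= oc_mul phi w.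
Proof.
move=> p0 vw; apply/odual_leP => z z0; rewrite !oc_mulE !odual_mulE.
apply: odual_mono => //; apply/cfun_leP => x; rewrite /=.
by apply: ler_wpM2r; [exact: cfun_ge0x|move/cfun_leP: vw; exact].
Qed.

(* If no c works, there are w n >= 0 with phi (w n) <= 2^-n and               *)
(* L (phi . w n) > n; the functionals phi . (w 0 + ... + w n) then have a     *)
(* supremum, at which L exceeds every n.                                      *)
Lemma odual_oc_bounded L phi : 0 <= L -> 0 <= phi -> exists2 c : R, 0 <= c &
  forall w, 0 <= w -> L (oc_mul phi w) <= c * phi w.
Proof.
move=> L0 p0; have [op oc] := oc_pos_oc_dual p0; apply: contrapT => nc.
have ex_w n : exists w, [/\ 0 <= w, phi w <= 2^-1 ^+ n & n%:R < L (oc_mul phi w)].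
  (* A [w] violating the bound with constant n 2^n, rescaled to [phi w = 2^-n], satisfies all three
     requirements. *)
  apply: contrapT => nw; apply: nc; exists (n%:R * 2 ^+ n).
    by rewrite mulr_ge0 ?exprn_ge0.
  move=> w w0; rewrite leNgt; apply/negP => Lw.
  have pw0 : 0 <= phi w := odual_ge0 op w0.
  (* Rescaling is impossible if [phi w = 0], but then [w] vanishes on the support and [oc_mul phi w]
     is zero. *)
  have [pw|pw] := eqVneq (phi w) 0.
    suff e0 : oc_mul phi w = 0 by move: Lw; rewrite e0 odual0 pw mulr0 ltxx.
    apply/val_inj/val_inj/funext => v; rewrite /= -[RHS](odual0 phi).
    apply: eq_on_csupp => // x Kx.
    rewrite [LHS](_ : _ = w x * v x)// (pos_eq0_csupp X_ed X_reg op w0 pw Kx).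
    by rewrite mul0r.
  have pw1 : 0 < phi w by rewrite lt_neqAle eq_sym pw.
  pose a : R := 2^-1 ^+ n / phi w.
  have a0 : 0 < a by rewrite divr_gt0 ?exprn_gt0.
  apply: nw; exists (a *: w); split; first exact: vl_scale_ge0 (ltW a0) w0.
    by rewrite odualZ divfK.
  have -> : oc_mul phi (a *: w) = a *: oc_mul phi w.
    by apply/val_inj; rewrite /= odual_mulZr.
  rewrite odualZ -ltr_pdivrMl//; apply: le_lt_trans Lw.
  rewrite /a invfM invrK exprVn invrK mulrC mulrA; lra.
have [w wP] := choice ex_w.
pose W N : Cfun R X := \sum_(n < N) w n.
have W0 N : 0 <= W N.
  elim: N => [|N IH]; first by rewrite /W big_ord0.
  by rewrite /W big_ord_recr/=; apply: vl_addr_ge0 => //; have [] := wP N.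
have W_S N : W N <= W N.+1.
  rewrite -vl_subr_ge0 /W big_ord_recr/= addrAC subrr add0r.
  by have [] := wP N.
have W_mono m n : (m <= n)%N -> W m <= W n.
  move=> /subnK <-; elim: (n - m)%N => [|k IH]; first by rewrite add0n.
  by rewrite addSn; exact: le_trans IH (W_S _).
have W_w N : w N <= W N.+1.
  by rewrite /W big_ord_recr/= -[leLHS]add0r vl_leD2rE; exact: W0.
have phiW N : phi (W N) <= 2 - 2 * 2^-1 ^+ N.
  elim: N => [|N IH]; first by rewrite /W big_ord0 odual0 expr0 mulr1 subrr.
  rewrite /W big_ord_recr/= odualD -/(W N).
  by have [_ + _] := wP N; rewrite exprS; move: IH; move: (2^-1 ^+ N) => q; lra.
have phiW2 N : phi (W N) <= 2.
  by apply: (le_trans (phiW N)); rewrite gerBl mulr_ge0 ?exprn_ge0.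
pose D : set (order_dual (Cfun R X)) := [set odual_mul phi (W N) | N in setT].
have [||||l lP] := @order_dual_directed_sup R _ D.
- by exists (odual_mul phi (W 0%N)), 0%N.
- move=> _ _ [m _ <-] [n _ <-]; exists (odual_mul phi (W (maxn m n))); split.
  + by exists (maxn m n).
  + by apply: (oc_mul_le p0); apply: W_mono; exact: leq_maxl.
  + by apply: (oc_mul_le p0); apply: W_mono; exact: leq_maxr.
- by move=> _ [n _ <-]; exact: odual_mul_ge0.
- move=> v v0; have [n nv] := csupp_bounded X_ed X_reg v op.
  exists (n%:R * 2) => _ [_ [N _ <-] <-].
  rewrite odual_mulE; apply: (@le_trans _ _ (n%:R * phi (W N))); last first.
    by rewrite ler_wpM2l.
  rewrite -odualZ; apply: pos_le_on_csupp => // x /nv vn.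
  rewrite [leLHS](_ : _ = W N x * v x)// [leRHS](_ : _ = n%:R * W N x)// mulrC.
  by rewrite ler_wpM2r ?cfun_ge0x// (le_trans (ler_norm _)).
have l0 : 0 <= l.
  apply: (le_trans _ (pointwise_sup_ub lP _)); last by exists 0%N.
  exact: odual_mul_ge0.
have lc : order_continuous l.
  apply: pointwise_sup_oc lP l0 _ => _ [N _ <-]; exact: odual_mul_oc.
pose th : G := OcDual (asboolT lc).
have [_ _ nL] := wP (Num.truncn (L th)).+1; move: nL; apply/negP; rewrite -leNgt.
apply: (@le_trans _ _ (L th)); last by rewrite ltW// truncnS_gt.
apply: odual_mono => //; apply: (@le_trans _ _ (oc_mul phi (W (Num.truncn (L th)).+2))).
  exact: oc_mul_le.
by apply: (pointwise_sup_ub lP); exists (Num.truncn (L th)).+2.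
Qed.

Lemma oc_dual_density L phi : 0 <= L -> 0 <= phi ->
  exists u, forall w, L (oc_mul phi w) = phi (cfunM u w).
Proof.
move=> L0 p0; have [op oc] := oc_pos_oc_dual p0.
have [c c0 Lc] := odual_oc_bounded L0 p0.
have tau_obl : obl_functional (fun w : Cfun R X => L (oc_mul phi w) : R^o).
  apply: positive_obl => [a u v|w w0]; first by rewrite oc_mul_linear linearP.
  by apply: odual_ge0 => //; exact: oc_mul_ge0.
pose tau := OrderDual tau_obl.
have tau0 : 0 <= tau.
  by apply/odual_leP => w w0; apply: (odual_ge0 L0); exact: oc_mul_ge0.
have tauc : tau <= c *: oc_dual_val phi by apply/odual_leP => w w0; exact: Lc.
have [u _ tauE] := oc_radon_nikodym X_ed X_reg op oc tau0 tauc c0.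
exists u => w; rewrite [LHS](_ : _ = tau w)// tauE; exact: odual_mulE.
Qed.

(** Testing with w = u - v shows that [phi] kills the nonnegative function (u - v)^2, which
    therefore vanishes on the support. *)
Lemma eq_on_csupp_mul (phi : order_dual (Cfun R X)) u v : oc_pos phi ->
  (forall w, phi (cfunM u w) = phi (cfunM v w)) ->
  forall x, csupp phi x -> u x = v x.
Proof.
move=> [p0 pc] uv x Kx; apply/eqP; rewrite -subr_eq0 -(sqrf_eq0 (u x - v x)); apply/eqP.
have -> : (u x - v x) ^+ 2 = cfunM (u - v) (u - v) x by rewrite expr2.
apply: (pos_eq0_csupp X_ed X_reg p0 _ _ Kx).
  apply/cfun_leP => y; rewrite [leRHS](_ : _ = (u y - v y) * (u y - v y))//.
  by rewrite -expr2 sqr_ge0.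
have -> : cfunM (u - v) (u - v) = cfunM u (u - v) - cfunM v (u - v).
  by apply: cfunP => y; exact: mulrBl.
by rewrite odualB uv subrr.
Qed.

Hypothesis ext : extension_property (R := R) (X := X).

(** Testing on [phi] multiplied by the indicator of the closure of {u > v} shows that (u - v)^+
    vanishes on every support; uniqueness of extensions makes it zero on X. *)
Lemma eval_map_embedding : order_embedding eval_map.
Proof.
move=> u v; apply/idP/idP => [/odual_leP uv|uv]; last first.
  apply/odual_leP => phi p0; rewrite !eval_mapE.
  exact: (odual_mono (phi := oc_dual_val phi)).
apply/cfun_leP => x; rewrite leNgt; apply/negP => vux.
pose U := closure [set x | 0 < (u - v) x].
have cU : clopen U by apply: ed_closure_clopen => //; exact: open_cfun_gt.
pose z := cfunM (cind U) (u - v).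
have zE y : z y = cind U y * (u y - v y) by [].
have z0 : 0 <= z.
  apply/cfun_leP => y; rewrite zE [leLHS](_ : _ = 0)//.
  have [Uy|NUy] := pselect (U y); last by rewrite cind_out// mul0r.
  by rewrite cind_in// mul1r; exact: closure_cfun_ge Uy.
have : z x = 0.
  rewrite [z](ext.1 z)// => y [phi [p0 pc] Ky].
  apply: (pos_eq0_csupp X_ed X_reg p0 z0 _ Ky).
  apply/le_anti; rewrite (odual_ge0 p0 z0) andbT.
  have mc := odual_mul_oc (cind U) pc.
  have := uv (OcDual (asboolT mc)) (odual_mul_ge0 p0 (cind_ge0 U)).
  by rewrite !eval_mapE -subr_le0 -odualB.
rewrite zE cind_in//; last first.
  apply: subset_closure => /=.
  by rewrite [ltRHS](_ : _ = u x - v x)// subr_gt0.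
by move/eqP; rewrite mul1r subr_eq0 gt_eqF.
Qed.

Lemma eval_map_surj L : exists u, eval_map u = L.
Proof.
suff pos L' : 0 <= L' -> exists u, eval_map u = L'.
  have [u uL] := pos _ (odual_pos_ge0 L); have [v vL] := pos _ (odual_neg_ge0 L).
  exists (u - v); rewrite (odual_posBneg L) -vL -uL.
  by apply/val_inj/funext => phi; exact: odualB.
move=> L0.
have dens (phi : order_dual (Cfun R X)) : exists u, forall (h : oc_pos phi) w,
    L' (oc_mul (OcDual (asboolT h.2)) w) = phi (cfunM u w).
  have [h|nh] := pselect (oc_pos phi); last by exists 0.
  have [u uP] := @oc_dual_density L' (OcDual (asboolT h.2)) L0 h.1.
  by exists u => h'; rewrite (Prop_irrelevance h' h).
have [u uP] := choice dens.
(* Writing phi = v chi, both phi(u_phi w) and phi(u_chi w) equal L(chi v w), so the densities agree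
   on the support of [phi]. *)
have cons (phi chi : order_dual (Cfun R X)) : oc_pos phi -> oc_pos chi -> phi <= chi ->
    forall x, csupp phi x -> u phi x = u chi x.
  move=> hp hc pc; apply: eq_on_csupp_mul => // w.
  have pc1 : phi <= 1 *: chi by rewrite scale1r.
  have [v _ vE] := oc_radon_nikodym X_ed X_reg hc.1 hc.2 hp.1 pc1 ler01.
  rewrite -(uP phi hp).
  have -> : oc_mul (OcDual (asboolT hp.2)) w =
      oc_mul (OcDual (asboolT hc.2)) (cfunM v w).
    apply/val_inj/val_inj/funext => z /=; rewrite vE odual_mulE.
    by congr (odual_fun chi _); apply: cfunP => y; exact: mulrA.
  rewrite (uP chi hc) vE odual_mulE; congr (odual_fun chi _).
  by apply: cfunP => y; exact: mulrCA.
have cons2 (phi psi : order_dual (Cfun R X)) x : oc_pos phi -> oc_pos psi ->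
    csupp phi x -> csupp psi x -> u phi x = u psi x.
  move=> hp hq Kp Kq; have hpq := oc_posD hp hq.
  rewrite (cons phi (phi + psi))//; last first.
    by rewrite -[leLHS]addr0 ![phi + _]addrC vl_leD2rE; exact: hq.1.
  by rewrite (cons psi (phi + psi))// -[leLHS]add0r vl_leD2rE; exact: hp.1.
pose h x : R := xget 0 [set r | exists phi : order_dual (Cfun R X),
  [/\ oc_pos phi, csupp phi x & r = u phi x]].
have hE (phi : order_dual (Cfun R X)) x : oc_pos phi -> csupp phi x -> h x = u phi x.
  move=> hp Kx; rewrite /h; case: xgetP => [r _ [psi [hq Kq ->]]|]; first exact: cons2.
  by move=> /(_ (u phi x)); case; exists phi.
have [|g gh] := ext.2 h; first by move=> phi hp; exists (u phi) => x Kx; exact: hE.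
exists g; apply: odual_eqP => phi p0; rewrite eval_mapE.
have hp := oc_pos_oc_dual p0.
(* Writing [phi] as [phi] times 1 brings in its density: L(phi) = phi(u_phi) = phi(g). *)
have -> : phi = oc_mul (OcDual (asboolT hp.2)) (cfun_cst 1).
  apply/val_inj/val_inj/funext => z /=; congr (odual_fun phi _).
  by apply: cfunP => y; apply/esym; exact: mul1r.
rewrite (uP _ hp) oc_mulE odual_mulE.
apply: (eq_on_csupp X_ed hp.1 hp.2) => x Kx.
rewrite [RHS](_ : _ = u phi x * 1)// [LHS](_ : _ = 1 * g x)//.
by rewrite mulrC gh ?(hE phi)//; exists (oc_dual_val phi).
Qed.

Lemma extension_dual : lattice_isomorphism eval_map.
Proof.
by apply: order_isomorphism; [exact: eval_map_linear|exact: eval_map_embedding|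
  exact: eval_map_surj].
Qed.

Lemma extension_perfect : perfect (Cfun R X).
Proof.
apply: order_isomorphism.
- by move=> a u v; apply/val_inj; exact: eval_map_linear.
- exact: eval_map_embedding.
- by move=> y; have [u uy] := eval_map_surj y; exists u; apply/val_inj.
Qed.

End EvaluationMap.

Section DualExtension.
Context {R : realType} {X : topologicalType}.
Hypothesis X_ed : extremally_disconnected X.

(** The range of the evaluation map is the order continuous part of the dual, which contains the
    required suprema by [pointwise_sup_oc]. *)
Lemma perfect_extension : perfect (Cfun R X) -> extension_property (R := R) (X := X).
Proof.
move=> [hom bij].
have emb := lattice_hom_embedding hom (bij_inj bij).
apply: (extension_property_of_dual X_ed (f := @eval_map R X)).
- exact: eval_map_linear.
- exact: emb.
move=> D l [u0 Du0] Dpos lP.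
have l0 : 0 <= l.
  apply: (le_trans _ (pointwise_sup_ub lP (ex_intro2 _ _ u0 Du0 erefl))).
  apply/odual_leP => phi p0.
  exact: (odual_ge0 (phi := oc_dual_val phi) p0 (Dpos _ Du0)).
have lc : order_continuous l.
  apply: pointwise_sup_oc lP l0 _ => _ [u _ <-].
  by have /asboolP := evaluation_oc u.
have [g _ gK] := bij; pose l' : oc_dual (oc_dual (Cfun R X)) := OcDual (asboolT lc).
by exists (g l'); have /(congr1 (@oc_dual_val _ _)) := gK l'.
Qed.

Lemma order_dual_extension (E : vectorLatticeType R) :
  lattice_isomorphic (Cfun R X) (order_dual E) ->
  extension_property (R := R) (X := X).
Proof.
move=> [f [hom bij]]; apply: (extension_property_of_dual X_ed (f := f)).
- by case: hom.
- exact: lattice_hom_embedding (bij_inj bij).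
by move=> D l _ _ _; have [g _ gK] := bij; exists (g l).
Qed.

End DualExtension.

(** * Bands and restriction *)

Section Carriers.
Context {R : realType} {X : topologicalType}.
Hypothesis X_ed : extremally_disconnected X.
Hypothesis X_reg : regular_space X.
Implicit Types (u v w : Cfun R X) (phi psi : order_dual (Cfun R X)).

Lemma disjoint_complement_vanish (K : set X) : clopen K ->
  disjoint_complement [set u : Cfun R X | forall x, K x -> u x = 0] =
  [set u : Cfun R X | forall x, ~ K x -> u x = 0].
Proof.
move=> cK; have cN := clopen_setC cK.
apply/seteqP; split=> u /= uK; last first.
  move=> v /= vK; apply: cfunP => x.
  rewrite [LHS](_ : _ = Num.min (vl_abs u x) (vl_abs v x))// !vl_absE.
  rewrite [RHS](_ : _ = 0)//.
  have [Kx|NKx] := pselect (K x); first by rewrite vK// normr0 min_r.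
  by rewrite uK// normr0 min_l.
move=> x NKx; have := uK (cind (~` K)).
have vanish y : K y -> (cind (~` K) : Cfun R X) y = 0.
  by move=> Ky; rewrite cind_out//; exact.
move=> /(_ vanish) h; have : Num.min (vl_abs u x) (vl_abs (cind (~` K)) x) = 0.
  by rewrite [LHS](_ : _ = vl_meet (vl_abs u) (vl_abs (cind (~` K))) x)// h.
rewrite !vl_absE (cind_in cN NKx) normr1 => /eqP.
rewrite minEle; case: ifPn => _; first by rewrite normr_eq0 => /eqP.
by rewrite oner_eq0.
Qed.

Lemma vl_abs_ge0 (V : vectorLatticeType R) (x : V) : 0 <= x -> vl_abs x = x.
Proof.
move=> x0; apply/le_anti; rewrite vl_joinl vl_joinP lexx/= andbT.
by apply: (le_trans _ x0); rewrite -vl_leN2 opprK oppr0.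
Qed.

Lemma null_idealE phi : oc_pos phi ->
  null_ideal phi = [set u : Cfun R X | forall x, csupp phi x -> u x = 0].
Proof.
move=> [p0 pc].
have nE u : null_ideal phi u = (phi (vl_abs u) = 0).
  by rewrite /null_ideal /mkset (vl_abs_ge0 p0).
apply/seteqP; split=> u; rewrite nE.
  move=> pu x Kx; apply/eqP; rewrite -normr_eq0 -vl_absE; apply/eqP.
  apply: (pos_eq0_csupp X_ed X_reg p0 _ pu Kx).
  by apply/cfun_leP => y; rewrite vl_absE; exact: normr_ge0.
move=> u0; rewrite (eq_on_csupp X_ed (v := 0) p0 pc) ?odual0// => x Kx.
by rewrite vl_absE u0// normr0.
Qed.

Lemma carrierE phi : oc_pos phi ->
  carrier phi = [set u : Cfun R X | forall x, ~ csupp phi x -> u x = 0].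
Proof.
move=> op; rewrite /carrier null_idealE// disjoint_complement_vanish//.
exact: clopen_csupp op.1 op.2.
Qed.

(** For clopen K, the splitting of u into its parts on K and off K is the only admissible one, so
    [xget] has no choice. *)
Lemma band_projection_carrier phi u : oc_pos phi ->
  band_projection (carrier phi) u = cfunM (cind (csupp phi)) u.
Proof.
move=> op; rewrite carrierE//; set K := csupp phi.
have cK : clopen K := clopen_csupp X_ed op.1 op.2.
have cN := clopen_setC cK.
have dE : disjoint_complement [set u : Cfun R X | forall x, ~ K x -> u x = 0] =
    [set u | forall x, K x -> u x = 0].
  rewrite [LHS](disjoint_complement_vanish cN); apply/seteqP.
  split=> v /= vK x Kx; apply: vK; last exact: contrapT.
  by move=> /(_ Kx).
rewrite /band_projection dE; case: xgetP => [b _ [/= b1 b2]|].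
  apply: cfunP => x; rewrite [RHS](_ : _ = cind K x * u x)//.
  have [Kx|NKx] := pselect (K x); last by rewrite b1// cind_out// mul0r.
  by rewrite cind_in// mul1r; apply/esym/eqP; rewrite -subr_eq0; apply/eqP/b2.
move=> /(_ (cfunM (cind K) u)); case; split=> x /= Kx.
  by rewrite [LHS](_ : _ = cind K x * u x)// cind_out// mul0r.
by rewrite [LHS](_ : _ = u x - cind K x * u x)// cind_in// mul1r subrr.
Qed.

Local Notation M := (oc_carriers (Cfun R X)).

Lemma oc_carriersP (B : M) : exists2 phi, oc_pos phi & set_val B = carrier phi.
Proof.
have [phi p0 phiB] := set_valP B; exists (oc_dual_val phi).
  exact: oc_pos_oc_dual.
by rewrite phiB.
Qed.

Lemma oc_carrier_ex phi : oc_pos phi -> exists B : M, set_val B = carrier phi.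
Proof.
move=> [p0 pc]; have MB : M (carrier phi).
  by exists (OcDual (asboolT pc)).
by exists (SigSub (mem_set MB)).
Qed.

(** Tested on the indicator of [csupp phi]. Carriers thus determine supports, although different
    functionals may share a carrier. *)
Lemma carrier_subset phi psi : oc_pos phi -> oc_pos psi ->
  carrier phi `<=` carrier psi -> csupp phi `<=` csupp psi.
Proof.
move=> op oq; rewrite !carrierE// => sub x Kx; apply: contrapT => NKx.
have cK := clopen_csupp X_ed op.1 op.2.
have := sub (cind (csupp phi)); move=> /(_ _ x NKx); rewrite cind_in// => /(_ _)/eqP.
by rewrite oner_eq0 => h; apply: notF; apply: h => y NKy; rewrite cind_out.
Qed.

Lemma subset_carrier phi psi : oc_pos phi -> oc_pos psi ->
  csupp phi `<=` csupp psi -> carrier phi `<=` carrier psi.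
Proof.
move=> op oq sub; rewrite !carrierE// => u /= uK x NKx; apply: uK.
by move=> /sub.
Qed.

Lemma limit_projection_hom : lattice_hom (limit_projection M).
Proof.
have E (B : M) : exists K, forall u, limit_projection M u B = cfunM (cind K) u.
  by have [phi op Bp] := oc_carriersP B; exists (csupp phi) => u;
    rewrite /limit_projection Bp band_projection_carrier.
split=> [a u v|u v|u v]; apply/funext => B; have [K KE] := E B.
- rewrite KE [RHS](_ : _ = a *: limit_projection M u B + limit_projection M v B)//.
  rewrite !KE; apply: cfunP => x.
  rewrite [LHS](_ : _ = cind K x * (a * u x + v x))//.
  rewrite [RHS](_ : _ = a * (cind K x * u x) + cind K x * v x)//.
  by rewrite mulrDr mulrCA.
- rewrite KE [RHS](_ : _ = vl_join (limit_projection M u B) (limit_projection M v B))//.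
  rewrite !KE; apply: cfunP => x.
  rewrite [LHS](_ : _ = cind K x * Num.max (u x) (v x))//.
  rewrite [RHS](_ : _ = Num.max (cind K x * u x) (cind K x * v x))//.
  by rewrite maxr_pMr// cind_ge0x.
- rewrite KE [RHS](_ : _ = vl_meet (limit_projection M u B) (limit_projection M v B))//.
  rewrite !KE; apply: cfunP => x.
  rewrite [LHS](_ : _ = cind K x * Num.min (u x) (v x))//.
  rewrite [RHS](_ : _ = Num.min (cind K x * u x) (cind K x * v x))//.
  by rewrite minr_pMr// cind_ge0x.
Qed.

Lemma limit_projection_inverse_limit u : inverse_limit M (limit_projection M u).
Proof.
split=> [B|A B AB].
  have [phi op Bp] := oc_carriersP B; rewrite Bp /limit_projection Bp.
  rewrite band_projection_carrier// carrierE// => x NKx.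
  rewrite [LHS](_ : _ = cind (csupp phi) x * u x)// cind_out ?mul0r//.
  exact: clopen_csupp op.1 op.2.
have [phi op Ap] := oc_carriersP A; have [psi oq Bp] := oc_carriersP B.
rewrite /limit_projection Ap Bp !band_projection_carrier//.
apply: cfunP => x; set K := csupp phi; set L := csupp psi.
rewrite [LHS](_ : _ = cind K x * (cind L x * u x))//.
rewrite [RHS](_ : _ = cind K x * u x)//.
have cK : clopen K := clopen_csupp X_ed op.1 op.2.
have cL : clopen L := clopen_csupp X_ed oq.1 oq.2.
have [Kx|NKx] := pselect (K x); last by rewrite cind_out// !mul0r.
rewrite [cind L x]cind_in ?mul1r//.
by rewrite Ap Bp in AB; exact: carrier_subset AB x Kx.
Qed.

(** A compatible family has values at a point independent of the support used, since [phi + psi]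
    dominates both functionals; so it is the same thing as a glueable function. *)
Lemma limit_projection_ext : extension_property (R := R) (X := X) <->
  lattice_isomorphism_onto (limit_projection M) (inverse_limit M).
Proof.
have onK u phi x (B : M) : oc_pos phi -> set_val B = carrier phi ->
    csupp phi x -> limit_projection M u B x = u x.
  move=> op Bp Kx; rewrite /limit_projection Bp band_projection_carrier//.
  rewrite [LHS](_ : _ = cind (csupp phi) x * u x)// cind_in ?mul1r//.
  exact: clopen_csupp op.1 op.2.
split=> [[ext1 ext2]|[_ inj ran]].
  split; first exact: limit_projection_hom.
    move=> u v uv; apply/eqP; rewrite -subr_eq0; apply/eqP; apply: ext1.
    move=> x [phi op Kx]; have [B Bp] := oc_carrier_ex op.
    rewrite [LHS](_ : _ = u x - v x)// -(onK u _ _ _ op Bp Kx).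
    by rewrite -(onK v _ _ _ op Bp Kx) uv subrr.
  apply/seteqP; split=> [_ [u _ <-]|U [UB UAB]].
    exact: limit_projection_inverse_limit.
  have compat (A B : M) phi psi x : oc_pos phi -> oc_pos psi ->
      set_val A = carrier phi -> set_val B = carrier psi ->
      csupp phi `<=` csupp psi -> csupp phi x -> U A x = U B x.
    move=> op oq Ap Bq sub Kx; rewrite -(UAB A B); last first.
      by rewrite Ap Bq; exact: subset_carrier.
    rewrite Ap band_projection_carrier//.
    rewrite [LHS](_ : _ = cind (csupp phi) x * U B x)// cind_in ?mul1r//.
    exact: clopen_csupp op.1 op.2.
  have compat2 (A B : M) phi psi x : oc_pos phi -> oc_pos psi ->
      set_val A = carrier phi -> set_val B = carrier psi ->
      csupp phi x -> csupp psi x -> U A x = U B x.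
    move=> op oq Ap Bq Kx Lx; have opq := oc_posD op oq.
    have [C Cpq] := oc_carrier_ex opq.
    rewrite (compat A C phi (phi + psi))//; last first.
      by apply: le_csupp; rewrite -[leLHS]addr0 ![phi + _]addrC vl_leD2rE; exact: oq.1.
    rewrite (compat B C psi (phi + psi))//.
    by apply: le_csupp; rewrite -[leLHS]add0r vl_leD2rE; exact: op.1.
  pose h x : R := xget 0 [set r | exists phi (B : M),
    [/\ oc_pos phi, set_val B = carrier phi, csupp phi x & r = U B x]].
  have hE phi (B : M) x : oc_pos phi -> set_val B = carrier phi ->
      csupp phi x -> h x = U B x.
    move=> op Bp Kx; rewrite /h; case: xgetP => [r _ [psi [A [oq Aq Lx ->]]]|].
      exact: (compat2 A B psi phi).
    by move=> /(_ (U B x)); case; exists phi, B.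
  have [|g gh] := ext2 h.
    move=> phi op; have [B Bp] := oc_carrier_ex op.
    by exists (U B) => x Kx; exact: (hE phi).
  exists g => //; apply/funext => B; have [phi op Bp] := oc_carriersP B.
  apply: cfunP => x; have [Kx|NKx] := pselect (csupp phi x).
    rewrite (onK _ phi)// gh; first exact: (hE phi).
    by exists phi.
  have := UB B; rewrite Bp carrierE// => /(_ x NKx) ->.
  rewrite /limit_projection Bp band_projection_carrier//.
  rewrite [LHS](_ : _ = cind (csupp phi) x * g x)// cind_out ?mul0r//.
  exact: clopen_csupp op.1 op.2.
split=> [u u0|h gh].
  apply: inj; apply/funext => B; have [phi op Bp] := oc_carriersP B.
  rewrite /limit_projection Bp !band_projection_carrier//.
  apply: cfunP => x; rewrite [LHS](_ : _ = cind (csupp phi) x * u x)//.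
  rewrite [RHS](_ : _ = cind (csupp phi) x * 0)//.
  have [Kx|NKx] := pselect (csupp phi x); first by rewrite u0//; exists phi.
  by rewrite cind_out ?mul0r//; exact: clopen_csupp op.1 op.2.
(* Quantifying over all functionals with carrier [B] makes the chosen function independent of a
   representative. *)
have ex_U (B : M) : exists w : Cfun R X, forall phi, oc_pos phi ->
    set_val B = carrier phi -> (forall x, csupp phi x -> w x = h x) /\
      (forall x, ~ csupp phi x -> w x = 0).
  have [phi op Bp] := oc_carriersP B; have [v hv] := gh phi op.
  have cK := clopen_csupp X_ed op.1 op.2.
  exists (cfunM (cind (csupp phi)) v) => psi oq Bq.
  have -> : csupp psi = csupp phi.
    by apply/seteqP; split; apply: carrier_subset => //; rewrite -Bp -Bq.
  split=> x Kx; rewrite [LHS](_ : _ = cind (csupp phi) x * v x)//.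
    by rewrite cind_in// mul1r hv.
  by rewrite cind_out// mul0r.
have [U UP] := choice ex_U.
have [g _ gU] : range (limit_projection M) U.
  rewrite ran; split=> [B|A B AB].
    have [phi op Bp] := oc_carriersP B; rewrite Bp carrierE// => x.
    by have [_] := UP B phi op Bp; exact.
  have [phi op Ap] := oc_carriersP A; have [psi oq Bq] := oc_carriersP B.
  rewrite Ap band_projection_carrier//; apply: cfunP => x.
  have cK := clopen_csupp X_ed op.1 op.2.
  rewrite [LHS](_ : _ = cind (csupp phi) x * U B x)//.
  have [A1 A2] := UP A phi op Ap; have [B1 B2] := UP B psi oq Bq.
  have [Kx|NKx] := pselect (csupp phi x); last by rewrite cind_out// mul0r A2.
  rewrite cind_in// mul1r A1// B1//; apply: carrier_subset op oq _ x Kx.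
  by rewrite -Ap -Bq.
exists g => x [phi op Kx]; have [B Bp] := oc_carrier_ex op.
rewrite -(onK g phi x B)// gU; exact: (UP B phi op Bp).1.
Qed.

End Carriers.

Section RestrictionMap.
Context {R : realType} {X : topologicalType}.
Hypothesis X_ed : extremally_disconnected X.

Lemma cfun_restr_hom (S : set X) : lattice_hom (@cfun_restr R X S).
Proof. by split=> [a u v|u v|u v]; apply: cfunP. Qed.

(** Since supports are clopen, a continuous function on S cut off to one support and extended by
    zero is continuous on X; conversely a glueable function is locally a restriction from X. *)
Lemma restriction_ext : extension_property (R := R) (X := X) <->
  lattice_isomorphism (@cfun_restr R X (oc_csupp (R := R))).
Proof.
set S := oc_csupp.
split=> [[ext1 ext2]|[_ [r rK Kr]]].
  split; first exact: cfun_restr_hom.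
  have inj : injective (@cfun_restr R X S).
    move=> u v uv; apply/eqP; rewrite -subr_eq0; apply/eqP; apply: ext1.
    move=> x Sx; rewrite [LHS](_ : _ = u x - v x)//.
    have := congr1 (fun w : Cfun R S => w (SigSub (mem_set Sx))) uv.
    by rewrite [X in X = _ -> _](_ : _ = u x)// [X in _ = X -> _](_ : _ = v x)// => ->;
      rewrite subrr.
  suff /choice[r rP] : forall w : Cfun R S, exists u, cfun_restr S u = w.
    by exists r => // u; apply: inj; rewrite rP.
  move=> w.
  pose h x : R :=
    if pselect (S x) is left Sx then w (SigSub (mem_set Sx)) else 0.
  have hE (s : S) : h (set_val s) = w s.
    rewrite /h; case: pselect => [Ss|]; last by case; exact: set_valP.
    by congr (w _); apply/val_inj.
  have [phi op|g gh] := ext2 h; last first.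
    by exists g; apply: cfunP => s; rewrite -hE -gh//; exact: set_valP.
  have [oK cK] := clopen_csupp X_ed op.1 op.2.
  pose f x : R := if pselect (csupp phi x) then h x else 0.
  have f_in y : csupp phi y -> f y = h y.
    by move=> Ky; rewrite /f; case: (pselect (csupp phi y)).
  have f_out y : ~ csupp phi y -> f y = 0.
    by move=> Ky; rewrite /f; case: (pselect (csupp phi y)).
  have fcts : continuous f.
    move=> x; have [Kx|NKx] := pselect (csupp phi x); last first.
      apply: (near_cst_continuous (0 : R)); near=> y.
      apply: f_out; near: y.
      by apply: open_nbhs_nbhs; split=> //; exact: closed_openC.
    have Sx : S x by exists phi.
    pose s : S := SigSub (mem_set Sx).
    have fx : f x = w s by rewrite f_in// -hE.
    move=> B; rewrite fx => nB; have := cfun_continuous (u := w) nB.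
    rewrite nbhsE => -[V [oV Vs] VB]; case: oV => Q oQ QV.
    have Qx : Q x by move: Vs; rewrite -QV.
    have : nbhs x (Q `&` csupp phi).
      by apply: open_nbhs_nbhs; split=> //; exact: openI.
    apply: filterS => y [Qy Ky]; have Sy : S y by exists phi.
    rewrite /= f_in//.
    by rewrite (hE (SigSub (mem_set Sy))); apply: VB; rewrite -QV.
  by exists (mkcts fcts) => x Kx; rewrite [RHS](_ : _ = f x)// f_in.
split=> [u u0|h gh].
  rewrite -[u]rK -[RHS]rK; congr (r _); apply: cfunP => s; apply: u0.
  exact: set_valP.
pose f (s : S) : R := h (set_val s).
have fcts : continuous f.
  move=> s; have [phi op Ks] := set_valP s; have [v hv] := gh phi op.
  have [oK cK] := clopen_csupp X_ed op.1 op.2.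
  have near_eq : \forall t \near s, f t = cfun_restr S v t.
    have : nbhs s (set_val @^-1` (csupp phi)).
      by apply: (initial_continuous (f := set_val)); apply: open_nbhs_nbhs.
    by apply: filterS => t Kt; exact: hv.
  have fs : f s = cfun_restr S v s by exact: hv.
  rewrite /continuous_at fs.
  have e : {near nbhs s, (cfun_restr S v : S -> R) =1 f}.
    by apply: filterS near_eq => t ->.
  apply: (cvg_trans (near_eq_cvg e)); exact: cfun_continuous.
exists (r (mkcts fcts)) => x Sx.
have := congr1 (fun w : Cfun R S => w (SigSub (mem_set Sx))) (Kr (mkcts fcts)).
by [].
Unshelve. all: by end_near. Qed.

End RestrictionMap.

(** * Representing measures *)

Section OuterMeasure.
Context {R : realType} {X : topologicalType}.
Hypothesis X_ed : extremally_disconnected X.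
Variable phi : order_dual (Cfun R X).
Hypothesis phi_op : oc_pos phi.
Implicit Types (A B G U V W : set X).
Local Open Scope ereal_scope.

(** The closures of open sets are clopen, so [cind] never takes its default value here. *)
Definition oc_outer A : \bar R :=
  ereal_inf [set (phi (cind (closure G)))%:E | G in [set G | open G /\ A `<=` G]].

Lemma phi_cind_ge0 U : (0 <= phi (cind U))%R.
Proof. by apply: odual_ge0; [exact: phi_op.1|exact: cind_ge0]. Qed.

Lemma phi_cind_le U V : clopen U -> clopen V -> U `<=` V ->
  (phi (cind U) <= phi (cind V))%R.
Proof. by move=> cU cV UV; apply: odual_mono; [exact: phi_op.1|exact: cind_le]. Qed.

Lemma phi_cindU U V : clopen U -> clopen V ->
  (phi (cind (U `|` V)) <= phi (cind U) + phi (cind V))%R.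
Proof.
move=> cU cV; rewrite -odualD; apply: odual_mono; first exact: phi_op.1.
exact: cind_setU.
Qed.

Lemma phi_cindC U : clopen U ->
  phi (cind (~` U)) = (phi (cind setT) - phi (cind U))%R.
Proof.
by move=> cU; rewrite -setTD cind_setD ?odualB//; exact: clopenT.
Qed.

Lemma oc_outer_le A G : open G -> A `<=` G ->
  oc_outer A <= (phi (cind (closure G)))%:E.
Proof. by move=> oG AG; apply: ereal_inf_lbound; exists G. Qed.

Lemma oc_outer_lt A (a : R) : oc_outer A < a%:E ->
  exists G, [/\ open G, A `<=` G & (phi (cind (closure G)) < a)%R].
Proof.
by move=> /ereal_inf_lt[_ [G [oG AG] <-]]; rewrite lte_fin => ?; exists G.
Qed.

Lemma oc_outer_ge A (a : R) :
  (forall G, open G -> A `<=` G -> (a <= phi (cind (closure G)))%R) ->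
  a%:E <= oc_outer A.
Proof.
by move=> h; apply: le_ereal_inf_tmp => _ [G [oG AG] <-]; rewrite lee_fin; exact: h.
Qed.

Lemma oc_outer_ge0 A : 0 <= oc_outer A.
Proof. by apply: oc_outer_ge => G _ _; exact: phi_cind_ge0. Qed.

Lemma oc_outer_open G : open G -> oc_outer G = (phi (cind (closure G)))%:E.
Proof.
move=> oG; apply/le_anti/andP; split; first exact: oc_outer_le.
apply: oc_outer_ge => H oH GH; apply: phi_cind_le; try exact: ed_closure_clopen.
exact: closure_subset.
Qed.

Lemma oc_outer_clopen U : clopen U -> oc_outer U = (phi (cind U))%:E.
Proof.
move=> [oU cU]; rewrite oc_outer_open//; congr (phi (cind _))%:E.
by apply/esym/closure_id.
Qed.

Lemma oc_outer_mono A B : A `<=` B -> oc_outer A <= oc_outer B.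
Proof.
move=> AB; apply: le_ereal_inf_tmp => _ [G [oG BG] <-].
by apply: oc_outer_le => //; exact: subset_trans BG.
Qed.

Lemma oc_outer_fin A : oc_outer A \is a fin_num.
Proof.
rewrite ge0_fin_numE ?oc_outer_ge0//.
by apply: le_lt_trans (oc_outer_le openT (@subsetT _ A)) _; rewrite ltry.
Qed.

Lemma oc_outer0 : oc_outer set0 = 0.
Proof.
rewrite oc_outer_clopen; last exact: clopen0.
by rewrite cind0 odual0.
Qed.

(** Order continuity recovers the value on the closure of the union from finite unions, where
    subadditivity is elementary. *)
Lemma phi_closure_bigcup (G : (set X)^nat) : (forall n, open (G n)) ->
  (phi (cind (closure (\bigcup_n G n))))%:E <=
  \sum_(n <oo) (phi (cind (closure (G n))))%:E.
Proof.
move=> oG; pose W N := \big[setU/set0]_(n < N) closure (G n).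
have cG n : clopen (closure (G n)) by exact: ed_closure_clopen.
have cW N : clopen (W N).
  elim: N => [|N IH]; first by rewrite /W big_ord0; exact: clopen0.
  by rewrite /W big_ord_recr/=; apply: clopenU.
have WS N : (phi (cind (W N)) <= \sum_(n < N) phi (cind (closure (G n))))%R.
  elim: N => [|N IH].
    by rewrite /W !big_ord0 cind0 odual0.
  rewrite /W !big_ord_recr/=; apply: (le_trans (phi_cindU (cW N) (cG N))).
  by rewrite lerD2r.
have W_mono m n : (m <= n)%N -> W m `<=` W n.
  exact: (@subset_bigsetU _ (fun n => closure (G n))).
pose D : set (set X) := [set W N | N in setT].
have dD : clopen_directed D.
  split; first by exists (W 0%N), 0%N.
    by move=> _ [N _ <-].
  move=> _ _ [m _ <-] [n _ <-]; exists (W (maxn m n)); split.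
  - by exists (maxn m n).
  - by apply: W_mono; exact: leq_maxl.
  - by apply: W_mono; exact: leq_maxr.
set U := closure _; have cU : clopen U.
  by apply: ed_closure_clopen => //; exact: bigcup_open.
have DU V : D V -> V `<=` U.
  move=> [N _ <-]; rewrite /W -(bigcup_mkord _ (fun n => closure (G n))) => x [n _ clx].
  by apply: closure_subset clx => y Gy; exists n.
have UD : U `<=` closure (\bigcup_(V in D) V).
  apply: closure_subset => x [n _ Gx]; exists (W n.+1); first by exists n.+1.
  rewrite /W -(bigcup_mkord _ (fun n => closure (G n))).
  by exists n => //=; exact: subset_closure.
apply/lee_addgt0Pr => e e0.
have [_ [N _ <-] /(_ (W N) (ex_intro2 _ _ N I erefl) (@subset_refl _ _))] :=
  oc_clopen_lim phi_op.2 dD cU DU UD e0.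
move=> /(le_lt_trans (ler_norm _)) small.
apply: (@le_trans _ _ (\sum_(0 <= n < N) (phi (cind (closure (G n))))%:E + e%:E)).
  rewrite big_mkord sumEFin -EFinD lee_fin; apply: ltW.
  by move: small (WS N); move: (phi (cind U)) (phi (cind (W N))) => a b; lra.
apply: leeD => //; apply: nneseries_lim_ge => n _ _.
by rewrite lee_fin phi_cind_ge0.
Qed.

Lemma oc_outer_sigma_subadditive : sigma_subadditive oc_outer.
Proof.
move=> A; apply/lee_addgt0Pr => e e0.
apply: le_trans (epsilon_trick _ _ _); last 2 first.
- by move=> n; exact: oc_outer_ge0.
- exact: ltW.
have /choice[G GP] n : exists G, [/\ open G, A n `<=` G &
    (phi (cind (closure G)))%:E <= oc_outer (A n) + (e / (2 ^ n.+1)%:R)%:E].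
  have : oc_outer (A n) < (fine (oc_outer (A n)) + e / (2 ^ n.+1)%:R)%:E.
    rewrite EFinD fineK ?oc_outer_fin// lteDl ?oc_outer_fin//.
    by rewrite lte_fin divr_gt0// ltr0n expn_gt0.
  move=> /oc_outer_lt[G [oG AG Ge]]; exists G; split=> //.
  by rewrite -[oc_outer _]fineK ?oc_outer_fin// -EFinD lee_fin ltW.
apply: (@le_trans _ _ (phi (cind (closure (\bigcup_n G n))))%:E).
  apply: oc_outer_le; first by apply: bigcup_open => n _; have [] := GP n.
  by apply: subset_bigcup => n _; have [] := GP n.
apply: (le_trans (phi_closure_bigcup _)); first by move=> n; have [] := GP n.
apply: lee_nneseries => n _; first by rewrite lee_fin phi_cind_ge0.
by have [] := GP n.
Qed.

Definition oc_outer_measure : {outer_measure set X -> \bar R} :=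
  HB.pack oc_outer (isOuterMeasure.Build R X oc_outer oc_outer0 oc_outer_ge0
    oc_outer_mono oc_outer_sigma_subadditive).

(** A clopen U cuts any open G into two open pieces whose closures are disjoint parts of the closure
    of G. *)
Lemma clopen_caratheodory U : clopen U -> caratheodory_measurable oc_outer_measure U.
Proof.
move=> cU; have cN := clopen_setC cU.
apply: le_caratheodory_measurable => A; rewrite /oc_outer_measure/=.
rewrite -[oc_outer (A `&` U)]fineK ?oc_outer_fin//.
rewrite -[oc_outer (A `&` ~` U)]fineK ?oc_outer_fin// -EFinD.
apply: oc_outer_ge => G oG AG; rewrite -lee_fin EFinD !fineK ?oc_outer_fin//.
have cl_sub V : clopen V -> closure (G `&` V) `<=` V.
  move=> [_ clV] x Vx; rewrite (closure_id V).1//.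
  by apply: closure_subset Vx => y [].
have oI V : clopen V -> clopen (closure (G `&` V)).
  by move=> [oV _]; apply: ed_closure_clopen => //; exact: openI.
apply: (@le_trans _ _ ((phi (cind (closure (G `&` U))))%:E +
    (phi (cind (closure (G `&` ~` U))))%:E)).
  apply: leeD; apply: oc_outer_le.
  - by apply: openI => //; exact: cU.1.
  - by apply: setSI.
  - by apply: openI => //; exact: cN.1.
  - by apply: setSI.
rewrite -EFinD lee_fin -odualD; apply: odual_mono; first exact: phi_op.1.
have cG := ed_closure_clopen X_ed oG.
apply/cfun_leP => x.
rewrite [leLHS](_ : _ = cind (closure (G `&` U)) x + cind (closure (G `&` ~` U)) x)%R//.
have [Ux|NUx] := pselect (U x).
  rewrite (cind_out (U := closure (G `&` ~` U))) ?addr0; last 2 first.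
  - exact: oI.
  - by move=> /(cl_sub _ cN).
  have /cfun_leP := cind_le (R := R) (oI U cU) cG (closure_subset (@subIsetl _ G U)).
  exact.
rewrite (cind_out (U := closure (G `&` U))) ?add0r; last 2 first.
- exact: oI.
- by move=> /(cl_sub _ cU).
have /cfun_leP := cind_le (R := R) (oI _ cN) cG (closure_subset (@subIsetl _ G (~` U))).
exact.
Qed.

Hypothesis X_reg : regular_space X.

(** The clopen sets missing the boundary are directed with dense union, so by order continuity their
    complements, which cover the boundary, have arbitrarily small mass. *)
Lemma oc_outer_boundary G : open G -> oc_outer (closure G `\` G) = 0.
Proof.
move=> oG; set F := closure G `\` G.
have clF : closed F.
  rewrite /F setDE; apply: closedI; first exact: closed_closure.
  exact: open_closedC.
pose D : set (set X) := [set V | clopen V /\ V `<=` ~` F].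
have dD : clopen_directed D.
  split; first by exists set0; split; [exact: clopen0|].
    by move=> V [].
  move=> U V [cU UF] [cV VF]; exists (U `|` V); split.
  - by split; [exact: clopenU|rewrite subUset].
  - exact: subsetUl.
  - exact: subsetUr.
have DF x : ~ F x -> (\bigcup_(V in D) V) x.
  move=> NFx; have [|W [cW Wx WF]] := clopen_nbhs X_ed X_reg (x := x) (U := ~` F).
    by apply: open_nbhs_nbhs; split=> //; exact: closed_openC.
  by exists W.
have UD : setT `<=` closure (\bigcup_(V in D) V).
  move=> x _; have [clx|Nclx] := pselect (closure G x).
    by apply: closure_subset clx => y Gy; apply: DF => -[].
  by apply: subset_closure; apply: DF => -[].
apply/le_anti; rewrite oc_outer_ge0 andbT; apply/lee_addgt0Pr => e e0.
have [V [cV VF] /(_ V (conj cV VF) (@subset_refl _ V))] :=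
  oc_clopen_lim phi_op.2 dD clopenT (fun V _ => @subsetT _ V) UD e0.
rewrite -phi_cindC// => /(le_lt_trans (ler_norm _)) small.
rewrite add0e; apply: (@le_trans _ _ (oc_outer (~` V))).
  by apply: oc_outer_mono => x Fx /VF; apply.
rewrite oc_outer_clopen ?lee_fin ?ltW//.
exact: clopen_setC.
Qed.

Lemma open_caratheodory G : open G -> caratheodory_measurable oc_outer_measure G.
Proof.
move=> oG; have -> : G = closure G `\` (closure G `\` G).
  by rewrite setDD; apply/esym/setIidPr; exact: subset_closure.
apply: caratheodory_measurable_setD.
  by apply: clopen_caratheodory; exact: ed_closure_clopen.
apply: le_caratheodory_measurable => A; rewrite /oc_outer_measure/=.
rewrite [X in X + _](_ : _ = 0).
  by rewrite add0e; apply: oc_outer_mono; exact: subIsetl.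
apply/le_anti; rewrite oc_outer_ge0 andbT -(oc_outer_boundary oG).
by apply: oc_outer_mono; exact: subIsetr.
Qed.

Variable x0 : X.
Local Notation T := (borel_space x0).

Lemma borel_caratheodory (A : set T) : measurable A ->
  caratheodory_measurable oc_outer_measure A.
Proof.
apply: smallest_sub => //.
  split.
  - exact: caratheodory_measurable_set0.
  - move=> B mB; rewrite setTD; exact: caratheodory_measurable_setC.
  - by move=> F mF; exact: caratheodory_measurable_bigcup.
exact: open_caratheodory.
Qed.

End OuterMeasure.

Section PositiveCharge.
Context d (T : measurableType d) (R : realType).
Variable m : {finite_measure set T -> \bar R}.
Local Open Scope ereal_scope.
Local Notation nu := (charge_of_finite_measure m).

Section jordan.
Variables (P N : set T) (PN : hahn_decomposition nu P N).

(** A negative set of a nonnegative measure is null, so the choice of Hahn decomposition is harmless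
    and the positive part is the measure itself. *)
Lemma jordan_neg_measure A : measurable A -> jordan_neg PN A = 0.
Proof.
move=> mA; have [_ [mN Nneg] _ _] := PN.
rewrite jordan_negE cjordan_negE /crestr0 mem_set//; apply/eqP; rewrite oppe_eq0.
apply/eqP/le_anti/andP; split.
  by apply: Nneg; [exact: measurableI|exact: subIsetr].
exact: measure_ge0.
Qed.

Lemma jordan_pos_measure A : measurable A -> jordan_pos PN A = m A.
Proof.
move=> mA; have := jordan_decomp PN mA.
rewrite [X in _ = X -> _](_ : _ = jordan_pos PN A + (-1)%:E * jordan_neg PN A)//.
by rewrite jordan_neg_measure// mule0 adde0 => <-.
Qed.

End jordan.

Lemma total_variation_measure A : measurable A -> Defs.total_variation nu A = m A.
Proof.
move=> mA; pose h := svalP (cid (svalP (cid (Hahn_decomposition nu)))).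
rewrite [LHS](_ : _ = jordan_pos h A + jordan_neg h A)//.
by rewrite jordan_pos_measure// jordan_neg_measure// adde0.
Qed.

Lemma charge_integral_measure (f : T -> \bar R) :
  charge_integral nu f = \int[m]_x f x.
Proof.
pose h := svalP (cid (svalP (cid (Hahn_decomposition nu)))).
rewrite [LHS](_ : _ = \int[jordan_pos h]_x f x - \int[jordan_neg h]_x f x)//.
rewrite (eq_measure_integral m); last first.
  by move=> A mA _; exact: jordan_pos_measure.
rewrite [X in _ - X](eq_measure_integral mzero); last first.
  by move=> A mA _; exact: jordan_neg_measure.
by rewrite integral_measure_zero sube0.
Qed.

End PositiveCharge.

Section BorelMeasure.
Context {R : realType} {X : topologicalType}.
Hypothesis X_ed : extremally_disconnected X.
Hypothesis X_reg : regular_space X.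
Variable phi : order_dual (Cfun R X).
Hypothesis phi_op : oc_pos phi.
Variable x0 : X.
Local Notation T := (borel_space x0).
Implicit Types (A B G U V W : set X).
Local Open Scope ereal_scope.

Lemma oc_outer_sigma_additive : semi_sigma_additive (oc_outer phi : set T -> \bar R).
Proof.
move=> F mF tF mUF.
have cara A (mA : measurable (A : set T)) :=
  borel_caratheodory X_ed phi_op X_reg mA.
pose mu : {outer_measure set (pointed_at x0) -> \bar R} := oc_outer_measure X_ed phi_op.
exact: (@caratheodory_measure_sigma_additive R (pointed_at x0) mu F
  (fun n => cara _ (mF n)) tF (cara _ mUF)).
Qed.

Definition oc_borel : set T -> \bar R := oc_outer phi.

Let oc_borel_measure : {measure set T -> \bar R} :=
  HB.pack oc_borel (isMeasure.Build _ T R oc_borel (oc_outer0 X_ed phi_op)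
    (oc_outer_ge0 phi_op) oc_outer_sigma_additive).

Lemma oc_borel_fin : fin_num_fun oc_borel_measure.
Proof. by move=> A _; exact: oc_outer_fin. Qed.

Definition oc_measure : {finite_measure set T -> \bar R} :=
  HB.pack oc_borel (Measure.class oc_borel_measure)
   (@Measure_isFinite.Build _ T R oc_borel_measure oc_borel_fin).


End BorelMeasure.

Section BorelSets.
Context {R : realType} {X : topologicalType} (x0 : X).
Local Notation T := (borel_space x0).

Lemma open_borel (G : set X) : open G -> measurable (G : set T).
Proof. exact: sub_sigma_algebra. Qed.

Lemma closed_borel (F : set X) : closed F -> measurable (F : set T).
Proof.
move=> cF; rewrite -[F]setCK; apply: measurableC.
apply: open_borel; exact: closed_openC.
Qed.

Lemma measurable_cfun (u : Cfun R X) : measurable_fun [set: T] (u : T -> R).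
Proof.
apply: (measurability (@RGenOInfty.G R)); first exact: RGenOInfty.measurableE.
move=> _ [_ [a ->] <-].
rewrite setTI; apply: open_borel.
rewrite (_ : _ @^-1` _ = [set x | a < u x]); first exact: open_cfun_gt.
by apply/seteqP; split=> x /=; rewrite in_itv/= andbT.
Qed.

End BorelSets.

Section Representation.
Context {R : realType} {X : topologicalType}.
Hypothesis X_ed : extremally_disconnected X.
Hypothesis X_rc : realcompact R X.
Variable phi : order_dual (Cfun R X).
Hypothesis phi_op : oc_pos phi.
Variable x0 : X.
Local Notation T := (borel_space x0).
Implicit Types (A B G U V W : set X).
Local Open Scope ereal_scope.

Let X_reg : regular_space X := realcompact_regular X_rc.
Let m := oc_measure X_ed X_reg phi_op x0.
Let K := csupp phi.
Let cK : clopen K := clopen_csupp X_ed phi_op.1 phi_op.2.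

Lemma oc_measure_clopen U : clopen U -> m U = (phi (cind U))%:E.
Proof. exact: oc_outer_clopen. Qed.

Lemma oc_measure_csuppC : m (~` K) = 0.
Proof.
have [cN pN] := csuppC X_ed phi_op.1 phi_op.2.
by rewrite oc_measure_clopen// pN.
Qed.

(** Outer regularity of the complement gives a closed set inside [A]; cutting it with the compact
    support [K], which has full mass, loses nothing. *)
Lemma oc_measure_inner A (e : R) : measurable (A : set T) -> (0 < e)%R ->
  exists C, [/\ compact C, C `<=` A & m A <= m C + e%:E].
Proof.
move=> mA e0.
have mCA : measurable (~` A : set T) by exact: measurableC.
have [G [oG AG Ge]] : exists G, [/\ open G, ~` A `<=` G & m G <= m (~` A) + e%:E].
  have fin := oc_outer_fin phi_op (~` A).
  have : oc_outer phi (~` A) < (fine (oc_outer phi (~` A)) + e)%:E.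
    by rewrite EFinD fineK// lteDl// lte_fin.
  move=> /oc_outer_lt[G [oG AG Ge]]; exists G; split=> //.
  rewrite [leLHS](oc_outer_open X_ed phi_op oG).
  rewrite [X in X + _](_ : _ = oc_outer phi (~` A))// -[oc_outer _ _]fineK//.
  by rewrite -EFinD lee_fin ltW.
have clF := open_closedC oG; have mG : measurable (G : set T) := open_borel oG.
exists (~` G `&` K); split.
- rewrite setIC.
  exact: (compact_closedI (compact_csupp X_ed X_rc phi_op.1 phi_op.2) clF).
- by move=> x [NGx _]; apply: contrapT => /AG.
have mGK : measurable (~` G `&` K : set T).
  by apply: measurableI; [exact: measurableC|apply: closed_borel; exact: cK.2].
have mK : measurable (~` K : set T) by apply: open_borel; exact: closed_openC cK.2.
have sub : A `<=` (~` G `&` K) `|` ((G `\` ~` A) `|` ~` K).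
  move=> x Ax; have [Kx|NKx] := pselect (K x); last by right; right.
  have [Gx|NGx] := pselect (G x); last by left.
  by right; left; split=> //; apply.
have mGA : measurable (G `\` ~` A : set T) by exact: measurableD.
have mGA_le : m (G `\` ~` A) <= e%:E.
  rewrite measureD//; last by rewrite ltey_eq fin_num_measure.
  rewrite setIC (setIidl AG) leeBlDl// ?fin_num_measure//.
apply: (@le_trans _ _ (m ((~` G `&` K) `|` ((G `\` ~` A) `|` ~` K)))).
  by apply: le_measure; rewrite ?inE//; apply: measurableU => //; exact: measurableU.
apply: le_trans (measureU2 _ mGK _) _; first exact: measurableU.
apply: leeD => //; apply: le_trans (measureU2 _ mGA mK) _.
rewrite [X in _ + X](_ : _ = 0) ?adde0//; exact: oc_measure_csuppC.
Qed.

Local Notation nu := (charge_of_finite_measure m).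

Lemma oc_radon_charge : radon_charge nu.
Proof.
move=> A mA; rewrite total_variation_measure//; have [hX _ _] := X_rc.
have tvK C : compact (C : set X) -> Defs.total_variation nu C = m C.
  move=> cC; apply: total_variation_measure; apply: closed_borel.
  exact: compact_closed.
apply/le_anti/andP; split.
  apply/lee_addgt0Pr => e e0.
  have [C [cC CA mC]] := oc_measure_inner mA e0.
  apply: (le_trans mC); apply: leeD => //.
  by apply: ereal_sup_ubound; exists C => //; exact: tvK.
apply: ge_ereal_sup => _ [C [cC CA] <-]; rewrite tvK//.
by apply: le_measure; rewrite ?inE//; apply: closed_borel; exact: compact_closed.
Qed.

Lemma oc_charge_support : charge_support nu = csupp phi.
Proof.
apply/seteqP; split=> x /= xS U.
  move=> cU Ux; have := xS U cU.1 Ux.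
  rewrite total_variation_measure; last exact: open_borel cU.1.
  by rewrite oc_measure_clopen// lte_fin.
move=> oU Ux; have [|W [cW Wx WU]] := clopen_nbhs X_ed X_reg (x := x) (U := U).
  exact: open_nbhs_nbhs.
rewrite total_variation_measure; last exact: open_borel.
apply: (@lt_le_trans _ _ (m W)); first by rewrite oc_measure_clopen// lte_fin xS.
by apply: le_measure; rewrite ?inE//; apply: open_borel => //; exact: cW.1.
Qed.

Lemma oc_integrable (u : Cfun R X) : m.-integrable setT (fun x => (u x)%:E).
Proof.
have mK : measurable (K : set T) by apply: open_borel; exact: cK.1.
have mf : measurable_fun [set: T] (EFin \o (u : T -> R)).
  by apply/measurable_EFinP; exact: measurable_cfun.
have [_] := @negligible_integrable _ T R m setT (~` K) _ (measurableC mK)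
  measurableT mf oc_measure_csuppC.
apply; rewrite setTD setCK.
have [n nP] := csupp_bounded X_ed X_reg u phi_op.1.
apply: measurable_bounded_integrable => //.
- by rewrite ltey_eq fin_num_measure.
- by apply: measurable_funTS; exact: measurable_cfun.
exists n%:R; split; first exact: num_real.
move=> M nM x Kx; exact: le_trans (nP x Kx) (ltW nM).
Qed.

(** Integration is itself an order bounded functional, and by [obl_eq] it suffices to compare it
    with [phi] on clopen indicators. *)
Lemma oc_integral (u : Cfun R X) : (phi u)%:E = \int[m]_x (u x)%:E.
Proof.
have intE (v : Cfun R X) : (fine (\int[m]_x (v x)%:E))%:E = \int[m]_x (v x)%:E.
  by rewrite fineK//; apply: integrable_fin_num => //; exact: oc_integrable.
pose I (v : Cfun R X) : R^o := fine (\int[m]_x (v x)%:E).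
have I_obl : obl_functional I.
  apply: positive_obl.
    move=> a v w; apply: EFin_inj; rewrite /I intE.
    rewrite [RHS](_ : _ = (a * fine (\int[m]_x (v x)%:E) +
      fine (\int[m]_x (w x)%:E))%:E)//.
    rewrite EFinD EFinM !intE -integralZl//; last exact: oc_integrable.
    rewrite -integralD//; last exact: oc_integrable.
    by have := oc_integrable (a *: v).
  by move=> v v0; apply: fine_ge0; apply: integral_ge0 => x _; rewrite lee_fin cfun_ge0x.
suff -> : phi = OrderDual I_obl by rewrite -intE.
apply: (obl_eq X_ed) => U cU; apply: EFin_inj.
rewrite [RHS](_ : _ = (fine (\int[m]_x (cind U x)%:E))%:E)// intE.
rewrite (eq_integral (fun x : T => (\1_U x)%:E)); last first.
  by move=> x _; rewrite cindE// indicE.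
rewrite integral_indic//; last by apply: open_borel; exact: cU.1.
by rewrite setIT; apply/esym; exact: oc_measure_clopen.
Qed.

Lemma oc_represents : represents nu phi.
Proof.
split; first exact: oc_radon_charge.
  by rewrite oc_charge_support; exact: compact_csupp X_ed X_rc _ phi_op.1 phi_op.2.
by move=> u; rewrite charge_integral_measure oc_integral.
Qed.

End Representation.

(** * Supports of arbitrary representing charges *)

Section SupportUnion.
Context {R : realType} {X : topologicalType}.
Hypothesis X_ed : extremally_disconnected X.
Hypothesis X_rc : realcompact R X.

(** Otherwise the sets C \ W, for clopen W inside O, would generate a proper filter on C, and a
    clopen neighbourhood in O of a cluster point gives a contradiction. *)
Lemma clopen_compact_nbhs (C O : set X) : compact C -> open O -> C `<=` O ->
  exists W, [/\ clopen W, C `<=` W & W `<=` O].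
Proof.
move=> cC oO CO; have X_reg := realcompact_regular X_rc.
apply: contrapT => nW.
pose F : set_system X := [set A | exists W, [/\ clopen W, W `<=` O & C `\` W `<=` A]].
have FF : ProperFilter F.
  split=> [[W [cW WO CW]]|].
    apply: nW; exists W; split=> // x Cx; apply: contrapT => NWx.
    exact: (CW x (conj Cx NWx)).
  split.
  - by exists set0; split=> //; exact: clopen0.
  - move=> A B [V [cV VO CV]] [W [cW WO CW]]; exists (V `|` W); split.
    + exact: clopenU.
    + by rewrite subUset.
    + by move=> x [Cx /not_orP[NV NW]]; split; [exact: CV|exact: CW].
  - by move=> A B AB [W [cW WO CW]]; exists W; split=> //; exact: subset_trans AB.
have FC : F C.
  by exists set0; split=> //; exact: clopen0.
have [x [Cx clx]] := cC F FF FC.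
have [W [cW Wx WO]] := clopen_nbhs X_ed X_reg (open_nbhs_nbhs (conj oO (CO x Cx))).
have FW : F (C `\` W) by exists W; split.
have [y [[_ NWy] Wy]] := clx _ _ FW (open_nbhs_nbhs (conj cW.1 Wx)).
exact: NWy.
Qed.

Local Open Scope ereal_scope.

(** Works for any representing charge, without uniqueness. If |phi| killed a clopen U around x, the
    Jordan parts of the charge would agree on all clopen subsets of U; yet they live on disjoint
    sets, which inner regularity and a clopen separation detect. *)
Lemma functional_support_subset (phi : oc_dual (Cfun R X)) :
  functional_support phi `<=` oc_csupp (R := R).
Proof.
move=> x [nu [rad _ rep] xs]; have [hX _ _] := X_rc.
have phic := oc_dualP phi; set p := oc_dual_val phi in rep phic.
pose psi : order_dual (Cfun R X) := (odual_pos p + (odual_pos p - p))%R.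
have ppc : order_continuous (odual_pos p) := odual_pos_oc phic.
have oc_psi : oc_pos psi.
  split; first by apply: vl_addr_ge0; [exact: odual_pos_ge0|exact: odual_neg_ge0].
  by apply: order_continuousD => //; exact: order_continuousB.
have psi_ge u : (0 <= u)%R -> (`|p u| <= psi u)%R.
  move=> u0; rewrite [psi u](_ : _ = odual_pos p u + (odual_pos p u - p u))%R//.
  have h1 := odual_ge0 (odual_pos_ge0 p) u0.
  have h2 : (0 <= odual_pos p u - p u)%R := odual_ge0 (odual_neg_ge0 p) u0.
  by move: h1 h2; rewrite ler_norml => ? ?; apply/andP; split; lra.
exists psi => // U cU Ux; rewrite lt_neqAle (odual_ge0 oc_psi.1 (cind_ge0 U)) andbT.
apply/negP => /eqP psiU.
pose h := svalP (cid (svalP (cid (Hahn_decomposition nu)))).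
set P := sval (cid (Hahn_decomposition nu)) in h.
set N := sval (cid (svalP (cid (Hahn_decomposition nu)))) in h.
have [[mP Ppos] [mN Nneg] PN PN0] := h.
pose jp : {finite_measure set (borel_space x) -> \bar R} := jordan_pos h.
pose jn : {finite_measure set (borel_space x) -> \bar R} := jordan_neg h.
have tvE A : Defs.total_variation nu A = jp A + jn A by [].
have mO (A : set X) : open A -> measurable (A : set (borel_space x)) by exact: open_borel.
have mU := mO _ cU.1.
have jW W : clopen W -> W `<=` U -> jp W = jn W.
  move=> cW WU; have mW := mO _ cW.1.
  have pW : p (cind W) = 0%R.
    apply/eqP; rewrite -normr_le0 psiU; apply: (le_trans (psi_ge _ (cind_ge0 _))).
    by apply: odual_mono; [exact: oc_psi.1|exact: cind_le].
  have := rep (cind W); rewrite pW.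
  rewrite [X in _ = X -> _](_ : _ = \int[jp]_y (cind W y)%:E -
    \int[jn]_y (cind W y)%:E)//.
  have e (mu : {measure set (borel_space x) -> \bar R}) :
      \int[mu]_y (cind W y : R)%:E = mu W.
    rewrite (eq_integral (fun y : borel_space x => (\1_W y)%:E)); last first.
      by move=> y _; rewrite cindE// indicE.
    by rewrite integral_indic// setIT.
  have fp : jp W \is a fin_num by rewrite fin_num_measure.
  have fn : jn W \is a fin_num by rewrite fin_num_measure.
  rewrite !e => jpn; rewrite -(fineK fp) -(fineK fn).
  have : 0%:E = (fine (jp W) - fine (jn W))%:E by rewrite EFinB !fineK.
  by move=> -[e0]; congr _%:E; apply/eqP; rewrite -subr_eq0 -e0.
have jpN A : measurable A -> A `<=` N -> jp A = 0.
  move=> mA AN; rewrite [LHS](_ : _ = crestr0 nu mP A)// /crestr0 mem_set// /crestr.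
  suff -> : A `&` P = set0 by rewrite charge0.
  by apply/seteqP; split=> // y [/AN Ny Py]; rewrite -PN0.
have jnP A : measurable A -> A `<=` P -> jn A = 0.
  move=> mA AP; rewrite [LHS](jordan_negE h A) cjordan_negE /crestr0 mem_set// /crestr.
  suff -> : A `&` N = set0 by rewrite charge0 oppe0.
  by apply/seteqP; split=> // y [/AP Py Ny]; rewrite -PN0.
have mUP : measurable (U `&` P : set (borel_space x)) by exact: measurableI.
have mUN : measurable (U `&` N : set (borel_space x)) by exact: measurableI.
have U_PN : U = (U `&` P) `|` (U `&` N) by rewrite -setIUr PN setIT.
have dPN : (U `&` P) `&` (U `&` N) = set0 by rewrite setIACA PN0 setI0.
have jpU : jp (U `&` P) = jp U.
  by rewrite [in RHS]U_PN measureU// [X in _ + X]jpN ?adde0//; exact: subIsetr.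
have jnU : jn (U `&` N) = jn U.
  by rewrite [in RHS]U_PN measureU// [X in X + _]jnP ?add0e//; exact: subIsetr.
pose a := fine (jp U).
have jpa : jp U = a%:E by rewrite fineK// fin_num_measure.
have jna : jn U = a%:E by rewrite -jW.
have a0 : (0 < a)%R.
  have := xs U cU.1 Ux; rewrite tvE jpa jna -EFinD lte_fin; lra.
have inner (A : set (borel_space x)) : measurable A -> jp A + jn A = a%:E ->
    exists C, [/\ compact (C : set X), C `<=` A & (a - a / 4)%:E < jp C + jn C].
  move=> mA jA; have : (a - a / 4)%:E < ereal_sup [set Defs.total_variation nu C |
      C in [set C | compact (C : set X) /\ C `<=` A]].
    by rewrite -rad// tvE jA lte_fin; lra.
  by move=> /ereal_sup_gt[_ [C [cC CA] <-]]; exists C.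
have [C [cC CUP jpC]] : exists C, [/\ compact (C : set X), C `<=` U `&` P &
    (a - a / 4)%:E < jp C + jn C].
  by apply: inner => //; rewrite jpU jnP ?adde0//; exact: subIsetr.
have [C' [cC' CUN jnC']] : exists C, [/\ compact (C : set X), C `<=` U `&` N &
    (a - a / 4)%:E < jp C + jn C].
  by apply: inner => //; rewrite jnU jpN ?add0e//; exact: subIsetr.
have clC : closed (C : set X) by exact: compact_closed.
have clC' : closed (C' : set X) by exact: compact_closed.
have mC : measurable (C : set (borel_space x)) by exact: closed_borel.
have mC' : measurable (C' : set (borel_space x)) by exact: closed_borel.
rewrite (jnP C)// ?adde0 in jpC; last by move=> y /CUP[].
rewrite (jpN C')// ?add0e in jnC'; last by move=> y /CUN[].
(* [W] carries more than 3a/4 of the positive part, but misses [C'] and so carries less than a/4 of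
   the negative part, although the two agree on [W]. *)
have [W [cW CW WUC']] : exists W, [/\ clopen W, C `<=` W & W `<=` U `\` C'].
  apply: clopen_compact_nbhs => //.
    by rewrite setDE; apply: openI; [exact: cU.1|exact: closed_openC].
  move=> y Cy; have [Uy Py] := CUP _ Cy; split=> // /CUN[_ Ny].
  by have : (P `&` N) y by []; rewrite PN0.
have WU : W `<=` U by move=> y /WUC'[].
have mW := mO _ cW.1.
have jpW : (a - a / 4)%:E < jp W.
  by apply: (lt_le_trans jpC); apply: le_measure; rewrite ?inE.
have jnW : jn W + jn C' <= a%:E.
  rewrite -measureU//; last by apply/seteqP; split=> // y [/WUC'[]].
  rewrite -jna; apply: le_measure; rewrite ?inE//; first exact: measurableU.
  by move=> y [/WU//|/CUN[]].
rewrite jW// in jpW.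
have : (a - a / 4)%:E + (a - a / 4)%:E < a%:E.
  by apply: lt_le_trans jnW; apply: lteD.
by rewrite -EFinD lte_fin; lra.
Qed.

Lemma oc_support_unionE : oc_support_union R X = oc_csupp (R := R).
Proof.
apply/seteqP; split=> x; first by move=> [phi _]; exact: functional_support_subset.
move=> [phi op Kx]; exists (OcDual (asboolT op.2)) => //=.
exists (charge_of_finite_measure (oc_measure X_ed (realcompact_regular X_rc) op x)).
  exact: oc_represents.
by rewrite oc_charge_support.
Qed.

End SupportUnion.

Theorem theorem6p21 (R : realType) (X : topologicalType)
    (X_ed : extremally_disconnected X) (X_rc : realcompact R X) :
  [<-> exists E : vectorLatticeType R,
         lattice_isomorphic (Cfun R X) (order_dual E);
       perfect (Cfun R X);
       lattice_isomorphism (@cfun_restr R X (oc_support_union R X));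
       lattice_isomorphism_onto (limit_projection (oc_carriers (Cfun R X)))
         (inverse_limit (oc_carriers (Cfun R X)))].
Proof.
have X_reg := realcompact_regular X_rc.
rewrite (oc_support_unionE X_ed X_rc).
tfae.
- move=> [E CE]; apply: extension_perfect => //.
  exact: order_dual_extension CE.
- by move=> /(perfect_extension X_ed)/(restriction_ext X_ed).
- by move=> /(restriction_ext X_ed)/(limit_projection_ext X_ed X_reg).
(* The order continuous dual of C(X) serves as predual. *)
- move=> /(limit_projection_ext X_ed X_reg) ext.
  exists (oc_dual (Cfun R X)); exists (@eval_map R X).
  exact: extension_dual.
Qed.
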